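(* Let $\beta\in[0,1]$ and let $U:\mathbb{R}^d\to\mathbb{R}$ be twice continuously differentiable such that $\int e^{-U}<\infty$, there exists $L_1\ge0$ with $\|\nabla U(q)-\nabla U(\tilde q)\|\le L_1\|q-\tilde q\|$ for all $q,\tilde q$, and there exists $M_1\ge0$ with $\|\nabla U(q)\|\le M_1(1+\|q\|^\beta)$ for all $q$. Then for every $T\in\mathbb{N}^*$ there exists $\tilde h_T>0$ such that for every $h\in(0,\tilde h_T]$, the HMC kernel $P_{h,T}$ is irreducible, the Lebesgue measure is an irreducibility measure for it, and $P_{h,T}$ is aperiodic and Harris recurrent. Consequently, for all $q\in\mathbb{R}^d$, $\lim_{n\to\infty}\|\delta_q P_{h,T}^n-\pi\|_{TV}=0$.
   Context: $\pi$ is the probability density on $\mathbb{R}^d$ proportional to $e^{-U}$. $H(q,p)=U(q)+\|p\|^2/2$. For $h>0$, the leapfrog map is $\Phi_h=\Psi^{(1)}_h\circ\Psi^{(2)}_h\circ\Psi^{(1)}_h$ with $\Psi^{(1)}_h(q,p)=(q,p-(h/2)\nabla U(q))$, $\Psi^{(2)}_h(q,p)=(q+hp,p)$; $\Phi_h^{\circ T}$ is its $T$-fold composition and $\Phi^{q,T}_h$ the position (first) component of $\Phi_h^{\circ T}$. Let $\alpha_H((q,p),(\tilde q,\tilde p))=\min[1,\exp(H(q,p)-H(\tilde q,\tilde p))]$ and $\varphi(p)=(2\pi)^{-d/2}e^{-\|p\|^2/2}$. The HMC kernel is the Markov kernel on $\mathbb{R}^d$ $$P_{h,T}(q,A)=\int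 1_A(\Phi^{q,T}_h(q,p))\,\alpha_H((q,p),\Phi_h^{\circ T}(q,p))\varphi(p)\,dp+\delta_q(A)\int[1-\alpha_H((q,p),\Phi_h^{\circ T}(q,p))]\varphi(p)\,dp.$$ A Markov kernel $P$ is irreducible with irreducibility measure $\mu$ (a nontrivial $\sigma$-finite measure) if every Borel set $A$ with $\mu(A)>0$ is accessible, i.e. $\sum_{m\ge1}P^m(x,A)>0$ for all $x$. $P$ is Harris recurrent if for every accessible set $A$ and every $x$, the chain started at $x$ visits $A$ infinitely often almost surely. $\|\cdot\|_{TV}$ is the total variation norm. *)

(* Defs.v *)
From HB Require Import structures.
From mathcomp Require Import all_boot all_order all_algebra.
From mathcomp Require Import all_classical all_reals all_analysis.

Set Implicit Arguments.
Unset Strict Implicit.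
Unset Printing Implicit Defensive.

Import Order.TTheory GRing.Theory Num.Theory.
Import numFieldNormedType.Exports.

Local Open Scope classical_set_scope.
Local Open Scope ring_scope.

Definition Vec (R : realType) (d : nat) := 'rV[R]_d.

Definition Bor (R : realType) (d : nat) :=
  g_sigma_algebraType (@open ('rV[R]_d)).

Definition sqnorm (R : realType) (d : nat) (v : 'rV[R]_d) : R :=
  \sum_(i < d) (v 0 i) ^+ 2.
Definition enorm (R : realType) (d : nat) (v : 'rV[R]_d) : R :=
  Num.sqrt (sqnorm v).

Definition ebasis (R : realType) (d : nat) (i : 'I_d) : 'rV[R]_d :=
  delta_mx 0 i.

Definition grad (R : realType) (d : nat) (U : 'rV[R]_d -> R) (q : 'rV[R]_d)
  : 'rV[R]_d := \row_i derive U q (@ebasis R d i).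

Definition hessian (R : realType) (d : nat) (U : 'rV[R]_d -> R)
  (q : 'rV[R]_d) : 'M[R]_d :=
  \matrix_(i, j) derive (fun y => derive U y (@ebasis R d i)) q (@ebasis R d j).

Definition C2 (R : realType) (d : nat) (U : 'rV[R]_d -> R) : Prop :=
  (forall q, differentiable U q) /\
  (forall q, differentiable (grad U) q) /\
  continuous (hessian U).

(* lam is the Lebesgue measure on the Borel sets of R^d: it gives every
   closed box its volume (this characterizes it uniquely on Borel sets). *)
Definition is_lebesgue (R : realType) (d : nat)
  (lam : {measure set (Bor R d) -> \bar R}) : Prop :=
  forall a b : 'rV[R]_d, (forall i, a 0 i <= b 0 i) ->
    lam [set x : Bor R d | forall i, a 0 i <= x 0 i <= b 0 i]
      = (\prod_(i < d) (b 0 i - a 0 i))%:E.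

Section HMC.
Variables (R : realType) (d : nat) (U : 'rV[R]_d -> R).

Definition Ham (z : 'rV[R]_d * 'rV[R]_d) : R := U z.1 + sqnorm z.2 / 2.

Definition Psi1 (h : R) (z : 'rV[R]_d * 'rV[R]_d) : 'rV[R]_d * 'rV[R]_d :=
  (z.1, z.2 - (h / 2) *: grad U z.1).
Definition Psi2 (h : R) (z : 'rV[R]_d * 'rV[R]_d) : 'rV[R]_d * 'rV[R]_d :=
  (z.1 + h *: z.2, z.2).

Definition leapfrog (h : R) (z : 'rV[R]_d * 'rV[R]_d) :=
  Psi1 h (Psi2 h (Psi1 h z)).

Definition leapfrogT (h : R) (T : nat) (z : 'rV[R]_d * 'rV[R]_d) :=
  iter T (leapfrog h) z.
Definition leapfrogT_q (h : R) (T : nat) (z : 'rV[R]_d * 'rV[R]_d) :=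
  (leapfrogT h T z).1.

Definition alphaH (z z' : 'rV[R]_d * 'rV[R]_d) : R :=
  Num.min 1 (expR (Ham z - Ham z')).

Definition gauss (p : 'rV[R]_d) : R :=
  powR (2 * pi) (- (d%:R / 2)) * expR (- (sqnorm p / 2)).

(* The HMC kernel P_{h,T}, given by its action on nonnegative functions
   f : R^d -> [0,+oo]:
     (P f)(q) = int f(Phi^{q,T}_h(q,p)) alpha_H((q,p),Phi^T_h(q,p)) phi(p) dp
              + f(q) int [1 - alpha_H((q,p),Phi^T_h(q,p))] phi(p) dp.
   With f = 1_A this is exactly P_{h,T}(q,A) as in the paper. *)
Definition HMCop (lam : {measure set (Bor R d) -> \bar R}) (h : R) (T : nat)
  (f : Bor R d -> \bar R) (q : Bor R d) : \bar R :=
  (\int[lam]_(p in [set: Bor R d])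
      (f (leapfrogT_q h T (q, p) : Bor R d) *
       (alphaH (q, p) (leapfrogT h T (q, p)) * gauss p)%:E)
   + f q * \int[lam]_(p in [set: Bor R d])
      ((1 - alphaH (q, p) (leapfrogT h T (q, p))) * gauss p)%:E)%E.

Definition piU (lam : {measure set (Bor R d) -> \bar R}) (A : set (Bor R d))
  : \bar R :=
  (\int[lam]_(x in A) (expR (- U x) /
     fine (\int[lam]_(y in [set: Bor R d]) (expR (- U y))%:E))%:E)%E.

End HMC.

(* Generic Markov-kernel notions, for a kernel given through its action *)
(* K on nonnegative functions (so K 1_A x = K(x,A) and the n-th iterate  *)
(* is K^n f = K (K^(n-1) f)).                                           *)

Section Kernels.
Variables (R : realType) (dsp : measure_display) (X : measurableType dsp).
Variable K : (X -> \bar R) -> X -> \bar R.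

Definition indic (A : set X) : X -> \bar R := fun y => (\1_A y)%:E.

Definition kpow (m : nat) (A : set X) (x : X) : \bar R :=
  iter m K (indic A) x.

Definition accessible (A : set X) : Prop :=
  forall x, exists m, (0 < m)%N /\ (0 < kpow m A x)%E.

Definition irr_measure (mu : {measure set X -> \bar R}) : Prop :=
  (0 < mu setT)%E /\ sigma_finite setT mu /\
  forall A, measurable A -> (0 < mu A)%E -> accessible A.

Definition irreducible : Prop :=
  exists mu : {measure set X -> \bar R}, irr_measure mu.

Definition small_for (C : set X) (m : nat) (g : set X -> \bar R) : Prop :=
  forall x, C x -> forall B, measurable B -> (g B <= kpow m B x)%E.

(* Aperiodicity (Meyn--Tweedie, Sec. 5.4.3): for an accessible
   nu_M-small set C with nu_M(C) > 0, the period of C is the gcd of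
   E_C = {n >= 1 : C is (n, delta_n nu_M)-small for some delta_n > 0};
   the kernel is aperiodic if this period is 1 (it does not depend on C).
   "gcd E_C = 1" is written as: no k >= 2 divides every element of E_C. *)
Definition aperiodic : Prop :=
  forall (C : set X) (M : nat) (nu : {measure set X -> \bar R}),
    measurable C -> accessible C -> (0 < M)%N ->
    (0 < nu setT)%E -> small_for C M nu -> (0 < nu C)%E ->
    forall k : nat, (1 < k)%N ->
      exists n : nat, [/\ (0 < n)%N, ~~ (k %| n)%N &
        exists delta : R, 0 < delta /\
          small_for C n (fun B => (delta%:E * nu B)%E)].

(* hit A n x = P_x(the chain visits A at some time in {1,...,n}) *)
Fixpoint hit (A : set X) (n : nat) : X -> \bar R :=
  match n with
  | 0 => fun _ => 0%E
  | n'.+1 => K (fun y => (indic A y + indic (~` A) y * hit A n' y)%E)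
  end.

Definition hitprob (A : set X) (x : X) : \bar R :=
  ereal_sup [set hit A n x | n in [set: nat]].

(* Harris recurrence: for every accessible A and every x, the chain started
   at x visits A infinitely often a.s., i.e. for every m,
   P_x(visit A at some time > m) = (K^m L(.,A))(x) = 1. *)
Definition harris_recurrent : Prop :=
  forall A, measurable A -> accessible A ->
    forall x (m : nat), iter m K (hitprob A) x = 1%E.

(* total variation norm of the signed measure delta_x K^n - pi, i.e.
   |xi|(X) = sup_A xi(A) - inf_A xi(A) (Hahn decomposition) *)
Definition tv_dist (pi : set X -> \bar R) (n : nat) (x : X) : \bar R :=
  (ereal_sup [set (kpow n A x - pi A)%E | A in [set A | measurable A]] -
   ereal_inf [set (kpow n A x - pi A)%E | A in [set A | measurable A]])%E.

End Kernels.

(* Main.v *)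
Require Import Defs.
From HB Require Import structures.
From mathcomp Require Import all_boot all_order all_algebra.
From mathcomp Require Import all_classical all_reals all_analysis.
From mathcomp Require Import measurable_realfun zify ring lra.
Set Implicit Arguments.
Unset Strict Implicit.
Unset Printing Implicit Defensive.
Import Order.TTheory GRing.Theory Num.Theory.
Import numFieldNormedType.Exports.
Local Open Scope classical_set_scope.
Local Open Scope ring_scope.

(* Let G_q(p) be the position reached after T leapfrog steps from (q, p).
   - If 4 L T^2 h^2 <= 1 then p |-> G_q(p) - h T p is (h T / 2)-Lipschitz, so G_q
     is a bi-Lipschitz bijection. Comparing the images of Lebesgue measure on
     balls, then on all Borel sets, shows that the image of Lebesgue measure
     under G_q lies between two multiples of it. Hence the moving part of the
     kernel has a density with respect to pi, every ball C satisfies a one-step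
     minorization K(x, .) >= e pi(. /\ C) for x in C, and the probability r(x)
     of staying put is < 1.
   - Flipping the momentum turns the leapfrog map into a measure preserving
     involution, so the kernel is reversible.
   - For f with values in [0, 1], pi(f^2) - pi((K f)^2) is the mean variance of f
     under K(x, .), which by the minorization controls the variance of f on C.
     Applied to K^n f, this makes K^n f converge to pi(f) in L^1(pi).
   - By reversibility (u pi) K^n = (K^n u) pi converges to pi(u) pi in total
     variation for every density u. With the density u_x of the moving part at
     x, the distance e_n between K^n(x, .) and pi satisfies
     e_(n+1) <= r(x) e_n + b_n with b_n -> 0, so e_n -> 0 for every x.
   - The hitting probability l of a set A with pi(A) > 0 satisfies K l <= l, so
     l >= lim K^n l = pi(l) =: c, and integrating l = K (1_A + 1_(~A) l) forces
     c = 1. *)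

(** * Reversible kernels with a holding atom *)

(** The holding atom shapes the argument: K(x, .) has no density with respect to pi, so a
    convergence result in L^1(pi) says nothing directly about a given starting point. Reversibility
    is therefore applied only to initial laws with a density, and the atom is paid for separately
    through the contraction factor r(x) < 1. What is needed of the kernel for this is collected in
    [rev_chain], and the limit theorems are proved for any such [K]. On the HMC side, [lam] is known
    only by its values on boxes, and G_q only through Lipschitz bounds. Balls for the sup norm are
    boxes, so the preimages of balls under G_q can be compared with balls, and the inequality
    between measures of balls is carried to Borel sets by averaging over centers. Volume
    preservation comes from the shape of the leapfrog map: each factor shifts one variable by a
    function of the other, so translation invariance and Tonelli suffice. Small [h] serves to keep
    the force a perturbation of free motion: over all [T] steps it changes a difference of momenta
    by at most half. *)

Definition nmf {R : realType} {dsp} {X : measurableType dsp} (f : X -> \bar R) :=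
  measurable_fun setT f /\ forall x, (0 <= f x)%E.

(* [K] acts on nonnegative functions. By [chain_rep] the law [K(x, .)] is the
   density [u] with respect to [P] plus an atom of mass [r < 1] at [x]. *)
Record rev_chain {R : realType} {dsp} {X : measurableType dsp}
  (P : probability X R) (K : (X -> \bar R) -> X -> \bar R) : Prop := RevChain {
  chain_meas : forall f, nmf f -> measurable_fun setT (K f);
  chain_rep : forall x, exists (u : X -> R) (r : R),
    [/\ measurable_fun setT u, forall y, 0 <= u y, 0 <= r < 1,
        (\int[P]_y (u y)%:E)%E = (1 - r)%:E &
        forall f, nmf f -> K f x = (\int[P]_y ((u y)%:E * f y) + r%:E * f x)%E];
  chain_rev : forall f g, nmf f -> nmf g ->
    (\int[P]_x (f x * K g x) = \int[P]_x (g x * K f x))%E;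
  chain_minor : exists C : nat -> set X,
    [/\ forall n, measurable (C n), nondecreasing_seq C,
        \bigcup_n C n = setT &
        forall n, exists2 e : R, 0 < e & forall x f, C n x -> nmf f ->
          (e%:E * \int[P]_(y in C n) f y <= K f x)%E] }.

Section NonnegMeasurable.
Context {R : realType} {dsp : measure_display} {X : measurableType dsp}.

Lemma nmf_cst (c : R) : 0 <= c -> nmf (fun _ : X => c%:E).
Proof. by move=> c0; split; [exact: measurable_cst | move=> ?; rewrite lee_fin]. Qed.

Lemma nmfD f g : @nmf R _ X f -> nmf g -> nmf (fun x => f x + g x)%E.
Proof.
move=> [mf f0] [mg g0]; split; first exact: emeasurable_funD.
by move=> x; rewrite adde_ge0.
Qed.

Lemma nmfM f g : @nmf R _ X f -> nmf g -> nmf (fun x => f x * g x)%E.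
Proof.
move=> [mf f0] [mg g0]; split; first exact: emeasurable_funM.
by move=> x; rewrite mule_ge0.
Qed.

Lemma nmf_indic (A : set X) : measurable A -> nmf (@Defs.indic R _ X A).
Proof.
move=> mA; split; last by move=> x; rewrite lee_fin.
by apply/measurable_EFinP; exact: measurable_indic.
Qed.

Lemma nmf_sup (f : nat -> X -> \bar R) : (forall n, nmf (f n)) ->
  nmf (fun y => ereal_sup (range (f ^~ y))).
Proof.
move=> nf; split.
  have := @measurable_fun_esups _ _ _ setT f (fun n => (nf n).1) 0%N.
  congr measurable_fun; apply/funext => x; congr ereal_sup.
  by apply/seteqP; split => [_ [n _ <-]|_ [n _ <-]]; exists n.
move=> x; apply: (le_trans ((nf 0%N).2 x)); apply: ereal_sup_ubound.
by exists 0%N.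
Qed.

Lemma int_nmfD (mu : {measure set X -> \bar R}) f g : nmf f -> nmf g ->
  (\int[mu]_x (f x + g x) = \int[mu]_x f x + \int[mu]_x g x)%E.
Proof. by move=> [mf f0] [mg g0]; rewrite ge0_integralD. Qed.

Lemma int_nmfZ (mu : {measure set X -> \bar R}) (c : R) f : 0 <= c -> nmf f ->
  (\int[mu]_x (c%:E * f x) = c%:E * \int[mu]_x f x)%E.
Proof. by move=> c0 [mf f0]; rewrite ge0_integralZl. Qed.

Lemma int_nmf_le (mu : {measure set X -> \bar R}) f g : nmf f -> nmf g ->
  (forall x, (f x <= g x)%E) -> (\int[mu]_x f x <= \int[mu]_x g x)%E.
Proof. by move=> [mf f0] [mg g0] fg; apply: ge0_le_integral. Qed.

End NonnegMeasurable.

Section ChainOperator.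
Context {R : realType} {dsp : measure_display} {X : measurableType dsp}.
Variables (P : probability X R) (K : (X -> \bar R) -> X -> \bar R).
Hypothesis Hc : rev_chain P K.

(** Linearity, monotonicity and monotone continuity of [K] are not fields of [rev_chain]: this lemma
    and the next ones read them off, point by point, from the integral representation
    [chain_rep]. *)
Lemma K_ge0 f x : nmf f -> (0 <= K f x)%E.
Proof.
move=> nf; have [u [r [mu u0 /andP[r0 _] _ E]]] := chain_rep Hc x.
rewrite E// adde_ge0//; last by rewrite mule_ge0 ?lee_fin//; exact: nf.2.
by apply: integral_ge0 => y _; rewrite mule_ge0 ?lee_fin//; exact: nf.2.
Qed.

Lemma K_nmf f : nmf f -> nmf (K f).
Proof. by move=> nf; split; [exact: (chain_meas Hc) | move=> x; exact: K_ge0]. Qed.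

Lemma K_D f g x : nmf f -> nmf g -> K (fun y => f y + g y)%E x = (K f x + K g x)%E.
Proof.
move=> nf ng; have [u [r [mu u0 /andP[r0 _] _ E]]] := chain_rep Hc x.
have nu : nmf (fun y => (u y)%:E).
  by split; [exact/measurable_EFinP | move=> y; rewrite lee_fin].
rewrite !E//; last exact: nmfD.
under eq_integral do rewrite muleDr ?ge0_adde_def ?inE ?(nf.2, ng.2)//.
rewrite ge0_integralD//.
- by rewrite muleDr ?ge0_adde_def ?inE ?(nf.2, ng.2)// addeACA.
- by move=> y _; exact: (nmfM nu nf).2.
- exact: (nmfM nu nf).1.
- by move=> y _; exact: (nmfM nu ng).2.
- exact: (nmfM nu ng).1.
Qed.

Lemma K_Z (c : R) f x : 0 <= c -> nmf f ->
  K (fun y => c%:E * f y)%E x = (c%:E * K f x)%E.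
Proof.
move=> c0 nf; have [u [r [mu u0 /andP[r0 _] _ E]]] := chain_rep Hc x.
have nu : nmf (fun y => (u y)%:E).
  by split; [exact/measurable_EFinP | move=> y; rewrite lee_fin].
rewrite !E//; last by apply: nmfM => //; exact: nmf_cst.
under eq_integral do rewrite muleCA.
rewrite ge0_integralZl//; last 2 first.
- exact: (nmfM nu nf).1.
- by move=> y _; exact: (nmfM nu nf).2.
rewrite muleCA -muleDr// ge0_adde_def// inE.
  by apply: integral_ge0 => y _; exact: (nmfM nu nf).2.
by rewrite mule_ge0// ?lee_fin//; exact: nf.2.
Qed.

Lemma K_le f g x : nmf f -> nmf g -> (forall y, (f y <= g y)%E) -> (K f x <= K g x)%E.
Proof.
move=> nf ng fg; have [u [r [mu u0 /andP[r0 _] _ E]]] := chain_rep Hc x.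
have nu : nmf (fun y => (u y)%:E).
  by split; [exact/measurable_EFinP | move=> y; rewrite lee_fin].
rewrite !E// leeD ?lee_wpmul2l ?lee_fin//; apply: ge0_le_integral => //.
- by move=> y _; exact: (nmfM nu nf).2.
- exact: (nmfM nu nf).1.
- exact: (nmfM nu ng).1.
- by move=> y _; rewrite lee_wpmul2l ?lee_fin.
Qed.

Lemma K_cst (c : R) x : 0 <= c -> K (fun=> c%:E) x = c%:E.
Proof.
move=> c0; have [u [r [mu u0 /andP[r0 _] I E]]] := chain_rep Hc x.
rewrite E; last exact: nmf_cst.
under eq_integral do rewrite muleC.
rewrite ge0_integralZl//=.
- by rewrite I -!EFinM -EFinD mulrC -mulrDl subrK mul1r.
- exact/measurable_EFinP.
- by move=> y _; rewrite lee_fin.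
Qed.

Lemma K_sup (f : nat -> X -> \bar R) x : (forall n, nmf (f n)) ->
  (forall y, nondecreasing_seq (f ^~ y)) ->
  K (fun y => ereal_sup (range (f ^~ y))) x = ereal_sup (range (fun n => K (f n) x)).
Proof.
move=> nf ndf; have [u [r [mu u0 /andP[r0 _] _ E]]] := chain_rep Hc x.
have nu : nmf (fun y => (u y)%:E).
  by split; [exact/measurable_EFinP | move=> y; rewrite lee_fin].
have nS := nmf_sup nf.
have ndK : nondecreasing_seq (fun n => K (f n) x).
  by move=> m n mn; apply: K_le => // y; exact: ndf.
have cvg1 : (fun n => K (f n) x) @ \oo --> K (fun y => ereal_sup (range (f ^~ y))) x.
  rewrite E//; under eq_cvg do rewrite E//.
  apply: cvgeD.
  - rewrite ge0_adde_def// inE.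
      by apply: integral_ge0 => y _; exact: (nmfM nu nS).2.
    by rewrite mule_ge0 ?lee_fin//; exact: nS.2.
  - have -> : (\int[P]_y ((u y)%:E * ereal_sup (range (f ^~ y))) =
       \int[P]_y limn (fun n => (u y)%:E * f n y))%E.
      apply: eq_integral => y _; apply/esym/cvg_lim => //.
      by apply: cvgeZl => //; exact: ereal_nondecreasing_cvgn.
    apply: cvg_monotone_convergence => //.
    - by move=> n; exact: (nmfM nu (nf n)).1.
    - by move=> n y _; exact: (nmfM nu (nf n)).2.
    - by move=> y _ m n mn; rewrite lee_wpmul2l ?lee_fin//; exact: ndf.
  - by apply: cvgeZl => //; exact: ereal_nondecreasing_cvgn.
rewrite -(cvg_lim _ cvg1)//; apply: cvg_lim => //.
exact: ereal_nondecreasing_cvgn.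
Qed.

(** Reversibility against the constant 1, which [K] fixes. *)
Lemma K_inv f : nmf f -> (\int[P]_x K f x = \int[P]_x f x)%E.
Proof.
move=> nf; have := chain_rev Hc (nmf_cst ler01) nf.
under eq_integral do rewrite mul1e.
by move=> ->; apply: eq_integral => x _; rewrite K_cst// mule1.
Qed.

Lemma iterK_nmf n f : nmf f -> nmf (iter n K f).
Proof. by move=> nf; elim: n => //= n IH; exact: K_nmf. Qed.

Lemma iterK_le n f g x : nmf f -> nmf g -> (forall y, (f y <= g y)%E) ->
  (iter n K f x <= iter n K g x)%E.
Proof.
move=> nf ng fg; elim: n x => //= n IH x.
by apply: K_le; [exact: iterK_nmf|exact: iterK_nmf|].
Qed.

Lemma iterK_cst n (c : R) x : 0 <= c -> iter n K (fun=> c%:E) x = c%:E.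
Proof.
move=> c0; elim: n x => //= n IH x.
by rewrite (_ : iter n K _ = fun=> c%:E) ?K_cst//; apply/funext.
Qed.

Lemma iterK_Z n (c : R) f x : 0 <= c -> nmf f ->
  iter n K (fun y => c%:E * f y)%E x = (c%:E * iter n K f x)%E.
Proof.
move=> c0 nf; elim: n x => //= n IH x.
by rewrite -K_Z//; [congr (K _ x); exact/funext|exact: iterK_nmf].
Qed.

Lemma iterK_rev n f g : nmf f -> nmf g ->
  (\int[P]_x (f x * iter n K g x) = \int[P]_x (g x * iter n K f x))%E.
Proof.
elim: n f g => [|n IH] f g nf ng.
  by apply: eq_integral => x _ /=; rewrite muleC.
rewrite iterS iterSr (chain_rev Hc)//; last exact: iterK_nmf.
by rewrite -IH//; [apply: eq_integral => x _; rewrite muleC|exact: K_nmf].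
Qed.

Lemma iterK_inv n f : nmf f -> (\int[P]_x iter n K f x = \int[P]_x f x)%E.
Proof. by move=> nf; elim: n => //= n <-; apply: K_inv; exact: iterK_nmf. Qed.

End ChainOperator.

(** * Convergence in mean *)

Definition unitf {R : realType} {dsp} {X : measurableType dsp} (f : X -> R) :=
  measurable_fun setT f /\ forall x, 0 <= f x <= 1.

Section UnitFunctions.
Context {R : realType} {dsp : measure_display} {X : measurableType dsp}.

Lemma unitf_nmf (f : X -> R) : unitf f -> nmf (EFin \o f).
Proof.
move=> [mf f01]; split; first exact/measurable_EFinP.
by move=> x /=; rewrite lee_fin; case/andP: (f01 x).
Qed.

Lemma unitf_sqr (f : X -> R) : unitf f -> unitf (fun x => f x ^+ 2).
Proof.
move=> [mf f01]; split; first exact: measurable_funX.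
by move=> x; have /andP[? ?] := f01 x; rewrite exprn_ge0 ?exprn_ile1.
Qed.

Lemma nmf_fun (f : X -> R) : measurable_fun setT f -> (forall x, 0 <= f x) ->
  nmf (fun x => (f x)%:E).
Proof.
by move=> mf f0; split; [exact/measurable_EFinP|move=> x; rewrite lee_fin].
Qed.

Lemma int_cstP (P : probability X R) (c : R) : (\int[P]_x c%:E = c%:E)%E.
Proof.
by rewrite -[RHS]mule1 -(@probability_setT _ _ _ P) -integral_cst.
Qed.

Lemma nmf_int_fin (P : probability X R) (f : X -> R) : unitf f ->
  exists2 a : R, 0 <= a <= 1 & (\int[P]_x (f x)%:E)%E = a%:E.
Proof.
move=> uf; have [mf f0] := unitf_nmf uf.
have l : (\int[P]_x (f x)%:E <= 1)%E.
  rewrite -(@probability_setT _ _ _ P) -[leRHS]mul1e -integral_cst//.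
  by apply: ge0_le_integral => // x _; rewrite lee_fin; case/andP: (uf.2 x).
have g : (0 <= \int[P]_x (f x)%:E)%E by apply: integral_ge0 => x _; exact: f0.
exists (fine (\int[P]_x (f x)%:E)%E); last first.
  by rewrite fineK// ge0_fin_numE//; apply: le_lt_trans l _; exact: ltry.
rewrite fine_ge0//= -lee_fin fineK// ge0_fin_numE//.
by apply: le_lt_trans l _; exact: ltry.
Qed.

End UnitFunctions.

Section L1Convergence.
Context {R : realType} {dsp : measure_display} {X : measurableType dsp}.
Variables (P : probability X R) (K : (X -> \bar R) -> X -> \bar R).
Hypothesis Hc : rev_chain P K.

(** [K] as a real-valued operator; on functions with values in [0, 1] nothing is lost by [fine], as
    [ropE] shows. *)
Definition rop (f : X -> R) (x : X) : R := fine (K (EFin \o f) x).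

Lemma ropE f x : unitf f -> K (EFin \o f) x = (rop f x)%:E.
Proof.
move=> uf; rewrite fineK// ge0_fin_numE; last by apply: (K_ge0 Hc); exact: unitf_nmf.
apply: (@le_lt_trans _ _ 1%E); last exact: ltry.
rewrite -(K_cst Hc x ler01); apply: (K_le Hc).
- exact: unitf_nmf.
- exact: nmf_cst.
- by move=> y; rewrite lee_fin; case/andP: (uf.2 y).
Qed.

Lemma rop_unitf f : unitf f -> unitf (rop f).
Proof.
move=> uf; have [mK K0] := K_nmf Hc (unitf_nmf uf); split.
  apply/measurable_EFinP; apply: eq_measurable_fun mK => x _.
  by rewrite ropE.
move=> x; rewrite -!lee_fin -ropE// K0/= -(K_cst Hc x ler01); apply: (K_le Hc).
- exact: unitf_nmf.
- exact: nmf_cst.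
- by move=> y; rewrite lee_fin; case/andP: (uf.2 y).
Qed.

(** The variance of [f] under K(x, .). Since [K] acts on nonnegative functions, the square is not
    expanded with a negative term; instead [K] is applied to both sides of
    [f^2 + c^2 = (f - c)^2 + 2 c f]. *)
Lemma rop_var f x : unitf f ->
  K (fun y => ((f y - rop f x) ^+ 2)%:E) x =
  (rop (fun y => f y ^+ 2) x - rop f x ^+ 2)%:E.
Proof.
move=> uf; set c := rop f x; have uf2 := unitf_sqr uf.
have [mc /(_ x)/andP[c0 c1]] := rop_unitf uf.
have nd : nmf (fun y => ((f y - c) ^+ 2)%:E).
  apply: nmf_fun => [|y]; last exact: sqr_ge0.
  by apply: measurable_funX; apply: measurable_funB => //; exact: uf.1.
have nf2 := unitf_nmf uf2; have nf := unitf_nmf uf.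
have e1 : K (fun y => ((f y ^+ 2)%:E + (c ^+ 2)%:E)%E) x =
    (rop (fun y => f y ^+ 2) x + c ^+ 2)%:E.
  rewrite (K_D Hc x nf2 (nmf_cst (sqr_ge0 c))) (K_cst Hc) ?sqr_ge0//.
  by rewrite [in X in (X + _)%E = _](ropE _ uf2).
have c20 : 0 <= c *+ 2 by rewrite mulrn_wge0.
have e2 : K (fun y => (((f y - c) ^+ 2)%:E + (c *+ 2)%:E * (f y)%:E)%E) x =
    (K (fun y => ((f y - c) ^+ 2)%:E) x + (c *+ 2 * c)%:E)%E.
  rewrite (K_D Hc x nd (nmfM (nmf_cst c20) nf)) (K_Z Hc)//.
  by rewrite [K (fun y => (f y)%:E) x](ropE x uf) EFinM.
have e3 : (fun y => ((f y ^+ 2)%:E + (c ^+ 2)%:E)%E) =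
  (fun y => (((f y - c) ^+ 2)%:E + (c *+ 2)%:E * (f y)%:E)%E).
  by apply/funext => y; rewrite -EFinM -!EFinD; congr EFin; ring.
move: e2; rewrite -e3 e1 => /esym.
have := K_ge0 Hc x nd; case: (K _ x) => // r _ [] /eqP.
by rewrite -subr_eq => /eqP <-; congr EFin; ring.
Qed.

Lemma rop_var_ge0 f x : unitf f -> 0 <= rop (fun y => f y ^+ 2) x - rop f x ^+ 2.
Proof.
move=> uf; rewrite -lee_fin -rop_var//; apply: (K_ge0 Hc).
apply: nmf_fun => [|y]; last exact: sqr_ge0.
by apply: measurable_funX; apply: measurable_funB => //; exact: uf.1.
Qed.

Lemma rop_var_unitf f : unitf f ->
  unitf (fun x => rop (fun y => f y ^+ 2) x - rop f x ^+ 2).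
Proof.
move=> uf; have u1 := rop_unitf (unitf_sqr uf); have u2 := unitf_sqr (rop_unitf uf).
split; first by apply: measurable_funB; [exact: u1.1|exact: u2.1].
move=> x; rewrite rop_var_ge0//=.
have /andP[_ le1] := u1.2 x; have /andP[ge0 _] := u2.2 x.
by rewrite lerBlDr (le_trans le1)// lerDl.
Qed.

Lemma iter_ropE n f : unitf f ->
  unitf (iter n rop f) /\ iter n K (EFin \o f) = EFin \o iter n rop f.
Proof.
move=> uf; elim: n => [//|n [u e]]; split => /=; first exact: rop_unitf.
by rewrite e; apply/funext => x /=; rewrite ropE.
Qed.

(** By invariance the integrated variance [d n] is the decrement [a n - a n.+1] of the sequence
    [a n] of integrals of [(K^n f)^2]. This sequence is nonincreasing and nonnegative, hence
    convergent, so its decrements tend to 0. *)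
Lemma sqr_decrease f : unitf f -> exists2 d : R ^nat,
  (forall n, (\int[P]_x (rop (fun y => iter n rop f y ^+ 2) x
              - rop (iter n rop f) x ^+ 2)%:E)%E = (d n)%:E) &
  d @ \oo --> (0 : R).
Proof.
move=> uf; pose fn n := iter n rop f.
have un n : unitf (fn n) := (iter_ropE n uf).1.
pose a n := fine (\int[P]_x (fn n x ^+ 2)%:E)%E.
have aE n : (\int[P]_x (fn n x ^+ 2)%:E)%E = (a n)%:E /\ 0 <= a n.
  have [b /andP[b0 _] e] := nmf_int_fin P (unitf_sqr (un n)).
  by rewrite /a e.
pose d n := fine (\int[P]_x (rop (fun y => fn n y ^+ 2) x - rop (fn n) x ^+ 2)%:E)%E.
have dE n : (\int[P]_x (rop (fun y => fn n y ^+ 2) x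
              - rop (fn n) x ^+ 2)%:E)%E = (d n)%:E /\ 0 <= d n.
  have [b /andP[b0 _] e] := nmf_int_fin P (rop_var_unitf (un n)).
  by rewrite /d e.
have ad n : a n = a n.+1 + d n.
  apply: EFin_inj; rewrite EFinD -(aE n).1 -(aE n.+1).1 -(dE n).1.
  rewrite -(K_inv Hc (unitf_nmf (unitf_sqr (un n)))).
  rewrite -(int_nmfD P (unitf_nmf (unitf_sqr (un n.+1)))
    (unitf_nmf (rop_var_unitf (un n)))); apply: eq_integral => x _.
  rewrite ropE; last exact: unitf_sqr.
  by rewrite -EFinD; congr EFin; rewrite /fn/=; ring.
exists d; first by move=> n; exact: (dE n).1.
have ca : cvgn a.
  apply: nonincreasing_is_cvgn.
    by apply/nonincreasing_seqP => n; rewrite [leRHS]ad lerDl (dE n).2.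
  by exists 0 => _ [n _ <-]; exact: (aE n).2.
have -> : d = (fun n => a n - a n.+1) by apply/funext => n; rewrite [a n]ad addrC addKr.
rewrite -(subrr (limn a)); apply: cvgB => //.
by rewrite (cvg_shiftS a).
Qed.

(* The variance of [f] under [K x] is at least a multiple of the variance of
   [f] on the minorization set, so the constant [c] below exists as soon as the
   integrated variance [d] is small. *)
Lemma near_cst_on (C : set X) (e d delta : R) f : unitf f -> measurable C ->
  0 < e -> (forall x g, C x -> nmf g -> (e%:E * \int[P]_(y in C) g y <= K g x)%E) ->
  (\int[P]_x (rop (fun y => f y ^+ 2) x - rop f x ^+ 2)%:E)%E = d%:E ->
  (d%:E < (e * delta)%:E * P C)%E -> 0 <= delta ->
  exists2 c : R, 0 <= c <= 1 & (\int[P]_(y in C) ((f y - c) ^+ 2)%:E <= delta%:E)%E.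
Proof.
move=> uf mC e0 min dE dlt delta0; apply: contrapT => nex.
(* If no constant works, then in particular [rop f x] fails for each [x] in [C]; the minorization
   makes the variance at such [x] at least [e * delta], and integrating over [C] contradicts the
   bound on [d]. *)
have gt x : C x -> (delta%:E < \int[P]_(y in C) ((f y - rop f x) ^+ 2)%:E)%E.
  move=> Cx; rewrite ltNge; apply/negP => le; apply: nex.
  by exists (rop f x) => //; exact: (rop_unitf uf).2.
move: dlt; rewrite -dE ltNge => /negP; apply.
have uv := rop_var_unitf uf; have [mv v0] := unitf_nmf uv.
apply: (@le_trans _ _ (\int[P]_(x in C) (rop (fun y => f y ^+ 2) x - rop f x ^+ 2)%:E)%E).
  rewrite -integral_cst//; apply: ge0_le_integral => //.
  - by move=> x _; rewrite lee_fin mulr_ge0// ltW.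
  - exact: measurable_funTS.
  - move=> x Cx; rewrite -rop_var// EFinM; apply: (le_trans _ (min x _ Cx _)).
      by rewrite lee_wpmul2l ?lee_fin ?ltW// gt.
    apply: nmf_fun => [|y]; last exact: sqr_ge0.
    by apply: measurable_funX; apply: measurable_funB => //; exact: uf.1.
by apply: ge0_subset_integral => // x _; exact: v0.
Qed.

(** Pointwise, [|f - c| <= eta + 1_C (f - c)^2 / eta + 1_(~C)], and each of the three terms has
    integral at most [eta]. *)
Lemma near_cst_L1 (C : set X) (eta c : R) f : unitf f -> measurable C ->
  0 < eta -> 0 <= c <= 1 ->
  (\int[P]_(y in C) ((f y - c) ^+ 2)%:E <= (eta ^+ 2)%:E)%E ->
  (P (~` C) <= eta%:E)%E -> (\int[P]_x `|f x - c|%:E <= (3 * eta)%:E)%E.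
Proof.
move=> uf mC eta0 c01 intC PC.
have mfc : measurable_fun setT (fun x => f x - c).
  by apply: measurable_funB => //; exact: uf.1.
have n1 : nmf (fun x => `|f x - c|%:E).
  by apply: nmf_fun => //; exact: measurableT_comp.
have n2 : nmf (fun x => ((f x - c) ^+ 2 * eta^-1)%:E).
  apply: nmf_fun => [|x]; last by rewrite mulr_ge0 ?sqr_ge0 ?invr_ge0 ?ltW.
  by apply: measurable_funM => //; exact: measurable_funX.
have nE : nmf (fun _ : X => eta%:E) by apply: nmf_cst; exact: ltW.
have nC : nmf (fun x => (\1_(~` C) x)%:E : \bar R).
  by apply: nmf_fun => //; apply: measurable_indic; exact: measurableC.
have nCd : nmf (fun x => (\1_C x)%:E * ((f x - c) ^+ 2 * eta^-1)%:E)%E.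
  by apply: nmfM => //; apply: nmf_fun => //; exact: measurable_indic.
apply: (@le_trans _ _ (\int[P]_x (eta%:E +
   ((\1_C x)%:E * ((f x - c) ^+ 2 * eta^-1)%:E + (\1_(~` C) x)%:E)))%E).
  have [m1 p1] := n1; have [m2 p2] := nmfD nE (nmfD nCd nC).
  apply: ge0_le_integral => // x _.
  rewrite -EFinM -!EFinD lee_fin.
  have /andP[f0 f1] := uf.2 x; have /andP[c0 c1] := c01.
  rewrite !indicE in_setC; case: (x \in C) => /=; last first.
    rewrite mul0r add0r; apply: (@le_trans _ _ 1); last by rewrite lerDr ltW.
    by rewrite ler_norml; apply/andP; split; lra.
  rewrite mul1r addr0 -(ler_pM2r eta0) mulrDl mulfVK ?gt_eqF//.
  rewrite -(real_normK (num_real (f x - c))).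
  have := sqr_ge0 (`|f x - c| - eta / 2); nra.
rewrite (int_nmfD P nE (nmfD nCd nC)) (int_nmfD P nCd nC).
rewrite (int_cstP P eta) integral_indic ?setIT//; last exact: measurableC.
rewrite (_ : 3 * eta = eta + (eta + eta)); last ring.
rewrite !EFinD; apply: leeD => //; apply: leeD => //.
rewrite (_ : (\int[P]_x _)%E = (\int[P]_(x in C) (eta^-1%:E * ((f x - c) ^+ 2)%:E))%E).
  rewrite ge0_integralZl//; last 3 first.
  - by apply/measurable_EFinP/measurable_funTS; exact: measurable_funX.
  - by move=> x _; rewrite lee_fin sqr_ge0.
  - by rewrite lee_fin invr_ge0 ltW.
  apply: (le_trans (lee_wpmul2l _ intC)); first by rewrite lee_fin invr_ge0 ltW.
  by rewrite -EFinM lee_fin expr2 mulKf// gt_eqF.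
rewrite [RHS]integral_mkcond; apply: eq_integral => x _.
rewrite /patch indicE; case: (x \in C); last by rewrite mul0e.
by rewrite mul1e EFinM muleC.
Qed.

Lemma near_cst_mean (eta c m : R) f : unitf f ->
  0 <= c -> (\int[P]_x (f x)%:E)%E = m%:E ->
  (\int[P]_x `|f x - c|%:E <= eta%:E)%E -> `|c - m| <= eta.
Proof.
move=> uf c0 mE le.
have n1 : nmf (fun x => `|f x - c|%:E).
  apply: nmf_fun => //; apply: measurableT_comp => //.
  by apply: measurable_funB => //; exact: uf.1.
have [m1 p1] := n1; have nf := unitf_nmf uf.
have [i0 ie] : (0 <= \int[P]_x `|f x - c|%:E)%E /\
   (\int[P]_x `|f x - c|%:E)%E \is a fin_num.
  have i0 : (0 <= \int[P]_x `|f x - c|%:E)%E by apply: integral_ge0 => x _.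
  by split=> //; rewrite ge0_fin_numE// (le_lt_trans le)// ltry.
rewrite ler_norml; apply/andP; split.
- rewrite lerBrDl lerBlDr -lee_fin -mE EFinD; apply: (@le_trans _ _
    (\int[P]_x (c%:E + `|f x - c|%:E))%E).
    have [m2 p2] := nmfD (nmf_cst c0) n1.
    apply: ge0_le_integral => //.
    - by move=> x _; exact: nf.2.
    - exact: nf.1.
    - by move=> x _; rewrite -EFinD lee_fin -lerBlDl ler_norm.
  rewrite (int_nmfD P (nmf_cst c0) n1) (int_cstP P c).
  by rewrite leeD2l.
- rewrite lerBlDr -lee_fin EFinD -mE; apply: (@le_trans _ _
    (\int[P]_x (`|f x - c|%:E + (f x)%:E))%E).
    rewrite -[leLHS]mule1 -(@probability_setT _ _ _ P) -integral_cst//.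
    have [m2 p2] := nmfD n1 nf.
    apply: ge0_le_integral => // x _.
    by rewrite -EFinD lee_fin -lerBlDr distrC ler_norm.
  by rewrite (int_nmfD P n1 nf) leeD2r.
Qed.

Lemma L1_convergence f m : unitf f -> (\int[P]_x (f x)%:E)%E = m%:E ->
  forall eta : R, 0 < eta -> exists N, forall n, (N <= n)%N ->
    (\int[P]_x `|iter n rop f x - m|%:E <= eta%:E)%E.
Proof.
move=> uf mE eta eta0.
have [d dE d0] := sqr_decrease uf.
have [C [mC ndC CT minC]] := chain_minor Hc.
have cP : P (C n) @[n --> \oo] --> P (\bigcup_n C n).
  by apply: nondecreasing_cvg_mu => //; exact: bigcup_measurable.
(* Six: [f] is within [3 z] of a constant [c] in mean, which puts [c] within [3 z] of [m]. The bound
   [1/2] in [w] below ensures that [C k] has positive mass. *)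
pose z := eta / 6; have z0 : 0 < z by rewrite divr_gt0.
pose w := Num.min z 2^-1.
have w0 : 0 < w by rewrite lt_min z0 invr_gt0 ltr0n.
have [k kC] : exists k, (P (~` C k) <= w%:E)%E.
  have : \forall n \near \oo, ((1 - w)%:E < P (C n))%E.
    rewrite CT probability_setT in cP.
    apply: (cP [set y | ((1 - w)%:E < y)%E]); apply: open_nbhs_nbhs.
    by split; [exact: open_ereal_gt_ereal|rewrite /= lte_fin gtrBl].
  move=> [k _ /(_ k (leqnn k))/= kC]; exists k.
  rewrite probability_setC//; move: kC.
  have -> : P (C k) = (fine (P (C k)))%:E by rewrite fineK// fin_num_measure.
  by rewrite -EFinB lte_fin lee_fin; lra.
have [e e0 min] := minC k.
have PCk : (0 < P (C k))%E.
  rewrite lt0e measure_ge0 andbT; apply/eqP => PC0.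
  move: kC; rewrite probability_setC// PC0 sube0 lee_fin => w1.
  have : w <= 2^-1 by rewrite ge_min lexx orbT.
  by move/(le_trans w1); rewrite invf_ge1//; lra.
pose p := fine (P (C k)).
have pE : P (C k) = p%:E by rewrite fineK// fin_num_measure.
have p0 : 0 < p by rewrite -lte_fin -pE.
have pos : 0 < e * z ^+ 2 * p by rewrite !mulr_gt0// exprn_gt0.
have [N _ NP] : \forall n \near \oo, d n < e * z ^+ 2 * p.
  by move/cvgr_lt: d0; apply.
exists N => n Nn; have [un _] := iter_ropE n uf.
have [||c c01 cC] := near_cst_on (delta := z ^+ 2) un (mC k) e0 min (dE n).
- by rewrite pE -EFinM lte_fin; exact: NP.
- exact: sqr_ge0.
have kz : (P (~` C k) <= z%:E)%E by rewrite (le_trans kC)// lee_fin ge_min lexx.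
have L1c := near_cst_L1 un (mC k) z0 c01 cC kz.
have mn : (\int[P]_x (iter n rop f x)%:E)%E = m%:E.
  by rewrite -mE -(iterK_inv Hc n (unitf_nmf uf)) (iter_ropE n uf).2.
have cm := near_cst_mean un (proj1 (andP c01)) mn L1c.
have mfc (b : R) : nmf (fun x => `|iter n rop f x - b|%:E).
  apply: nmf_fun => //; apply: measurableT_comp => //.
  by apply: measurable_funB => //; exact: un.1.
have nz : nmf (fun _ : X => (3 * z)%:E) by apply: nmf_cst; rewrite mulr_ge0// ltW.
apply: (@le_trans _ _ (\int[P]_x (`|iter n rop f x - c|%:E + (3 * z)%:E))%E).
  apply: ge0_le_integral => //.
  - exact: (mfc m).1.
  - exact: (nmfD (mfc c) nz).1.
  - move=> x _; rewrite -EFinD lee_fin (le_trans (ler_distD c _ _))//.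
    by rewrite lerD2l.
rewrite (int_nmfD P (mfc c) nz) (int_cstP P (3 * z)).
apply: (le_trans (leeD2r _ L1c)); rewrite -EFinD lee_fin /z; lra.
Qed.

End L1Convergence.

(** * Convergence in total variation *)

Section TotalVariation.
Context {R : realType} {dsp : measure_display} {X : measurableType dsp}.
Variables (P : probability X R) (K : (X -> \bar R) -> X -> \bar R).
Hypothesis Hc : rev_chain P K.

Lemma measurable_min_cst (u : X -> R) (k : R) : measurable_fun setT u ->
  measurable_fun setT (fun x => Num.min (u x) k).
Proof. by move=> mu; apply: measurable_minr => //; exact: measurable_cst. Qed.

(** Monotone convergence of the truncations; [t] is the mass cut off. A truncated density is
    bounded, so after scaling it takes values in [0, 1] and [L1_convergence] applies to it. *)
Lemma trunc_L1 (u : X -> R) (b eta : R) : measurable_fun setT u ->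
  (forall x, 0 <= u x) -> (\int[P]_x (u x)%:E)%E = b%:E -> 0 < eta ->
  exists2 k : R, 0 < k & exists t : R, 0 <= t <= eta /\
   (\int[P]_x (Num.min (u x) k)%:E)%E = (b - t)%:E /\
   (\int[P]_x (u x - Num.min (u x) k)%:E)%E = t%:E.
Proof.
move=> mu u0 bE eta0.
pose v (k : nat) x := Num.min (u x) k.+1%:R.
have nv k : nmf (fun x => (v k x)%:E).
  apply: nmf_fun => [|x]; last by rewrite le_min u0 ler0n.
  exact: measurable_min_cst.
have nw k : nmf (fun x => (u x - v k x)%:E).
  apply: nmf_fun => [|x]; last by rewrite subr_ge0 ge_min lexx.
  by apply: measurable_funB => //; exact: measurable_min_cst.
have cv : (\int[P]_x (v k x)%:E @[k --> \oo] --> b%:E)%E.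
  have -> : b%:E = (\int[P]_x limn (fun k => (v k x)%:E))%E.
    rewrite -bE; apply: eq_integral => x _; apply/esym/cvg_lim => //.
    apply/cvg_EFin; first exact: nearW.
    apply: cvg_near_cst; exists (Num.trunc (u x)) => // k /= tk.
    apply/min_idPl; apply/ltW; apply: lt_le_trans (truncnS_gt _) _.
    by rewrite ler_nat.
  apply: cvg_monotone_convergence => //.
  - by move=> n; exact: (nv n).1.
  - by move=> n x _; exact: (nv n).2.
  - move=> x _ m n mn; rewrite lee_fin le_min !ge_min lexx/= ler_nat ltnS mn.
    by rewrite orbT.
have [k kP] : exists k, ((b - eta)%:E < \int[P]_x (v k x)%:E)%E.
  have [k _ /(_ k (leqnn k))/= kC] : \forall k \near \oo,
      ((b - eta)%:E < \int[P]_x (v k x)%:E)%E.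
    apply: (cv [set y | ((b - eta)%:E < y)%E]); apply: open_nbhs_nbhs.
    by split; [exact: open_ereal_gt_ereal|rewrite /= lte_fin gtrBl].
  by exists k.
have e : ((\int[P]_x (v k x)%:E) + (\int[P]_x (u x - v k x)%:E) = b%:E)%E.
  rewrite -(int_nmfD P (nv k) (nw k)) -bE; apply: eq_integral => x _.
  by rewrite -EFinD addrC subrK.
exists k.+1%:R; first by rewrite ltr0n.
have v0 : (0 <= \int[P]_x (v k x)%:E)%E by apply: integral_ge0 => x _; exact: (nv k).2.
have w0 : (0 <= \int[P]_x (u x - v k x)%:E)%E.
  by apply: integral_ge0 => x _; exact: (nw k).2.
move: kP e v0 w0; rewrite /v.
case: (\int[P]_x _)%E => //= a; case: (\int[P]_x _)%E => //= t ab [eb] a0 t0.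
exists t; rewrite -eb addrK; split => //.
rewrite -lee_fin t0 /=; move: ab; rewrite lte_fin; lra.
Qed.

(* By reversibility [u P] evolves into [(K^n u) P]: the convergence is uniform
   in [f]. *)
Lemma density_convergence (u : X -> R) (b eta : R) : measurable_fun setT u ->
  (forall x, 0 <= u x) -> (\int[P]_x (u x)%:E)%E = b%:E -> 0 < eta ->
  exists N, forall n, (N <= n)%N -> forall f m, unitf f ->
    (\int[P]_x (f x)%:E)%E = m%:E ->
    exists2 I : R, (\int[P]_x ((u x)%:E * iter n K (EFin \o f) x))%E = I%:E &
      `|I - b * m| <= eta.
Proof.
move=> mu u0 bE eta0.
(* One third for each error term of the final decomposition: [k * (J - c * m)], [s] and [t * m]. *)
have eta3 : 0 < eta / 3 by rewrite divr_gt0.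
have [k k0 [t [/andP[t0 te] [vE wE]]]] := trunc_L1 mu u0 bE eta3.
pose v x := Num.min (u x) k / k.
have uv : unitf v.
  split.
    by apply: measurable_funM => //; exact: measurable_min_cst.
  move=> x; rewrite /v divr_ge0 ?(ltW k0)// ?le_min ?u0 ?(ltW k0)//=.
  by rewrite ler_pdivrMr// mul1r ge_min lexx orbT.
have nw : nmf (fun x => (u x - Num.min (u x) k)%:E).
  apply: nmf_fun => [|x]; last by rewrite subr_ge0 ge_min lexx.
  by apply: measurable_funB => //; exact: measurable_min_cst.
have kv x : k * v x = Num.min (u x) k by rewrite /v mulrC divfK// gt_eqF.
have vm : (\int[P]_x (v x)%:E)%E = ((b - t) / k)%:E.
  have : (k%:E * \int[P]_x (v x)%:E)%E = (b - t)%:E.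
    rewrite -(int_nmfZ P (ltW k0) (unitf_nmf uv)) -vE; apply: eq_integral => x _.
    by rewrite -EFinM kv.
  have [a _ ->] := nmf_int_fin P uv; rewrite -EFinM => -[<-].
  by rewrite mulrC mulKf// gt_eqF.
have zk : 0 < eta / (3 * k) by rewrite divr_gt0// mulr_gt0.
have [N NP] := L1_convergence Hc uv vm zk.
exists N => n Nn f m uf mE.
have [un fnE] := iter_ropE Hc n uf; have [uvn vnE] := iter_ropE Hc n uv.
have nf := unitf_nmf uf; have nfn := unitf_nmf un; have nvn := unitf_nmf uvn.
have nv := unitf_nmf uv.
have m01 : 0 <= m <= 1 by have [a a01] := nmf_int_fin P uf; rewrite mE => -[->].
(* [u] is split into [min u k], to which [L1_convergence] applies after
   scaling, and a remainder of mass [t]. *)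
have [J JE] : exists J, (\int[P]_x ((f x)%:E * (iter n (rop K) v x)%:E))%E = J%:E.
  have [] := @nmf_int_fin _ _ _ P (fun x => f x * iter n (rop K) v x).
    split; first by apply: measurable_funM; [exact: uf.1|exact: uvn.1].
    move=> x; have /andP[? ?] := uf.2 x; have /andP[? ?] := uvn.2 x.
    by rewrite mulr_ge0//= mulr_ile1.
  by move=> J _ JE; exists J; rewrite -JE; apply: eq_integral => x _; rewrite EFinM.
have D := NP n Nn; set c := (b - t) / k in vm D.
have c0 : 0 <= c.
  by have [a /andP[a0 _]] := nmf_int_fin P uv; rewrite vm => -[->].
have nd : nmf (fun x => `|iter n (rop K) v x - c|%:E).
  apply: nmf_fun => //; apply: measurableT_comp => //.
  by apply: measurable_funB => //; exact: uvn.1.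
have nfv := nmfM nf nvn; have ncf := nmfM (nmf_cst c0) nf.
have cf : (\int[P]_x (c%:E * (EFin \o f) x) = (c * m)%:E)%E.
  by rewrite (int_nmfZ P c0 nf) mE.
(* Since [0 <= f <= 1], [|f g - c f| <= |g - c|] with [g = K^n v]. The right-hand side does not
   involve [f], which is where the uniformity comes from. *)
have Jle : `|J - c * m| <= eta / (3 * k).
  rewrite ler_norml; apply/andP; split.
    rewrite lerBrDl lerBlDr -lee_fin EFinD -cf -JE.
    apply: le_trans (leeD2l _ D); rewrite -(int_nmfD P nfv nd).
    apply: int_nmf_le => [||x /=]; [exact: ncf|exact: nmfD|].
    rewrite -!EFinM -EFinD lee_fin.
    have /andP[f0 f1] := uf.2 x; set g := iter _ _ _ _.
    have := ler_norm (c - g); rewrite distrC => h.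
    have := ler_pM f0 (normr_ge0 (g - c)) f1 (lexx _).
    have := ler_wpM2l f0 h; rewrite mul1r mulrBr; lra.
  rewrite lerBlDr -lee_fin EFinD -cf -JE addeC.
  apply: le_trans (leeD2l _ D); rewrite -(int_nmfD P ncf nd).
  apply: int_nmf_le => [||x /=]; [exact: nfv|exact: nmfD|].
  rewrite -!EFinM -EFinD lee_fin.
  have /andP[f0 f1] := uf.2 x; set g := iter _ _ _ _.
  have h := ler_norm (g - c).
  have := ler_pM f0 (normr_ge0 (g - c)) f1 (lexx _).
  have := ler_wpM2l f0 h; rewrite mul1r mulrBr; lra.
have vf : (\int[P]_x ((v x)%:E * (iter n (rop K) f x)%:E))%E = J%:E.
  rewrite -JE; have := iterK_rev Hc n nv nf; rewrite fnE vnE => e.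
  exact: e.
have nwf := nmfM nw nfn.
have [s sE /andP[s0 st]] : exists2 s : R, (\int[P]_x ((u x - Num.min (u x) k)%:E *
    (iter n (rop K) f x)%:E))%E = s%:E & 0 <= s <= t.
  have i0 : (0 <= \int[P]_x ((u x - Num.min (u x) k)%:E *
    (iter n (rop K) f x)%:E))%E by apply: integral_ge0 => x _; exact: nwf.2.
  have it : (\int[P]_x ((u x - Num.min (u x) k)%:E *
    (iter n (rop K) f x)%:E) <= t%:E)%E.
    rewrite -wE; apply: int_nmf_le => // x; rewrite -EFinM lee_fin.
    by rewrite ler_piMr// ?(proj2 (andP (un.2 x)))// subr_ge0 ge_min lexx.
  move: i0 it; case: (\int[P]_x _)%E => // s; rewrite !lee_fin => s0 st.
  by exists s => //; rewrite s0.
exists (k * J + s).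
  rewrite fnE EFinD -sE EFinM -vf -(int_nmfZ P (ltW k0) (nmfM nv nfn)).
  rewrite -(int_nmfD P (nmfM (nmf_cst (ltW k0)) (nmfM nv nfn)) nwf).
  apply: eq_integral => x _ /=; rewrite -!EFinM -EFinD; congr EFin.
  by rewrite mulrA kv mulrBl addrC subrK.
have -> : k * J + s - b * m = k * (J - c * m) + s - t * m.
  rewrite mulrBr [k * (c * m)]mulrA (_ : k * c = b - t); first ring.
  by rewrite /c mulrC divfK// gt_eqF.
have kJ : `|k * (J - c * m)| <= eta / 3.
  rewrite normrM gtr0_norm// -ler_pdivlMl//; apply: (le_trans Jle).
  by rewrite invfM mulrA mulrC.
have /andP[m0 m1] := m01.
have tm : 0 <= t * m <= t by rewrite mulr_ge0//= ler_piMr.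
move: kJ; rewrite !ler_norml => /andP[? ?]; case/andP: tm => ? ?.
by apply/andP; split; lra.
Qed.

(** One [N] serves all [f]; applied to indicators, this is convergence in total variation. *)
Lemma pointwise_convergence x (eta : R) : 0 < eta ->
  exists N, forall n, (N <= n)%N -> forall f m, unitf f ->
    (\int[P]_x (f x)%:E)%E = m%:E -> `|iter n (rop K) f x - m| <= eta.
Proof.
move=> eta0; have [u [r [mu u0 /andP[r0 r1] uE E]]] := chain_rep Hc x.
have r10 : 0 < 1 - r by rewrite subr_gt0.
have eta2 : 0 < eta / 2 by rewrite divr_gt0.
have [N NP] := density_convergence mu u0 uE (mulr_gt0 r10 eta2).
have step n f m : (N <= n)%N -> unitf f -> (\int[P]_x (f x)%:E)%E = m%:E ->
    `|iter n.+1 (rop K) f x - m| <= (1 - r) * (eta / 2) + r * `|iter n (rop K) f x - m|.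
  move=> Nn uf mE; have [I IE Im] := NP n Nn f m uf mE.
  have [un fnE] := iter_ropE Hc n uf.
  have -> : iter n.+1 (rop K) f x = I + r * iter n (rop K) f x.
    apply: EFin_inj; rewrite /= -(ropE Hc)// E; last exact: unitf_nmf.
    by rewrite EFinD -IE fnE EFinM.
  have -> : I + r * iter n (rop K) f x - m =
     (I - (1 - r) * m) + r * (iter n (rop K) f x - m) by ring.
  apply: (le_trans (ler_normD _ _)); apply: lerD => //.
  by rewrite normrM ger0_norm.
(* [eta / 2] is the fixed point of the affine recursion; the excess over it is at most 1 at time [N]
   and shrinks by the factor [r] at each step. *)
have {}step j f m : unitf f -> (\int[P]_x (f x)%:E)%E = m%:E ->
    `|iter (N + j) (rop K) f x - m| <= eta / 2 + r ^+ j.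
  move=> uf mE.
  have [a a01 aE] := nmf_int_fin P uf; move: aE; rewrite mE => -[am].
  elim: j => [|j IH].
    have [un _] := iter_ropE Hc (N + 0) uf; have /andP[? ?] := un.2 x.
    case/andP: a01; rewrite -am => ? ?.
    by rewrite expr0 ler_norml; apply/andP; split; lra.
  rewrite addnS; apply: (le_trans (step _ _ _ (leq_addr _ _) uf mE)).
  have := ler_wpM2l r0 IH; rewrite exprS mulrDr; lra.
have [j _ jP] : \forall j \near \oo, r ^+ j < eta / 2.
  have : r ^+ n @[n --> \oo] --> 0 by apply: cvg_expr; rewrite ger0_norm.
  by move/cvgr_lt; apply.
exists (N + j)%N => n Nn f m uf mE.
have Nn' : (N <= n)%N by rewrite (leq_trans _ Nn)// leq_addr.
rewrite -(subnKC Nn'); apply: (le_trans (step _ _ _ uf mE)).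
have /= := jP (n - N)%N; rewrite leq_subRL//.
by move/(_ Nn) => h; lra.
Qed.

Lemma unitf_indic (A : set X) : measurable A -> unitf (\1_A : X -> R).
Proof.
move=> mA; split; first exact: measurable_indic.
by move=> x; rewrite indicE; case: (_ \in _) => /=; rewrite ?lexx ler01.
Qed.

Lemma int_indicP (A : set X) : measurable A ->
  (\int[P]_x (\1_A x : R)%:E)%E = P A.
Proof. by move=> mA; rewrite integral_indic// setIT. Qed.

Lemma tv_convergence (pi : set X -> \bar R) x :
  (forall A, measurable A -> pi A = P A) ->
  tv_dist K pi n x @[n --> \oo] --> 0%E.
Proof.
move=> piP.
have bound (eta : R) : 0 < eta -> \forall n \near \oo,
    (0 <= tv_dist K pi n x <= (2 * eta)%:E)%E.
  move=> eta0; have [N NP] := pointwise_convergence x eta0.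
  exists N => // n /= Nn.
  pose S := [set (kpow K n A x - pi A)%E | A in [set A | measurable A]].
  have SE y : S y -> exists2 z, y = z%:E & `|z| <= eta.
    case=> A /= mA <-; have uA := unitf_indic mA.
    have pf : P A = (fine (P A))%:E by rewrite fineK// fin_num_measure.
    have := NP n Nn _ (fine (P A)) uA; rewrite -pf int_indicP// => /(_ erefl) le.
    eexists; last exact: le.
    by rewrite piP// EFinD EFinN -pf /kpow [iter n K _](iter_ropE Hc n uA).2.
  (* The empty set contributes 0, so the supremum is nonnegative and the infimum nonpositive; with
     the bounds by [eta] both are finite and their difference is nonnegative. *)
  have S0 : S (0 : \bar R).
    exists set0; first exact: measurable0.
    rewrite piP// measure0 sube0 /kpow.
    have -> : Defs.indic R set0 = (fun _ : X => 0%:E).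
      by apply/funext => y; rewrite /Defs.indic indic0.
    exact: (iterK_cst Hc).
  have sup_le : (ereal_sup S <= eta%:E)%E.
    apply: ge_ereal_sup => y /SE[z -> zl]; rewrite lee_fin.
    by rewrite (le_trans (ler_norm _)).
  have inf_ge : ((- eta)%:E <= ereal_inf S)%E.
    apply: le_ereal_inf_tmp => y /SE[z -> zl]; rewrite lee_fin.
    by move: zl; rewrite ler_norml => /andP[].
  have sup_ge := ereal_sup_ubound S0; have inf_le := ereal_inf_lbound S0.
  rewrite /tv_dist -/S; move: sup_le inf_ge sup_ge inf_le.
  case: (ereal_sup S) => // a; case: (ereal_inf S) => // b.
  rewrite !lee_fin => ? ? ? ?; apply/andP; split; lra.
apply/fine_cvgP; split.
  have [N _ NP] := bound 1 ltr01; exists N => // n /= Nn.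
  have /andP[a b] := NP n Nn.
  by rewrite ge0_fin_numE// (le_lt_trans b)// ltry.
apply/cvgrPdist_le => e e0; have e2 : 0 < e / 2 by rewrite divr_gt0.
have [N _ NP] := bound _ e2; exists N => // n /= Nn.
have /andP[] := NP n Nn; case: (tv_dist _ _ _ _) => //= z.
rewrite !lee_fin sub0r normrN => z0; rewrite ger0_norm//; lra.
Qed.

End TotalVariation.

(** * Harris recurrence and aperiodicity *)

Section Recurrence.
Context {R : realType} {dsp : measure_display} {X : measurableType dsp}.
Variables (P : probability X R) (K : (X -> \bar R) -> X -> \bar R).
Hypothesis Hc : rev_chain P K.

Local Notation ind := (@Defs.indic R dsp X).

(** The integral of [f] over some set of the exhausting sequence is already positive. The index is
    enlarged until the set also contains [x], and the minorization applies. *)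
Lemma K_pos f x : nmf f -> (0 < \int[P]_x f x)%E -> (0 < K f x)%E.
Proof.
move=> nf If; have [C [mC ndC CT minC]] := chain_minor Hc.
have cI : (\int[P]_(y in C i) f y)%E @[i --> \oo] --> (\int[P]_y f y)%E.
  rewrite -CT; apply: ge0_nondecreasing_set_cvg_integral => //.
  - by move=> i; apply: measurable_funTS; exact: nf.1.
  - by move=> i y _; exact: nf.2.
have [N _ NP] : \forall i \near \oo, (0 < \int[P]_(y in C i) f y)%E.
  apply: (cI [set y | (0 < y)%E]); apply: open_nbhs_nbhs.
  by split; [exact: open_ereal_gt_ereal|].
have [j _ Cj] : (\bigcup_n C n) x by rewrite CT.
have Cx : C (maxn N j) x.
  by have /subsetPset := ndC j (maxn N j) (leq_maxr _ _); apply.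
have [e e0 min] := minC (maxn N j); apply: lt_le_trans (min x f Cx nf).
by rewrite mule_gt0// NP//= leq_maxl.
Qed.

Lemma accessible_pos (A : set X) : measurable A ->
  (0 < P A)%E -> accessible K A.
Proof.
move=> mA PA x; exists 1%N; split => //; rewrite /kpow /=; apply: K_pos.
  exact: nmf_indic.
by rewrite int_indicP.
Qed.

(** If [A] were null, invariance would make every [kpow K m A] vanish almost everywhere, while
    accessibility covers the whole space by the countably many sets where one of them is nonzero. *)
Lemma pos_accessible (A : set X) : measurable A -> accessible K A -> (0 < P A)%E.
Proof.
move=> mA acc; rewrite lt0e measure_ge0 andbT; apply/eqP => PA0.
have nA := @nmf_indic R _ X A mA.
have null m : P.-negligible [set x | kpow K m A x != 0%E].
  have [mK K0] := iterK_nmf Hc m nA.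
  have : (\int[P]_x `|kpow K m A x| = 0)%E.
    under eq_integral do rewrite gee0_abs ?K0//.
    by rewrite (iterK_inv Hc m nA) int_indicP.
  move/(ae_eq_integral_abs P measurableT mK); apply: negligibleS => x /= k0.
  by apply/not_implyP; split => //; exact/eqP.
have := negligible_bigcup null; rewrite (_ : \bigcup_n _ = setT).
  move/(negligibleP _ measurableT) => h; have : P setT = 0%E := h.
  by rewrite probability_setT => /eqP; rewrite onee_eq0.
apply/seteqP; split => // x _; have [m [_ m0]] := acc x.
by exists m => //=; rewrite gt_eqF.
Qed.

Lemma indic_le1 (A : set X) x : (ind A x <= 1)%E.
Proof. by rewrite /Defs.indic indicE lee_fin; case: (_ \in _). Qed.

Lemma kpow_le1 m (A : set X) x : measurable A -> (kpow K m A x <= 1)%E.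
Proof.
move=> mA; rewrite -(iterK_cst Hc m x ler01); apply: (iterK_le Hc).
- exact: nmf_indic.
- exact: nmf_cst.
- by move=> y; exact: indic_le1.
Qed.

Let hitfun (A : set X) (h : X -> \bar R) y := (ind A y + ind (~` A) y * h y)%E.

Lemma nmf_hitfun A h : measurable A -> nmf h -> nmf (hitfun A h).
Proof.
move=> mA nh; apply: nmfD; first exact: nmf_indic.
by apply: nmfM => //; apply: nmf_indic; exact: measurableC.
Qed.

Lemma hitfunE A h y : hitfun A h y = if y \in A then 1%E else h y.
Proof.
rewrite /hitfun /Defs.indic !indicE in_setC; case: (y \in A) => /=.
  by rewrite mul0e adde0.
by rewrite mul1e add0e.
Qed.

Lemma hit_nmf A n : measurable A -> nmf (hit K A n).
Proof.
move=> mA; elim: n => [|n IH] /=; first exact: nmf_cst.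
by apply: (K_nmf Hc); exact: nmf_hitfun.
Qed.

Lemma hit_le1 A n x : measurable A -> (hit K A n x <= 1)%E.
Proof.
move=> mA; elim: n x => [|n IH] x /=; first by rewrite lee_fin.
rewrite -(K_cst Hc x ler01); apply: (K_le Hc).
- by apply: nmf_hitfun => //; exact: hit_nmf.
- exact: nmf_cst.
- by move=> y; rewrite -/(hitfun _ _ _) hitfunE; case: ifP.
Qed.

Lemma hit_nd A y : measurable A -> nondecreasing_seq (hit K A ^~ y).
Proof.
move=> mA; apply/nondecreasing_seqP => n.
elim: n y => [|n IH] y; first exact: (hit_nmf 1 mA).2.
apply: (K_le Hc).
- by apply: nmf_hitfun => //; exact: hit_nmf.
- by apply: nmf_hitfun => //; exact: (hit_nmf n.+1).
- by move=> z; rewrite -!/(hitfun _ _ _) !hitfunE; case: ifP => // _; exact: IH.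
Qed.

Lemma hitprobE A x : hitprob K A x = ereal_sup (range (hit K A ^~ x)).
Proof. by []. Qed.

(** First-step equation: [K_sup] carries the recursion that defines [hit] to the supremum. The shift
    of index is harmless because [hit K A 0] is 0. *)
Lemma hitprob_fixed A x : measurable A ->
  hitprob K A x = K (hitfun A (hitprob K A)) x.
Proof.
move=> mA; have nh n := nmf_hitfun mA (hit_nmf n mA).
have ndh y : nondecreasing_seq (fun n => hitfun A (hit K A n) y).
  by move=> m n mn; rewrite !hitfunE; case: ifP => // _; exact: hit_nd.
transitivity (K (fun y => ereal_sup (range (fun n => hitfun A (hit K A n) y))) x).
  rewrite (K_sup Hc)//; apply/eqP; rewrite eq_le; apply/andP; split.
    apply: ge_ereal_sup => _ [[|n] _ <-] /=.
      apply: le_trans (K_ge0 Hc x (nh 0%N)) _.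
      by apply: ereal_sup_ubound; exists 0%N.
    by apply: ereal_sup_ubound; exists n.
  apply: ge_ereal_sup => _ [n _ <-]; apply: ereal_sup_ubound.
  by exists n.+1.
congr (K _ x); apply/funext => y; rewrite hitfunE.
have [yA|yA] := boolP (y \in A).
  have -> : (fun n => hitfun A (hit K A n) y) = cst 1%E.
    by apply/funext => n; rewrite hitfunE yA.
  by rewrite ereal_sup_cst//; apply/set0P; exists 0%N.
have -> // : (fun n => hitfun A (hit K A n) y) = hit K A ^~ y.
by apply/funext => n; rewrite hitfunE (negbTE yA).
Qed.

Lemma hitprob_unitf A : measurable A ->
  exists2 l : X -> R, unitf l & hitprob K A = EFin \o l.
Proof.
move=> mA; have [mL L0] := nmf_sup (fun n => hit_nmf n mA).
have L1 x : (hitprob K A x <= 1)%E.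
  by apply: ge_ereal_sup => _ [n _ <-]; exact: hit_le1.
have lE : hitprob K A = EFin \o (fine \o hitprob K A).
  apply/funext => x /=; rewrite fineK// ge0_fin_numE; last exact: L0.
  by rewrite (le_lt_trans (L1 x))// ltry.
exists (fine \o hitprob K A) => //.
split; first by apply/measurable_EFinP; rewrite -lE; exact: mL.
move=> x /=; move: (L0 x) (L1 x); rewrite -hitprobE.
by case: (hitprob K A x) => // r; rewrite !lee_fin /= => -> ->.
Qed.

(* [l] is superharmonic and [K^n l] tends to its mean [c], so [l >= c];
   integrating [hitprob_fixed] gives [P A = P (1_A l) = c P A]. *)
Lemma hitprob1 A x : measurable A -> (0 < P A)%E -> hitprob K A x = 1%E.
Proof.
move=> mA PA; have [l ul lE] := hitprob_unitf mA.
have nl := unitf_nmf ul.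
have nH := nmf_hitfun mA nl.
have fixd y : K (hitfun A (EFin \o l)) y = (l y)%:E.
  by rewrite -lE -hitprob_fixed// lE.
have [c /andP[c0 c1] cE] := nmf_int_fin P ul.
(* [hitfun A l] equals [l] off [A] and 1 on [A], so it dominates every iterate that is below [l],
   and [K] sends it back to [l]. *)
have decr n y : iter n (rop K) l y <= l y.
  elim: n y => // n IH y /=.
  have [un _] := iter_ropE Hc n ul.
  rewrite -lee_fin -(ropE Hc)// -fixd; apply: (K_le Hc) => //.
    exact: unitf_nmf.
  move=> z; rewrite hitfunE; case: ifP => _ /=; last by rewrite lee_fin.
  by rewrite lee_fin; case/andP: (un.2 z).
have lc y : c <= l y.
  apply/ler_addgt0Pl => e e0.
  have [N NP] := pointwise_convergence Hc y e0.
  have := NP N (leqnn _) l c ul cE; rewrite ler_norml => /andP[+ _].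
  have := decr N y; lra.
have nA := @nmf_indic R _ X A mA.
have nAc := @nmf_indic R _ X (~` A) (measurableC mA).
have uAl : unitf (fun y => \1_A y * l y).
  have uA := @unitf_indic R _ X A mA.
  split; first by apply: measurable_funM; [exact: uA.1|exact: ul.1].
  move=> y; have /andP[? ?] := uA.2 y; have /andP[? ?] := ul.2 y.
  by rewrite mulr_ge0//= mulr_ile1.
have [a /andP[a0 a1] aE] := nmf_int_fin P uAl.
have pE : P A = (fine (P A))%:E by rewrite fineK// fin_num_measure.
set p := fine (P A) in pE.
(* Both [P A] and the integral of [1_A l], when added to the integral of [1_(~A) l], give [c]: the
   former by invariance and the first-step equation, the latter by definition of [c]. *)
have ap : a = p.
  have e1 : (p%:E + \int[P]_y (ind (~` A) y * (l y)%:E) = c%:E)%E.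
    rewrite -pE -int_indicP// -cE -(int_nmfD P nA (nmfM nAc nl)).
    by rewrite -(K_inv Hc nH); apply: eq_integral => y _; exact: fixd.
  have e2 : (a%:E + \int[P]_y (ind (~` A) y * (l y)%:E) = c%:E)%E.
    rewrite -aE -cE -(int_nmfD P (unitf_nmf uAl) (nmfM nAc nl)).
    apply: eq_integral => y _ /=; rewrite /Defs.indic !indicE in_setC.
    by case: (y \in A) => /=; rewrite -EFinM -EFinD; congr EFin; ring.
  move: e1 e2; case: (\int[P]_y _)%E => // s [e1] [e2].
  by apply: (addIr s); rewrite e1 e2.
have p0 : 0 < p by rewrite -lte_fin -pE.
(* [l - c] is nonnegative with integral 0, so integrating [1_A l <= c 1_A + (l - c)] gives the
   bound. Together with [a = p > 0] it yields [1 <= c]. *)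
have apc : a <= p * c.
  have nlc : nmf (fun y => (l y - c)%:E).
    apply: nmf_fun => [|y]; last by rewrite subr_ge0.
    by apply: measurable_funB => //; exact: ul.1.
  have z : (\int[P]_y (l y - c)%:E = 0)%E.
    have : (\int[P]_y (l y - c)%:E + \int[P]_y c%:E = c%:E)%E.
      rewrite -[RHS]cE -(int_nmfD P nlc (nmf_cst c0)); apply: eq_integral => y _.
      by rewrite -EFinD subrK.
    rewrite int_cstP; case: (\int[P]_y _)%E => // s [/eqP].
    by rewrite -subr_eq0 addrK => /eqP ->.
  rewrite -lee_fin -aE EFinM -pE -[leRHS]adde0 -[in leRHS]z muleC.
  have -> : (c%:E * P A = \int[P]_y (c%:E * ind A y))%E.
    by rewrite (int_nmfZ P c0 nA) int_indicP.
  have nc := nmfM (nmf_cst c0) nA; rewrite -(int_nmfD P nc nlc).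
  apply: int_nmf_le => [||y]; [exact: unitf_nmf|exact: nmfD|].
  rewrite /Defs.indic indicE -EFinM -EFinD lee_fin.
  by have := lc y; case: (y \in A) => /=; lra.
have c1' : 1 <= c by rewrite -(ler_pM2l p0) mulr1 -{1}ap.
rewrite lE /=; congr EFin; apply/eqP; rewrite eq_le.
by have /andP[_ ->] := ul.2 x; rewrite (le_trans c1').
Qed.

Lemma rev_chain_harris : harris_recurrent K.
Proof.
move=> A mA acc x m; have PA := pos_accessible mA acc.
rewrite (_ : hitprob K A = fun=> 1%:E) ?(iterK_cst Hc)//.
by apply/funext => y; exact: hitprob1.
Qed.

(** Three stages: [M] steps from [C] into [B k], where the chain returns to [C] in [n] steps with
    probability above [1 / (k + 1)], then [M] steps governed by [nu] again. Hence [delta] is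
    [nu (B k) / (k + 1)]. Some [B k] is charged by [nu] because these sets cover the space. *)
Lemma small_for_return (C : set X) (M n : nat) (nu : {measure set X -> \bar R}) :
  measurable C -> (0 < nu setT)%E -> small_for K C M nu -> C !=set0 ->
  (forall x, 0 < kpow K n C x)%E ->
  exists2 delta : R, 0 < delta &
    small_for K C (M + (n + M)) (fun B => (delta%:E * nu B)%E).
Proof.
move=> mC nuT sm [x0 Cx0] pos.
have nC := @nmf_indic R _ X C mC; have [mg g0] := iterK_nmf Hc n nC.
pose B k := [set x | ((k.+1%:R^-1)%:E < kpow K n C x)%E].
have mB k : measurable (B k).
  by rewrite -[X in measurable X]setTI; exact: emeasurable_fun_o_infty.
have [k nuB] : exists k, (0 < nu (B k))%E.
  apply: contrapT => /forallNP nB.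
  have B0 k : nu.-negligible (B k).
    apply/(negligibleP _ (mB k)); apply/eqP; rewrite eq_le measure_ge0 andbT leNgt.
    exact/negP/nB.
  have := negligible_bigcup B0; rewrite (_ : \bigcup_n _ = setT).
    by move/(negligibleP _ measurableT) => h; move: nuT; rewrite h ltxx.
  apply/seteqP; split => // x _; have := pos x; rewrite /B.
  case E : (kpow K n C x) => [r| |]// r0.
    have [k _ /(_ k (leqnn k))/= kr] := near_infty_natSinv_lt (PosNum r0).
    by exists k => //=; rewrite E lte_fin.
  by exists 0%N => //=; rewrite E ltry.
have finB B' : measurable B' -> nu B' \is a fin_num.
  move=> mB'; rewrite ge0_fin_numE//; apply: le_lt_trans (sm x0 Cx0 _ mB') _.
  by apply: le_lt_trans (kpow_le1 M x0 mB') _; exact: ltry.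
pose b := fine (nu (B k)).
have bE : nu (B k) = b%:E by rewrite fineK// finB.
have b0 : 0 < b by rewrite -lte_fin -bE.
have k0 : 0 <= k.+1%:R^-1 :> R by rewrite invr_ge0.
exists (k.+1%:R^-1 * b); first by rewrite mulr_gt0// invr_gt0.
move=> x Cx D mD; pose t := fine (nu D).
have tE : nu D = t%:E by rewrite fineK// finB.
have t0 : 0 <= t by rewrite fine_ge0.
have nB := @nmf_indic R _ X _ (mB k).
have nD := @nmf_indic R _ X D mD.
rewrite /kpow !iterD.
apply: (@le_trans _ _ (iter M K (iter n K (fun y => (t%:E * ind C y)%E)) x)); last first.
  have ntC : nmf (fun y => (t%:E * ind C y)%E) by apply: nmfM => //; exact: nmf_cst.
  have nM := iterK_nmf Hc M nD.
  apply: (iterK_le Hc _ _ (iterK_nmf Hc n ntC) (iterK_nmf Hc n nM)) => y.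
  apply: (iterK_le Hc _ _ ntC nM) => z; rewrite /Defs.indic indicE.
  have [zC|zC] := boolP (z \in C); last by rewrite mule0; exact: nM.2.
  by rewrite mule1 -tE; apply: sm => //; exact/set_mem.
rewrite (_ : iter n K _ = fun y => (t%:E * kpow K n C y)%E); last first.
  by apply/funext => y; exact: (iterK_Z Hc).
have nk := iterK_nmf Hc n nC.
rewrite (iterK_Z Hc)//.
apply: (@le_trans _ _ (t%:E * iter M K (fun y => ((k.+1%:R^-1)%:E * ind (B k) y)%E) x)%E);
    last first.
  rewrite lee_wpmul2l ?lee_fin//; apply: (iterK_le Hc) => //.
    by apply: nmfM => //; exact: nmf_cst.
  move=> y; rewrite /Defs.indic indicE.
  have [/set_mem/ltW yB|_] := boolP (y \in B k); first by rewrite mule1.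
  by rewrite mule0; exact: nk.2.
rewrite (iterK_Z Hc)// tE -EFinM.
apply: (@le_trans _ _ (t%:E * ((k.+1%:R^-1)%:E * b%:E))%E).
  by rewrite -!EFinM lee_fin le_eqVlt; apply/orP; left; apply/eqP; ring.
rewrite lee_wpmul2l ?lee_fin// lee_wpmul2l ?lee_fin// -bE.
exact: sm.
Qed.

(** [C] is small at the consecutive times [2 M + 1] and [2 M + 2], and no [k >= 2] divides both. *)
Lemma rev_chain_aperiodic : aperiodic K.
Proof.
move=> C M nu mC acc M0 nuT sm nuC k k1.
have PC := pos_accessible mC acc; have nC := @nmf_indic R _ X C mC.
have C0 : C !=set0.
  by apply/set0P/eqP => C0; move: nuC; rewrite C0 measure0 ltxx.
have pos n x : (0 < kpow K n.+1 C x)%E.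
  apply: (K_pos _ (iterK_nmf Hc n nC)).
  by rewrite (iterK_inv Hc n nC) int_indicP.
have [kd|kd] := boolP (k %| M + (1 + M))%N; last first.
  have [delta d0 sd] := small_for_return mC nuT sm C0 (pos 0%N).
  exists (M + (1 + M))%N; split => //; first by rewrite addn_gt0 M0.
  by exists delta.
have [delta d0 sd] := small_for_return mC nuT sm C0 (pos 1%N).
exists (M + (2 + M))%N; split => //; first by rewrite addn_gt0 M0.
  rewrite (_ : M + (2 + M) = (M + (1 + M)) + 1)%N; last by rewrite !addnA; lia.
  by rewrite dvdn_addr// dvdn1 gtn_eqF.
by exists delta.
Qed.

End Recurrence.

(** * Measures and nonnegative functions *)

Import HBNNSimple.

Section NonnegInduction.
Context {R : realType} {dsp : measure_display} {X : measurableType dsp}.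

(** A nonnegative measurable function is the supremum of an increasing sequence of simple functions,
    and a simple function is a finite sum of scaled indicators, treated by induction on the list of
    its values. *)
Lemma nmf_induction (Q : (X -> \bar R) -> Prop) :
  (forall A, measurable A -> Q (@Defs.indic R dsp X A)) ->
  (forall (c : R) f, 0 <= c -> nmf f -> Q f -> Q (fun x => c%:E * f x)%E) ->
  (forall f g, nmf f -> nmf g -> Q f -> Q g -> Q (fun x => f x + g x)%E) ->
  (forall f : nat -> X -> \bar R, (forall n, nmf (f n)) ->
    (forall y, nondecreasing_seq (f ^~ y)) -> (forall n, Q (f n)) ->
    Q (fun y => ereal_sup (range (f ^~ y)))) ->
  forall f, nmf f -> Q f.
Proof.
move=> Qi QZ QD QS f [mf f0].
pose g := nnsfun_approx measurableT mf.
have ndg y : nondecreasing_seq (fun n => (g n y)%:E).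
  by move=> m n mn; rewrite lee_fin; exact/lefP/nd_nnsfun_approx.
have fE : f = fun y => ereal_sup (range (fun n => (g n y)%:E)).
  apply/funext => y; transitivity (limn (fun n => (g n y)%:E)).
    by apply/esym/cvg_lim => //; exact: cvg_nnsfun_approx.
  by apply/cvg_lim => //; exact: ereal_nondecreasing_cvgn.
rewrite fE; apply: (QS (fun n y => (g n y)%:E)) => // n.
  split; last by move=> y; rewrite lee_fin.
  exact/measurable_EFinP/measurable_funP.
have [s pos gE] : exists2 s : seq R, (forall r, r \in s -> 0 <= r) &
    (fun y => (g n y)%:E) = fun y =>
    (\sum_(r <- s) r%:E * @Defs.indic R dsp X (g n @^-1` [set r]) y)%E.
  exists (finmap.enum_fset (fset_set (range (g n)))).
    by move=> r; rewrite in_fset_set// inE => -[z _ <-].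
  apply/funext => y; rewrite fimfunE fsbig_finite//= -sumEFin.
  by apply: eq_bigr => r _; rewrite EFinM.
rewrite gE {gE}.
suff : nmf (fun y => \sum_(r <- s)
      r%:E * @Defs.indic R dsp X (g n @^-1` [set r]) y)%E /\
    Q (fun y => \sum_(r <- s)
      r%:E * Defs.indic R (g n @^-1` [set r]) y)%E by case.
elim: s pos => [_|r s IH pos].
  have -> : (fun y => \sum_(r <- [::]) r%:E * @Defs.indic R dsp X (g n @^-1` [set r]) y)%E
     = Defs.indic R set0.
    by apply/funext => y; rewrite big_nil /Defs.indic indic0.
  by split; [exact: nmf_indic|exact: Qi].
have -> : (fun y => \sum_(r <- r :: s) r%:E * @Defs.indic R dsp X (g n @^-1` [set r]) y)%E
     = fun y => (r%:E * Defs.indic R (g n @^-1` [set r]) y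
        + \sum_(r <- s) r%:E * @Defs.indic R dsp X (g n @^-1` [set r]) y)%E.
  by apply/funext => y; rewrite big_cons.
have r0 : 0 <= r by apply: pos; rewrite mem_head.
have ni : nmf (@Defs.indic R dsp X (g n @^-1` [set r])) by exact: nmf_indic.
have [|ns Qs] := IH; first by move=> t ts; apply: pos; rewrite in_cons ts orbT.
have nr : nmf (fun y => r%:E * @Defs.indic R dsp X (g n @^-1` [set r]) y)%E.
  by apply: nmfM => //; exact: nmf_cst.
split; first exact: nmfD.
by apply: (QD _ _ nr ns) => //; apply: QZ => //; exact: Qi.
Qed.

Lemma int_nmf_sup (mu : {measure set X -> \bar R}) (f : nat -> X -> \bar R) :
  (forall n, nmf (f n)) -> (forall y, nondecreasing_seq (f ^~ y)) ->
  (\int[mu]_x ereal_sup (range (f ^~ x)) = ereal_sup (range (fun n => \int[mu]_x f n x)))%E.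
Proof.
move=> nf ndf; transitivity (\int[mu]_x limn (f ^~ x))%E.
  apply: eq_integral => y _; apply/esym/cvg_lim => //.
  exact: ereal_nondecreasing_cvgn.
rewrite monotone_convergence//.
- apply/cvg_lim => //; apply: ereal_nondecreasing_cvgn => m n mn.
  by apply: int_nmf_le => // x; exact: ndf.
- by move=> n; exact: (nf n).1.
- by move=> n x _; exact: (nf n).2.
Qed.

(** Multiplication by a finite [c] is continuous; for [c = +oo] the cases of a zero and of a
    positive supremum are separated. *)
Lemma mule_sup (c : \bar R) (u : nat -> \bar R) : (0 <= c)%E ->
  (forall n, 0 <= u n)%E -> nondecreasing_seq u ->
  (ereal_sup (range u) * c = ereal_sup (range (fun n => u n * c)))%E.
Proof.
move=> c0 u0 ndu.
have nd : nondecreasing_seq (fun n => (u n * c)%E).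
  by move=> m n mn; rewrite lee_wpmul2r//; exact: ndu.
have h2 := ereal_nondecreasing_cvgn nd.
have h1 := ereal_nondecreasing_cvgn ndu.
have [cf|] := boolP (c \is a fin_num).
  rewrite -(cvg_lim _ h2)//; apply/esym/cvg_lim => //.
  exact: cvgeZr.
rewrite ge0_fin_numE// -leNgt leye_eq => /eqP ->.
have [S0|S0] := eqVneq (ereal_sup (range u)) 0%E.
  have uE n : u n = 0%E.
    apply/eqP; rewrite eq_le u0 andbT -S0.
    by apply: ereal_sup_ubound; exists n.
  rewrite S0 mul0e (_ : (fun n => _) = cst 0%E) ?ereal_sup_cst//.
    by apply/set0P; exists 0%N.
  by apply/funext => n; rewrite uE mul0e.
have Sp : (0 < ereal_sup (range u))%E.
  by rewrite lt_def S0/=; apply: le_trans (u0 0%N) _; apply: ereal_sup_ubound; exists 0%N.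
rewrite gt0_muley//; apply/esym/eqP; rewrite -leye_eq.
have [_ [n _ <-] un] := ereal_sup_gt Sp.
by apply: le_ereal_sup_tmp; exists (u n * +oo)%E; [exists n|rewrite gt0_muley].
Qed.

End NonnegInduction.

Section Density.
Context {R : realType} {dsp : measure_display} {X : measurableType dsp}.
Variables (mu : {measure set X -> \bar R}) (w : X -> \bar R).
Hypothesis nw : nmf w.

Definition density_fun (A : set X) : \bar R := (\int[mu]_(x in A) w x)%E.

Let density0 : density_fun set0 = 0%E.
Proof. exact: integral_set0. Qed.

Let density_ge0 A : (0 <= density_fun A)%E.
Proof. by apply: integral_ge0 => x _; exact: nw.2. Qed.

Let density_additive : semi_sigma_additive density_fun.
Proof.
move=> A mA tA mUA; rewrite /density_fun ge0_integral_bigcup//; last 2 first.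
- by apply: measurable_funTS; exact: nw.1.
- by move=> x _; exact: nw.2.
apply: is_cvg_ereal_nneg_natsum_cond => n _ _.
exact: density_ge0.
Qed.

Definition density : {measure set X -> \bar R} :=
  HB.pack density_fun (isMeasure.Build _ _ _ density_fun density0 density_ge0 density_additive).

Lemma densityE A : density A = (\int[mu]_(x in A) w x)%E.
Proof. by []. Qed.

Lemma int_density f : nmf f -> (\int[density]_x f x = \int[mu]_x (f x * w x))%E.
Proof.
move: f; apply: (nmf_induction (Q := fun f =>
  (\int[density]_x f x = \int[mu]_x (f x * w x))%E)).
- move=> A mA; rewrite integral_indic// setIT densityE integral_mkcond.
  apply: eq_integral => x _; rewrite /patch /Defs.indic indicE.
  by case: (x \in A); rewrite ?mul1e ?mul0e.
- move=> c f c0 nf e; rewrite int_nmfZ// e -int_nmfZ//; last exact: nmfM.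
  by apply: eq_integral => x _; rewrite muleA.
- move=> f g nf ng ef eg; rewrite int_nmfD// ef eg -int_nmfD//; try exact: nmfM.
  by apply: eq_integral => x _; rewrite ge0_muleDl// ?(nf.2, ng.2).
- move=> f nf ndf e; rewrite int_nmf_sup//.
  rewrite (_ : (fun n => _) = fun n => (\int[mu]_x (f n x * w x))%E); last exact/funext.
  rewrite -int_nmf_sup//; first last.
  + by move=> x m n mn; rewrite lee_wpmul2r ?nw.2//; exact: ndf.
  + by move=> n; exact: nmfM.
  apply: eq_integral => x _; rewrite mule_sup ?nw.2// => n.
  exact: (nf n).2.
Qed.

End Density.

Section Pushforward.
Context {R : realType} {d1 d2 : measure_display} {X : measurableType d1} {Y : measurableType d2}.
Variables (mu : {measure set X -> \bar R}) (phi : X -> Y).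
Hypothesis mphi : measurable_fun setT phi.

Definition image_fun (A : set Y) : \bar R := pushforward mu phi A.

Let measurable_preimage A : measurable A -> measurable (phi @^-1` A).
Proof. by move=> mA; rewrite -[X in measurable X]setTI; exact: mphi. Qed.

Let image0 : image_fun set0 = 0%E.
Proof. by rewrite /image_fun /pushforward preimage_set0 measure0. Qed.

Let image_ge0 A : (0 <= image_fun A)%E.
Proof. exact: measure_ge0. Qed.

Let image_additive : semi_sigma_additive image_fun.
Proof.
move=> F mF tF mUF; rewrite /image_fun /pushforward preimage_bigcup.
apply: measure_semi_sigma_additive.
- by move=> n; exact: measurable_preimage.
- apply/trivIsetP => /= i j _ _ ij; rewrite -preimage_setI.
  by move/trivIsetP : tF => /(_ _ _ _ _ ij) ->//; rewrite preimage_set0.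
- by rewrite -preimage_bigcup; exact: measurable_preimage.
Qed.

Definition image_measure : {measure set Y -> \bar R} :=
  HB.pack image_fun (isMeasure.Build _ _ _ image_fun image0 image_ge0 image_additive).

Lemma image_measureE A : image_measure A = mu (phi @^-1` A).
Proof. by []. Qed.

Lemma int_image_measure f : nmf f ->
  (\int[image_measure]_y f y = \int[mu]_x f (phi x))%E.
Proof.
move=> [mf f0].
by rewrite -[LHS]/(\int[pushforward mu phi]_y f y)%E (ge0_integral_pushforward mphi).
Qed.

Lemma nmf_comp (f : Y -> \bar R) : nmf f -> nmf (f \o phi).
Proof.
move=> [mf f0]; split; last by move=> x; exact: f0.
exact: measurableT_comp.
Qed.

End Pushforward.

(** * Borel sets and boxes *)

Section BorelBoxes.
Context {R : realType} {d : nat}.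
Implicit Types (a b x : 'rV[R]_d).

Definition box a b : set (Bor R d) :=
  [set x : Bor R d | forall i, a 0 i <= x 0 i <= b 0 i].

Lemma rV_norm_leP x (r : R) : 0 <= r -> (`|x| <= r) <-> (forall i, `|x 0 i| <= r).
Proof.
move=> r0; rewrite /Num.norm/= mx_normrE; split=> [|h].
  by move=> /bigmax_leP[_ h] i; exact: (h (0, i)).
by apply/bigmax_leP; split => // -[i j] _ /=; rewrite ord1; exact: h.
Qed.

Lemma rV_coord_le x i : `|x 0 i| <= `|x|.
Proof. by have /(rV_norm_leP x (normr_ge0 x)) := lexx `|x|; apply. Qed.

(** The norm of row vectors is the sup norm, so closed balls are cubes and [is_lebesgue] gives their
    volume. *)
Lemma box_cball a (r : R) : 0 <= r ->
  box (a - const_mx r) (a + const_mx r) = [set x : Bor R d | `|(x : 'rV[R]_d) - a| <= r].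
Proof.
move=> r0; apply/seteqP; split => x /=.
  move=> h; apply/rV_norm_leP => // i; rewrite !mxE ler_norml.
  by have := h i; rewrite !mxE => /andP[? ?]; apply/andP; split; lra.
move/rV_norm_leP => /(_ r0) h i; have := h i; rewrite !mxE ler_norml => /andP[? ?].
by apply/andP; split; lra.
Qed.

Lemma measurable_open (A : set (Bor R d)) : @open 'rV[R]_d A -> measurable A.
Proof. by move=> oA; exact: sub_sigma_algebra. Qed.

Lemma measurable_closed (A : set (Bor R d)) : @closed 'rV[R]_d A -> measurable A.
Proof.
move=> cA; rewrite -[A]setCK; apply: measurableC; apply: measurable_open.
exact: closed_openC.
Qed.

Lemma continuous_Bor_measurable (f : 'rV[R]_d -> R) : continuous f ->
  measurable_fun [set: Bor R d] f.
Proof.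
move=> cf; apply: (measurability _ (RGenOInfty.measurableE R)) => //.
move=> _ [_ [r ->] <-]; rewrite setTI; apply: measurable_open.
move/continuousP: cf; apply; rewrite set_itvE; exact: open_gt.
Qed.

Lemma measurable_coord i : measurable_fun [set: Bor R d] (fun x : Bor R d => x 0 i).
Proof. by apply: continuous_Bor_measurable; exact: coord_continuous. Qed.

Lemma measurable_box a b : measurable (box a b).
Proof.
rewrite (_ : box a b = \bigcap_(i in [set: 'I_d]) [set x : Bor R d | a 0 i <= x 0 i <= b 0 i]).
  apply: fin_bigcap_measurable => //.
  move=> i _; have := measurable_coord i measurableT (measurable_itv `[a 0 i, b 0 i]).
  by rewrite setTI; congr measurable; apply/seteqP; split => x /=; rewrite in_itv.
by apply/seteqP; split => x /= h; [move=> i _; exact: h|move=> i; exact: h].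
Qed.

Lemma boxI a b a' b' : box a b `&` box a' b' =
  box (\row_i Num.max (a 0 i) (a' 0 i)) (\row_i Num.min (b 0 i) (b' 0 i)).
Proof.
apply/seteqP; split => x /=.
  move=> [h h'] i; rewrite !mxE ge_max le_min.
  by have /andP[-> ->] := h i; have /andP[-> ->] := h' i.
by move=> h; split => i; have := h i; rewrite !mxE ge_max le_min => /andP[/andP[? ?] /andP[? ?]];
  apply/andP.
Qed.

(** The index [n] is decoded into a pair of rational corners, and the box is kept only if it lies in
    [O]. Around each point of [O] there is such a box of sup radius at most [e / 2]. *)
Lemma open_box_cover (O : set 'rV[R]_d) : open O ->
  exists F : nat -> set (Bor R d),
    O = \bigcup_n F n /\ forall n, F n = set0 \/ exists a b, F n = box a b.
Proof.
move=> oO; pose rv (q : 'rV[rat]_d) : 'rV[R]_d := map_mx ratr q.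
pose F n : set (Bor R d) := match @unpickle ('rV[rat]_d * 'rV[rat]_d)%type n with
  | Some p => if pselect (box (rv p.1) (rv p.2) `<=` O) then box (rv p.1) (rv p.2) else set0
  | None => set0 end.
exists F; split; last first.
  move=> n; rewrite /F; case: unpickle => [p|]; last by left.
  by case: pselect => /= _; [right; exists (rv p.1), (rv p.2)|left].
apply/seteqP; split => x; last first.
  by move=> [n _]; rewrite /F; case: unpickle => // p; case: pselect => // h /h.
move=> Ox; have [e /= e0 eO] : exists2 e : R, 0 < e & ball x e `<=` O.
  by apply/nbhs_ballP; exact: open_nbhs_nbhs.
have lo i : exists q : rat, x 0 i - e / 2 < ratr q < x 0 i.
  have : x 0 i - e / 2 < x 0 i by rewrite gtrBl divr_gt0.
  by move/rat_in_itvoo => [q]; rewrite in_itv; exists q.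
have hi i : exists q : rat, x 0 i < ratr q < x 0 i + e / 2.
  have : x 0 i < x 0 i + e / 2 by rewrite ltrDl divr_gt0.
  by move/rat_in_itvoo => [q]; rewrite in_itv; exists q.
pose p := (\row_i sval (cid (lo i)), \row_i sval (cid (hi i))).
have xp : box (rv p.1) (rv p.2) x.
  by move=> i; rewrite !mxE; case: cid => q /= /andP[_ /ltW ->]; case: cid => q' /= /andP[/ltW -> _].
exists (pickle p) => //; rewrite /F pickleK; case: pselect => // -[].
move=> y yp; apply: eO; rewrite -ball_normE/=; apply: (@le_lt_trans _ _ (e / 2)).
  apply/rV_norm_leP; first by rewrite divr_ge0 ?ltW.
  move=> i; have := yp i; rewrite !mxE ler_norml.
  case: cid => q /= /andP[? ?]; case: cid => q' /= /andP[? ?] /andP[? ?].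
  by apply/andP; split; lra.
by rewrite ltr_pdivrMr// ltr_pMr// ltr1n.
Qed.

(** Open sets are countable unions of boxes. This makes values on boxes determine a measure
    ([box_measure_unique]) and reduces measurability of vector-valued maps to their coordinates
    ([measurable_coords]). *)
Lemma Bor_generated : @measurable _ (Bor R d) = <<s [set box a b | a in setT & b in setT] >>.
Proof.
apply/seteqP; split.
  apply: smallest_sub; first exact: smallest_sigma_algebra.
  move=> O oO; have [F [-> FE]] := open_box_cover oO.
  apply: sigma_algebra_bigcup => n; have [->|[a [b ->]]] := FE n.
    exact: sigma_algebra0.
  by apply: sub_sigma_algebra; exists a => //; exists b.
apply: smallest_sub; first exact: sigma_algebra_measurable.
by move=> _ [a _ [b _ <-]]; exact: measurable_box.
Qed.

Lemma measurable_coords {dT} {T : measurableType dT} (f : T -> Bor R d) :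
  (forall i, measurable_fun setT (fun t => f t 0 i)) -> measurable_fun setT f.
Proof.
move=> mf; apply: (measurability _ Bor_generated).
move=> _ [_ [a _ [b _ <-]] <-]; rewrite setTI.
rewrite (_ : _ @^-1` _ = \bigcap_(i in [set: 'I_d]) [set t | a 0 i <= f t 0 i <= b 0 i]).
  apply: fin_bigcap_measurable => //.
  move=> i _; have := mf i measurableT _ (measurable_itv `[a 0 i, b 0 i]).
  by rewrite setTI; congr measurable; apply/seteqP; split => x /=; rewrite in_itv.
by apply/seteqP; split => x /= h; [move=> i _; exact: h|move=> i; exact: h].
Qed.

Lemma box_cover : \bigcup_n box (const_mx (- n%:R)) (const_mx n%:R) = [set: Bor R d].
Proof.
apply/seteqP; split => // x _; exists (Num.trunc `|x : 'rV[R]_d|).+1 => // i.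
rewrite !mxE -ler_norml; apply: (le_trans (rV_coord_le x i)).
exact/ltW/truncnS_gt.
Qed.

Lemma box_measure_unique (m1 m2 : {measure set (Bor R d) -> \bar R}) :
  (forall a b, (forall i, a 0 i <= b 0 i) -> m1 (box a b) = m2 (box a b)) ->
  (forall a b, (m1 (box a b) < +oo)%E) ->
  forall A, measurable A -> m1 A = m2 A.
Proof.
move=> e fin; apply: (measure_unique _ _ Bor_generated _ _ box_cover).
- move=> _ _ [a _ [b _ <-]] [a' _ [b' _ <-]]; rewrite boxI.
  by do 2 eexists => //; eexists.
- by move=> n; do 2 eexists => //; eexists.
- move=> _ [a _ [b _ <-]]; have [ab|] := pselect (forall i, a 0 i <= b 0 i).
    exact: e.
  move=> /existsNP[i /negP ab]; rewrite (_ : box a b = set0) ?measure0//.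
  apply/seteqP; split => // x /(_ i) /andP[ax xb]; move: ab.
  by rewrite (le_trans ax xb).
- by move=> n; exact: fin.
Qed.

End BorelBoxes.

(** * Lebesgue measure on boxes *)

Section SigmaFinitePack.
Context {R : realType} {d1 : measure_display} {X : measurableType d1}.
Variable m : {measure set X -> \bar R}.
Hypothesis s : sigma_finite setT m.

(* A copy of [m]: a fresh head constant on which structures can be declared. *)
Definition pack_fun (A : set X) : \bar R := m A.

Let pack0 : pack_fun set0 = 0%E. Proof. exact: measure0. Qed.
Let pack_ge0 A : (0 <= pack_fun A)%E. Proof. exact: measure_ge0. Qed.
Let pack_additive : semi_sigma_additive pack_fun.
Proof. exact: measure_semi_sigma_additive. Qed.

Let pack_sigma_finite : sigma_finite setT pack_fun. Proof. exact: s. Qed.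

HB.instance Definition _ := isMeasure.Build _ _ _ pack_fun pack0 pack_ge0 pack_additive.
HB.instance Definition _ := Measure_isSigmaFinite.Build _ _ _ pack_fun pack_sigma_finite.

Definition sigma_finite_pack : {sigma_finite_measure set X -> \bar R} := pack_fun.

End SigmaFinitePack.

Section Tonelli.
Context {R : realType} {d1 d2 : measure_display} {X : measurableType d1} {Y : measurableType d2}.
Variables (m1 : {measure set X -> \bar R}) (m2 : {measure set Y -> \bar R}).
Hypotheses (s1 : sigma_finite setT m1) (s2 : sigma_finite setT m2).

Let m1' := sigma_finite_pack s1.
Let m2' := sigma_finite_pack s2.

Lemma tonelli (f : X * Y -> \bar R) : nmf f ->
  (\int[m1]_x \int[m2]_y f (x, y) = \int[m2]_y \int[m1]_x f (x, y))%E.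
Proof. by move=> [mf f0]; exact: (@fubini_tonelli _ _ _ _ _ m1' m2' f mf f0). Qed.

Lemma nmf_int2 (f : X * Y -> \bar R) : nmf f -> nmf (fun x => \int[m2]_y f (x, y))%E.
Proof.
move=> [mf f0]; split; last by move=> x; apply: integral_ge0.
exact: (@measurable_fun_fubini_tonelli_F _ _ _ _ _ m2' f mf f0).
Qed.

Lemma nmf_pair1 (f : X * Y -> \bar R) x : nmf f -> nmf (fun y => f (x, y)).
Proof.
move=> [mf f0]; split => //.
by apply: (measurableT_comp mf); exact: measurable_pair1.
Qed.

Lemma nmf_pair2 (f : X * Y -> \bar R) y : nmf f -> nmf (fun x => f (x, y)).
Proof.
move=> [mf f0]; split => //.
by apply: (measurableT_comp mf); exact: measurable_pair2.
Qed.

Definition prod_measure : {measure set (X * Y) -> \bar R} := (m1' \x m2')%E.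

Lemma prod_measureE A B : measurable A -> measurable B ->
  prod_measure (A `*` B) = (m1 A * m2 B)%E.
Proof. by move=> mA mB; exact: (product_measure1E m1' m2'). Qed.

Lemma int_prod_measure f : nmf f ->
  (\int[prod_measure]_z f z = \int[m1]_x \int[m2]_y f (x, y))%E.
Proof. by move=> [mf f0]; exact: (@fubini_tonelli1 _ _ _ _ _ m1' m2' f mf f0). Qed.

End Tonelli.

Section LebesgueInvariance.
Context {R : realType} {d : nat}.
Variable (lam : {measure set (Bor R d) -> \bar R}).
Hypothesis Hl : is_lebesgue lam.

Lemma lam_box (a b : 'rV[R]_d) : (forall i, a 0 i <= b 0 i) ->
  lam (box a b) = (\prod_(i < d) (b 0 i - a 0 i))%:E.
Proof. exact: Hl. Qed.

Lemma box_empty (a b : 'rV[R]_d) : ~ (forall i, a 0 i <= b 0 i) -> box a b = set0.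
Proof.
move=> /existsNP[i /negP ab]; apply/seteqP; split => // x /(_ i) /andP[ax xb].
by move: ab; rewrite (le_trans ax xb).
Qed.

Lemma lam_box_fin (a b : 'rV[R]_d) : (lam (box a b) < +oo)%E.
Proof.
have [ab|ab] := pselect (forall i, a 0 i <= b 0 i); first by rewrite lam_box// ltry.
by rewrite box_empty// measure0.
Qed.

Lemma lam_cball (a : 'rV[R]_d) (r : R) : 0 <= r ->
  lam [set x : Bor R d | `|(x : 'rV[R]_d) - a| <= r] = ((2 * r) ^+ d)%:E.
Proof.
move=> r0; rewrite -box_cball// lam_box; last by move=> i; rewrite !mxE; lra.
congr EFin; rewrite -[d in RHS]card_ord -prodr_const; apply: eq_bigr => i _.
by rewrite !mxE; ring.
Qed.

Lemma lam_sigma_finite : sigma_finite setT lam.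
Proof.
exists (fun n => box (const_mx (- n%:R)) (const_mx n%:R)); first by rewrite box_cover.
by move=> n; split; [exact: measurable_box|exact: lam_box_fin].
Qed.

Lemma lam_setT_gt0 : (0 < lam setT)%E.
Proof.
apply: (@lt_le_trans _ _ (lam (box (0 : 'rV[R]_d) (const_mx 1)))).
  rewrite lam_box; last by move=> i; rewrite !mxE.
  by rewrite lte_fin; apply: prodr_gt0 => i _; rewrite !mxE subr0.
have mb := measurable_box (0 : 'rV[R]_d) (const_mx 1).
by apply: le_measure => //; rewrite inE.
Qed.

(** The image of [lam] under [phi] agrees with [lam] on boxes, hence on all Borel sets. *)
Lemma lam_invariant (phi : Bor R d -> Bor R d) (f : Bor R d -> \bar R) : measurable_fun setT phi ->
  (forall a b : 'rV[R]_d, (forall i, a 0 i <= b 0 i) -> lam (phi @^-1` box a b) = lam (box a b)) ->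
  nmf f -> (\int[lam]_x f (phi x) = \int[lam]_x f x)%E.
Proof.
move=> mphi e nf; rewrite -(int_image_measure lam mphi nf).
apply: eq_measure_integral => A mA _; apply: box_measure_unique => //.
  move=> a b; have [ab|ab] := pselect (forall i, a 0 i <= b 0 i); last first.
    by rewrite box_empty// measure0.
  by rewrite image_measureE e// lam_box_fin.
Qed.

Lemma measurable_addv {dT} {T : measurableType dT} (f g : T -> Bor R d) :
  measurable_fun setT f -> measurable_fun setT g ->
  measurable_fun setT (fun t => (f t : 'rV[R]_d) + (g t : 'rV[R]_d) : Bor R d).
Proof.
move=> mf mg; apply: measurable_coords => i.
rewrite (_ : (fun t => _) = fun t => f t 0 i + g t 0 i); last by apply/funext => t; rewrite mxE.
by apply: measurable_funD; exact: (measurableT_comp (measurable_coord i)).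
Qed.

Lemma measurable_scalev {dT} {T : measurableType dT} (c : R) (f : T -> Bor R d) :
  measurable_fun setT f ->
  measurable_fun setT (fun t => c *: (f t : 'rV[R]_d) : Bor R d).
Proof.
move=> mf; apply: measurable_coords => i.
rewrite (_ : (fun t => _) = fun t => c * f t 0 i); last by apply/funext => t; rewrite mxE.
by apply: measurable_funM => //; exact: (measurableT_comp (measurable_coord i)).
Qed.

Lemma measurable_oppv {dT} {T : measurableType dT} (f : T -> Bor R d) :
  measurable_fun setT f ->
  measurable_fun setT (fun t => - (f t : 'rV[R]_d) : Bor R d).
Proof.
move=> mf; have := measurable_scalev (-1) mf; congr measurable_fun.
by apply/funext => t; rewrite scaleN1r.
Qed.

Lemma int_translate (v : 'rV[R]_d) (f : Bor R d -> \bar R) : nmf f ->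
  (\int[lam]_x f ((x : 'rV[R]_d) + v)%R = \int[lam]_x f x)%E.
Proof.
move=> nf; apply: (@lam_invariant (fun x => (x : 'rV[R]_d) + v)) => //.
  by apply: measurable_addv => //; exact: measurable_cst.
move=> a b ab; rewrite (_ : _ @^-1` _ = box (a - v) (b - v)).
  rewrite !lam_box// => [|i]; last by rewrite !mxE lerD2r.
  by congr EFin; apply: eq_bigr => i _; rewrite !mxE; ring.
apply/seteqP; split => x /= h i; have := h i; rewrite !mxE => /andP[? ?];
  by apply/andP; split; lra.
Qed.

Lemma int_opp (f : Bor R d -> \bar R) : nmf f -> (\int[lam]_x f (- (x : 'rV[R]_d))%R = \int[lam]_x f x)%E.
Proof.
move=> nf; apply: (@lam_invariant (fun x => - (x : 'rV[R]_d))) => //.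
  exact: measurable_oppv.
move=> a b ab; rewrite (_ : _ @^-1` _ = box (- b) (- a)).
  rewrite !lam_box// => [|i]; last by rewrite !mxE lerN2.
  by congr EFin; apply: eq_bigr => i _; rewrite !mxE; ring.
apply/seteqP; split => x /= h i; have := h i; rewrite !mxE => /andP[? ?];
  by apply/andP; split; lra.
Qed.

End LebesgueInvariance.

(** * Total mass of the Gaussian *)

Section GaussianMass.
Context {R : realType}.

Let leb : {measure set (measurableTypeR R) -> \bar R} := @lebesgue_measure R.

Let leb_sigma_finite : sigma_finite setT leb.
Proof. exact: (@sigma_finiteT _ _ _ (@lebesgue_measure R)). Qed.

Definition consv (d : nat) (z : measurableTypeR R * Bor R d) : Bor R d.+1 :=
  \row_i (if unlift ord0 i is Some j then (z.2 : 'rV[R]_d) 0 j else (z.1 : R)).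

Lemma consv0 d z : (@consv d z : 'rV[R]_d.+1) 0 ord0 = z.1.
Proof. by rewrite mxE unlift_none. Qed.

Lemma consvS d z j : (@consv d z : 'rV[R]_d.+1) 0 (lift ord0 j) = (z.2 : 'rV[R]_d) 0 j.
Proof. by rewrite mxE liftK. Qed.

Lemma measurable_consv d : measurable_fun setT (@consv d).
Proof.
apply: measurable_coords => i; case: (unliftP ord0 i) => [j ->|->].
  rewrite (_ : (fun t => _) = fun t => (t.2 : 'rV[R]_d) 0 j); last first.
    by apply/funext => t; rewrite consvS.
  by apply: (measurableT_comp (measurable_coord j)).
rewrite (_ : (fun t => _) = fst); last by apply/funext => t; rewrite consv0.
exact: measurable_fst.
Qed.

(* A measure satisfying [is_lebesgue] is only known on boxes; the product
   structure comes from building one by induction on the dimension. *)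
Lemma lebesgue_exists (d : nat) (f : R -> R) (c : R) : measurable_fun setT f ->
  (forall x, 0 <= f x) -> (\int[leb]_x (f x)%:E)%E = c%:E ->
  exists mu : {measure set (Bor R d) -> \bar R}, is_lebesgue mu /\
    (\int[mu]_x (\prod_(i < d) f (x 0 i))%:E)%E = (c ^+ d)%:E.
Proof.
move=> mf f0 fc.
have mp d' : measurable_fun setT (fun x : Bor R d' => \prod_(i < d') f (x 0 i)).
  apply: measurable_prod => i _.
  by apply: (measurableT_comp mf); exact: measurable_coord.
have np d' : nmf (fun x : Bor R d' => (\prod_(i < d') f (x 0 i))%:E).
  by apply: nmf_fun => // x; exact: prodr_ge0.
elim: d => [|d [mu [mul muE]]].
  (* In dimension 0 every box is the whole one-point space, and its volume is the empty product
     1. *)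
  exists (dirac (0 : Bor R 0)); split.
    move=> a b _; rewrite big_ord0 /= /dirac indicE mem_set//.
    by case.
  rewrite integral_dirac//; last exact: (np 0%N).1.
  by rewrite big_ord0 expr0 diracE mem_set// mul1e.
have smu := lam_sigma_finite mul.
exists (image_measure (prod_measure leb_sigma_finite smu) (@measurable_consv d)); split.
  move=> a b ab; rewrite -[LHS]/(image_measure _ _ (box a b)) image_measureE.
  rewrite (_ : _ @^-1` _ = `[a 0 ord0, b 0 ord0]%classic `*`
    box (\row_j a 0 (lift ord0 j)) (\row_j b 0 (lift ord0 j))); last first.
    apply/seteqP; split => -[t v] /=.
      move=> h; split; first by have := h ord0; rewrite consv0 in_itv.
      by move=> j; have := h (lift ord0 j); rewrite consvS !mxE.
    rewrite in_itv => -[h1 h2] i; case: (unliftP ord0 i) => [j ->|->].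
      by rewrite consvS; have := h2 j; rewrite !mxE.
    by rewrite consv0.
  rewrite prod_measureE//; last exact: measurable_box.
  rewrite lam_box//; last by move=> i; rewrite !mxE.
  rewrite big_ord_recl EFinM; congr (_ * _)%E; last first.
    by congr EFin; apply: eq_bigr => i _; rewrite !mxE.
  rewrite [leb _](lebesgue_measure_itv `[a 0 ord0, b 0 ord0])/= lte_fin.
  case: ltP => [_|ba]; first by rewrite EFinB.
  by rewrite (@le_anti _ _ (b 0 ord0) (a 0 ord0)) ?subrr// ba ab.
rewrite int_image_measure// int_prod_measure; last first.
  exact: (nmf_comp (@measurable_consv d) (np d.+1)).
have nf : nmf (fun x : measurableTypeR R => (f x)%:E) by exact: nmf_fun.
transitivity (\int[leb]_x ((f x)%:E * (c ^+ d)%:E))%E.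
  apply: eq_integral => t _; rewrite -muE -int_nmfZ//.
  apply: eq_integral => v _; rewrite big_ord_recl consv0 EFinM.
  congr (_ * EFin _)%E; apply: eq_bigr => j _; by rewrite consvS.
have c0 : 0 <= c by rewrite -lee_fin -fc; apply: integral_ge0 => x _; rewrite lee_fin.
under eq_integral do rewrite muleC.
by rewrite int_nmfZ ?exprn_ge0// fc -EFinM exprSr.
Qed.

(** The Gaussian is a product of standard normal densities, so its mass is computed under the
    product measure of [lebesgue_exists] with [c = 1]. That measure and [lam] agree on boxes, hence
    on Borel sets. *)
Lemma int_gauss d (lam : {measure set (Bor R d) -> \bar R}) : is_lebesgue lam ->
  (\int[lam]_p (gauss p)%:E = 1)%E.
Proof.
move=> Hl; pose f := normal_pdf (0 : R) 1.
have fc : (\int[leb]_x (f x)%:E)%E = 1%:E by exact: integral_normal_pdf.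
have [mu [mul muE]] := lebesgue_exists d (measurable_normal_pdf 0 1)
  (normal_pdf_ge0 0 1) fc.
transitivity ((1 ^+ d : R)%:E); last by rewrite expr1n.
rewrite -muE.
transitivity (\int[mu]_p (gauss p)%:E)%E.
  apply: eq_measure_integral => A mA _; apply: box_measure_unique => //.
    by move=> a b ab; rewrite !lam_box.
  by move=> a b; exact: lam_box_fin.
apply: eq_integral => p _; congr EFin.
have pi2 : 0 <= 2 * pi :> R by rewrite mulr_ge0// pi_ge0.
rewrite (eq_bigr (fun i => normal_peak 1 * normal_fun 0 1 (p 0 i))); last first.
  by move=> i _; rewrite /f normal_pdfE ?oner_eq0.
rewrite big_split/= prodr_const card_ord /gauss; congr (_ * _).
  rewrite powRN (mulrC d%:R) powRrM powR12_sqrt// powR_mulrn ?sqrtr_ge0//.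
  by rewrite /normal_peak expr1n mul1r -(mulr_natl pi) exprVn.
rewrite /sqnorm -expR_sum; congr expR.
rewrite mulr_suml -sumrN; apply: eq_bigr => i _.
by rewrite subr0 expr1n; field.
Qed.

End GaussianMass.

(** * Comparing measures on balls *)

Section Regularity.
Context {R : realType} {d : nat}.
Variable m : {measure set (Bor R d) -> \bar R}.
Hypothesis mfin : (m setT < +oo)%E.

Let le_mT A : measurable A -> (m A < +oo)%E.
Proof. by move=> mA; apply: le_lt_trans mfin; apply: le_measure; rewrite ?inE. Qed.

(** The remainders decrease to [O] minus the full union, and the finite measure [m] is continuous
    from above. Halving [eps] gives the strict inequality that is reached at a finite stage. *)
Let closed_approx (O : set (Bor R d)) (F : nat -> set (Bor R d)) (eps : R) :
  0 < eps -> measurable O -> (forall n, @closed 'rV[R]_d (F n)) ->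
  (m (O `\` \bigcup_n F n) <= (eps / 2)%:E)%E ->
  exists N, (m (O `\` \big[setU/set0]_(n < N) F n) <= eps%:E)%E.
Proof.
move=> e0 mO cF le.
have mF n : measurable (F n) by exact: measurable_closed.
pose D N := O `\` \big[setU/set0]_(n < N) F n.
have mD N : measurable (D N) by apply: measurableD => //; exact: bigsetU_measurable.
have capD : \bigcap_N D N = O `\` \bigcup_n F n.
  apply/seteqP; split => x.
    move=> h; split; first by have [] := h 0%N I.
    move=> [n _ Fn]; have [_] := h n.+1 I; apply.
    by rewrite big_ord_recr/=; right.
  move=> [Ox nF] N _; split => //; rewrite -bigcup_mkord => -[n _ Fn].
  by apply: nF; exists n.
have cv : m \o D @ \oo --> m (\bigcap_N D N).
  apply: nonincreasing_cvg_mu => //; first exact: le_mT.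
    by rewrite capD; apply: measurableD => //; exact: bigcup_measurable.
  apply/nonincreasing_seqP => n; apply/subsetPset => x [Ox h]; split => // h'.
  by apply: h; rewrite big_ord_recr/=; left.
have : (m (\bigcap_N D N) < eps%:E)%E.
  by rewrite capD (le_lt_trans le)// lte_fin ltr_pdivrMr// ltr_pMr// ltr1n.
move=> lt; have [N _ /(_ N (leqnn N)) /ltW h] : \forall N \near \oo, (m (D N) < eps%:E)%E.
  by apply: (cv [set y | (y < eps%:E)%E]); apply: open_nbhs_nbhs; split => //; exact: open_ereal_lt_ereal.
by exists N.
Qed.

(** The sets that can be squeezed in this way form a sigma-algebra: for a countable union, the union
    of the inner sets may fail to be closed and is cut at a finite stage by [closed_approx]. Open
    sets belong to it as countable unions of closed boxes. *)
Lemma closed_regularity (A : set (Bor R d)) (eps : R) : measurable A -> 0 < eps ->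
  exists F O : set (Bor R d), [/\ @closed 'rV[R]_d F, @open 'rV[R]_d O,
    F `<=` A, A `<=` O & (m (O `\` F) <= eps%:E)%E].
Proof.
move=> mA; move: eps.
pose C : set (set (Bor R d)) := [set A | forall eps : R, 0 < eps ->
  exists F O : set (Bor R d), [/\ @closed 'rV[R]_d F, @open 'rV[R]_d O,
    F `<=` A, A `<=` O & (m (O `\` F) <= eps%:E)%E]].
suff : @measurable _ (Bor R d) `<=` C by move/(_ _ mA).
apply: smallest_sub.
  split.
  - move=> eps e0; exists set0, set0; split => //.
    + exact: (@closed0 'rV[R]_d).
    + by rewrite setD0 measure0 lee_fin ltW.
  - move=> B CB eps e0; have [F [V [cF oV FB BV le]]] := CB eps e0.
    exists (~` V), (~` F); split.
    + exact: open_closedC.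
    + exact: closed_openC.
    + by rewrite setTD; exact: subsetC.
    + by rewrite setTD; exact: subsetC.
    + by rewrite setDE setCK setIC -setDE.
  - move=> B CB eps e0.
    have p n : 0 < eps / 2 / (2 ^ n.+1)%:R.
      by rewrite !divr_gt0// ltr0n expn_gt0.
    have [F FP] := choice (fun n => CB n _ (p n)).
    have [V VP] := choice FP.
    have cF n : @closed 'rV[R]_d (F n) by have [] := VP n.
    have oV n : @open 'rV[R]_d (V n) by have [] := VP n.
    have mF n : measurable (F n) by exact: measurable_closed.
    have mV n : measurable (V n) by exact: measurable_open.
    have oU : @open 'rV[R]_d (\bigcup_n V n) by apply: bigcup_open.
    have mU : measurable (\bigcup_n V n) by exact: bigcupT_measurable.
    have [N NP] : exists N,
        (m ((\bigcup_n V n) `\` \big[setU/set0]_(n < N) F n) <= eps%:E)%E.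
      apply: closed_approx => //.
      apply: (@le_trans _ _ (\sum_(n <oo) m (V n `\` F n))%E).
        apply: measure_sigma_subadditive.
        - by move=> n; exact: measurableD.
        - by apply: measurableD => //; exact: bigcupT_measurable.
        - move=> x [[n _ On] nF]; exists n => //; split => // Fn; apply: nF.
          by exists n.
      apply: le_trans (epsilon_trick0 xpredT _); last by rewrite divr_ge0// ltW.
      by apply: lee_nneseries => [n _ _|n _]; [exact: measure_ge0|have [] := VP n].
    exists (\big[setU/set0]_(n < N) F n), (\bigcup_n V n); split => //.
    + by apply: closed_bigsetU => n _; exact: cF.
    + rewrite -bigcup_mkord => x [n _ Fn]; exists n => //.
      by have [_ _ FB _ _] := VP n; exact: FB.
    + move=> x [n _ Bn]; exists n => //.
      by have [_ _ _ BV _] := VP n; exact: BV.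
move=> O oO eps e0.
have [F [OE Fbox]] := open_box_cover oO.
have cF n : @closed 'rV[R]_d (F n).
  case: (Fbox n) => [->|[a [b ->]]]; first exact: (@closed0 'rV[R]_d).
  rewrite (_ : box a b = \bigcap_(i in [set: 'I_d])
     ((fun x : 'rV[R]_d => x 0 i) @^-1` `[a 0 i, b 0 i])).
    apply: closed_bigI => i _; apply: closed_comp; last exact: interval_closed.
    by move=> x _; exact: coord_continuous.
  apply/seteqP; split => x /= h; first by move=> i _ /=; rewrite in_itv; exact: h.
  by move=> i; have := h i I; rewrite /= in_itv.
have mO : measurable O by exact: measurable_open.
have [|N NP] := @closed_approx O F eps e0 mO cF.
  by rewrite -OE setDv measure0 lee_fin divr_ge0// ltW.
exists (\big[setU/set0]_(n < N) F n), O; split => //.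
- by apply: closed_bigsetU => n _; exact: cF.
- by rewrite -bigcup_mkord OE => x [n _ Fn]; exists n.
Qed.

End Regularity.

Section BallDomination.
Context {R : realType} {d : nat}.
Variables (lam mu nu : {measure set (Bor R d) -> \bar R}) (K : R).
Hypothesis Hl : is_lebesgue lam.
Hypothesis mu_fin : forall a b : 'rV[R]_d, (mu (box a b) < +oo)%E.
Hypothesis nu_fin : forall a b : 'rV[R]_d, (nu (box a b) < +oo)%E.
Hypothesis K0 : 0 <= K.

Local Notation cball z r := [set x : Bor R d | `|(x : 'rV[R]_d) - z| <= r].

Hypothesis ball_le : forall (z : 'rV[R]_d) r, 0 < r ->
  (mu (cball z r) <= K%:E * nu (cball z r))%E.

Lemma sigma_finite_box (m : {measure set (Bor R d) -> \bar R}) :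
  (forall a b : 'rV[R]_d, (m (box a b) < +oo)%E) -> sigma_finite setT m.
Proof.
move=> fin; exists (fun n => box (const_mx (- n%:R)) (const_mx n%:R)).
  by rewrite box_cover.
by move=> n; split; [exact: measurable_box|exact: fin].
Qed.

Lemma measurable_cball (z : 'rV[R]_d) (r : R) : 0 <= r -> measurable (cball z r).
Proof. by move=> r0; rewrite -box_cball//; exact: measurable_box. Qed.

Lemma measurable_near_pairs (r : R) : 0 <= r ->
  measurable [set p : Bor R d * Bor R d | `|(p.1 : 'rV[R]_d) - (p.2 : 'rV[R]_d)| <= r].
Proof.
move=> r0; have mf : measurable_fun [set: Bor R d * Bor R d]
    (fun p => (p.1 : 'rV[R]_d) - (p.2 : 'rV[R]_d) : Bor R d).
  apply: measurable_addv => //.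
  exact: measurable_oppv.
have := mf measurableT _ (measurable_cball 0 r0); rewrite setTI.
by congr measurable; apply/seteqP; split => p /=; rewrite subr0.
Qed.

Lemma eq_indic {T1 T2} (A : set T1) (B : set T2) x y : (A x <-> B y) ->
  \1_A x = \1_B y :> R.
Proof.
move=> h; rewrite !indicE; have [ax|nax] := pselect (A x).
  by rewrite !mem_set//; exact/h.
by rewrite !memNset// => by_; apply: nax; exact/h.
Qed.

Definition nbhd (F : set (Bor R d)) (s : R) : set (Bor R d) :=
  \bigcup_(w in F) @ball _ 'rV[R]_d w s.

Lemma nbhd_open F s : @open 'rV[R]_d (nbhd F s).
Proof. by apply: bigcup_open => w _; exact: ball_open. Qed.

Lemma measurable_nbhd F s : measurable (nbhd F s).
Proof. by apply: measurable_open; exact: nbhd_open. Qed.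

(* Average both sides over the centers [z] of the balls and exchange the
   integrals. *)
Lemma closed_le_nbhd (F : set (Bor R d)) (r : R) : measurable F -> 0 < r ->
  (mu F <= K%:E * nu (nbhd F (4 * r)))%E.
Proof.
move=> mF r0; have r0' := ltW r0.
pose g (A : set (Bor R d)) (p : Bor R d * Bor R d) : \bar R :=
  (\1_A p.2 * \1_[set p : Bor R d * Bor R d |
    `|(p.1 : 'rV[R]_d) - (p.2 : 'rV[R]_d)| <= r] p)%:E.
have mi (A : set (Bor R d)) : measurable A -> nmf (fun p : Bor R d * Bor R d => (\1_A p.2 : R)%:E).
  move=> mA; apply: nmf_fun => //.
  have m1 : measurable_fun setT (\1_A : Bor R d -> R) by exact: measurable_indic.
  exact: (measurableT_comp m1 measurable_snd).
have ng A : measurable A -> nmf (g A).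
  move=> mA; have := nmfM (mi A mA) (nmf_indic (measurable_near_pairs r0')).
  by congr nmf; apply/funext => p; rewrite /g EFinM.
have smu := sigma_finite_box mu_fin; have snu := sigma_finite_box nu_fin.
have slam := lam_sigma_finite Hl.
pose v : R := (2 * r) ^+ d.
have v0 : 0 < v by rewrite exprn_gt0// mulr_gt0.
(* Two orders of integration of the kernel [g]: over the centers first, every ball has the same
   volume [v], which gives [v * m A]; over [w] first, [inner1] gives the measure of [A] inside the
   ball around [z]. *)
have inner (m : {measure set (Bor R d) -> \bar R}) A : sigma_finite setT m -> measurable A ->
    (\int[lam]_z \int[m]_w g A (z, w) = v%:E * m A)%E.
  move=> sm mA; rewrite (tonelli slam sm (ng A mA)).
  transitivity (\int[m]_w (v%:E * (\1_A w)%:E))%E.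
    apply: eq_integral => w _; rewrite /g /=.
    transitivity (\int[lam]_z ((\1_A w)%:E * (\1_(cball (w : 'rV[R]_d) r) z)%:E))%E.
      by apply: eq_integral => z _; rewrite EFinM.
    rewrite int_nmfZ; [|by rewrite indicE|by apply: nmf_indic; exact: measurable_cball].
    rewrite integral_indic//; last exact: measurable_cball.
    by rewrite setIT (lam_cball Hl)// muleC.
  rewrite int_nmfZ ?(ltW v0)//; last exact: nmf_indic.
  by rewrite integral_indic// setIT.
have inner1 (m : {measure set (Bor R d) -> \bar R}) A (z : 'rV[R]_d) : measurable A ->
    (\int[m]_w g A (z, w) = m (A `&` cball z r))%E.
  move=> mA; have mAz : measurable (A `&` cball z r).
    by apply: measurableI => //; exact: measurable_cball.
  transitivity (\int[m]_w (\1_(A `&` cball z r) w)%:E)%E; last first.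
    by rewrite integral_indic// setIT.
  apply: eq_integral => w _; rewrite /g indicI/=; congr (_ * (_ : R))%:E.
  by apply: eq_indic => /=; rewrite distrC.
have mN := measurable_nbhd F (4 * r).
rewrite -(@lee_pmul2l _ v%:E)// ?lte_fin// muleCA.
rewrite -(inner mu F smu mF) -(inner nu (nbhd F (4 * r)) snu mN).
have n1 := nmf_int2 smu (ng F mF); have n2 := nmf_int2 snu (ng _ mN).
rewrite -int_nmfZ//; apply: int_nmf_le => // [|z]; first by apply: nmfM => //; exact: nmf_cst.
rewrite !inner1//.
have mb : measurable (cball (z : 'rV[R]_d) r) by exact: measurable_cball.
(* A ball that misses [F] contributes 0. A ball that meets [F] at [w] lies within [2 r] of [w],
   hence inside the [4 r]-neighbourhood, which is built from open balls. *)
have [[w [Fw zw]]|nex] := pselect (exists w : Bor R d, F w /\ `|(w : 'rV[R]_d) - z| <= r); last first.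
  rewrite (_ : F `&` _ = set0) ?measure0; last first.
    by apply/seteqP; split => // w [Fw /= zw]; apply: nex; exists w.
  by rewrite mule_ge0.
apply: (@le_trans _ _ (mu (cball (z : 'rV[R]_d) r))).
  by apply: le_measure; rewrite ?inE//; exact: measurableI.
rewrite (_ : nbhd F (4 * r) `&` _ = cball (z : 'rV[R]_d) r); first exact: ball_le.
apply/seteqP; split => [x []//|x /= xz]; split => //; exists w => //.
rewrite -ball_normE /=; apply: (@le_lt_trans _ _ (2 * r)); last by rewrite ltr_pM2r// ltr_nat.
rewrite (le_trans (ler_distD (z : 'rV[R]_d) _ _))// [`|_ - (x : 'rV[R]_d)|]distrC; lra.
Qed.

(** The radius tends to 0 in [closed_le_nbhd]. The neighbourhoods decrease to [F] because it is
    closed, and [nu] is continuous along them because the first one, of radius 1, lies in a bounded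
    box. *)
Lemma compact_le (F : set (Bor R d)) (a b : 'rV[R]_d) : @closed 'rV[R]_d F ->
  F `<=` box a b -> (mu F <= K%:E * nu F)%E.
Proof.
move=> cF Fab; have mF := measurable_closed cF.
pose r (n : nat) : R := (4 * n.+1%:R)^-1.
have r0 n : 0 < r n by rewrite invr_gt0 mulr_gt0.
pose G n := nbhd F (4 * r n).
have r4 n : 4 * r n = n.+1%:R^-1 by rewrite /r invfM mulrA mulfV ?mul1r.
have capG : \bigcap_n G n = F.
  apply/seteqP; split => x; last first.
    by move=> Fx n _; exists x => //; apply: ballxx; rewrite r4 invr_gt0.
  have Fc : (F : set 'rV[R]_d) = closure (F : set 'rV[R]_d) by apply/closure_id.
  move=> h; suff : closure (F : set 'rV[R]_d) x by rewrite -Fc.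
  move=> B /nbhs_ballP[e /= e0 eB].
  have [n _ /(_ n (leqnn n))/= ne] := near_infty_natSinv_lt (PosNum e0).
  have [w Fw wx] := h n I; exists w; split => //; apply: eB; apply: ball_sym.
  by apply: le_ball wx; rewrite r4 ltW.
have cv : nu \o G @ \oo --> nu (\bigcap_n G n).
  apply: nonincreasing_cvg_mu.
  - apply: le_lt_trans (nu_fin (a - const_mx 1) (b + const_mx 1)).
    apply: le_measure; rewrite ?inE; [exact: measurable_nbhd|exact: measurable_box|].
    move=> x [w Fw]; rewrite r4 invr1 -ball_normE /= => /ltW/(rV_norm_leP _ ler01) h i.
    have := h i; have := Fab _ Fw i; rewrite !mxE ler_norml => /andP[? ?] /andP[? ?].
    by apply/andP; split; lra.
  - by move=> n; exact: measurable_nbhd.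
  - by rewrite capG.
  - apply/nonincreasing_seqP => n; apply/subsetPset => x [w Fw wx]; exists w => //.
    by apply: le_ball wx; rewrite !r4 lef_pV2 ?posrE// ler_nat.
rewrite capG in cv.
have nuF : nu F \is a fin_num.
  rewrite ge0_fin_numE//; apply: le_lt_trans (nu_fin a b).
  by apply: le_measure; rewrite ?inE//; exact: measurable_box.
have cv' : (K%:E * nu (G n))%E @[n --> \oo] --> (K%:E * nu F)%E by exact: cvgeZl.
by apply: (cvge_to_ge cv'); apply: nearW => n; exact: closed_le_nbhd.
Qed.

(** The part of [A] in a large box is exhausted from inside by closed sets, up to [e] for the finite
    restriction of [mu] to that box; [compact_le] handles these sets, then [e] tends to 0 and the
    box grows. *)
Lemma ball_domination (A : set (Bor R d)) : measurable A -> (mu A <= K%:E * nu A)%E.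
Proof.
move=> mA; pose b n := box (const_mx (- n%:R) : 'rV[R]_d) (const_mx n%:R).
have mb n : measurable (b n) by exact: measurable_box.
have cv : (mu (A `&` b n) @[n --> \oo] --> mu A)%E.
  rewrite -[A in mu A]setIT -box_cover setI_bigcupr.
  apply: nondecreasing_cvg_mu.
  - by move=> n; exact: measurableI.
  - by apply: bigcupT_measurable => n; exact: measurableI.
  - apply/nondecreasing_seqP => n; apply/subsetPset; apply: setIS => x /= h i.
    have := h i; rewrite !mxE; have : n%:R <= n.+1%:R :> R by rewrite ler_nat.
    by move=> ? /andP[? ?]; apply/andP; split; lra.
apply: (cvge_to_le cv); apply: nearW => n.
apply/lee_addgt0Pr => e e0.
have fin : (mrestr mu (mb n) setT < +oo)%E by rewrite /mrestr setTI mu_fin.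
have [F [V [cF oV FA AV le]]] := closed_regularity fin mA e0.
have mF := measurable_closed cF; have mV := measurable_open oV.
have cb : @closed 'rV[R]_d (b n).
  rewrite (_ : b n = \bigcap_(i in [set: 'I_d])
     ((fun x : 'rV[R]_d => x 0 i) @^-1` `[- n%:R, n%:R])).
    apply: closed_bigI => i _; apply: closed_comp; last exact: interval_closed.
    by move=> x _; exact: coord_continuous.
  apply/seteqP; split => x /= h; first by move=> i _ /=; have := h i; rewrite in_itv !mxE.
  by move=> i; have := h i I; rewrite /= in_itv !mxE.
apply: (@le_trans _ _ (mu (F `&` b n) + e%:E)%E).
  apply: (@le_trans _ _ (mu (F `&` b n) + mu ((V `\` F) `&` b n))%E); last by rewrite leeD2l.
  rewrite -measureU//.
  - apply: le_measure; rewrite ?inE; [exact: measurableI| |].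
      by apply: measurableU; [exact: measurableI|apply: measurableI => //; exact: measurableD].
    move=> x [Ax bx]; have [Fx|nFx] := pselect (F x); first by left.
    by right; split => //; split => //; exact: AV.
  - exact: measurableI.
  - by apply: measurableI => //; exact: measurableD.
  - by apply/seteqP; split => // x [[Fx _] [[_ nF] _]].
rewrite leeD2r//.
apply: (@le_trans _ _ (K%:E * nu (F `&` b n))%E).
  by apply: (compact_le (closedI cF cb)); exact: subIsetr.
rewrite lee_wpmul2l ?lee_fin//; apply: le_measure; rewrite ?inE//.
  exact: measurableI.
by move=> x [/FA].
Qed.

End BallDomination.

(** * The leapfrog map *)

(** Banach's fixed point theorem, used for [leapfrogT_q_surj], asks for row vectors as a complete
    normed module. *)
HB.instance Definition _ (R : realType) (d : nat) := Complete.on 'rV[R]_d.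

Section Leapfrog.
Context {R : realType} {d : nat}.
Variables (U : 'rV[R]_d -> R) (L h : R).
Hypotheses (L0 : 0 <= L) (h0 : 0 < h).
Hypothesis gradU_lip : forall q q' : 'rV[R]_d, `|grad U q - grad U q'| <= L * `|q - q'|.

Lemma leapfrogE (q p : 'rV[R]_d) (q1 := q + h *: p - (h ^+ 2 / 2) *: grad U q) :
  leapfrog U h (q, p) = (q1, p - (h / 2) *: (grad U q + grad U q1)).
Proof.
have q1E : q + h *: (p - (h / 2) *: grad U q) = q1.
  by rewrite /q1 scalerBr addrA scalerA expr2 mulrA.
by rewrite /leapfrog /Psi1 /Psi2 /= q1E scalerDr opprD addrA.
Qed.

Lemma leapfrogTS n z : leapfrogT U h n.+1 z = leapfrog U h (leapfrogT U h n z).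
Proof. by []. Qed.

Definition flip (z : 'rV[R]_d * 'rV[R]_d) : 'rV[R]_d * 'rV[R]_d := (z.1, - z.2).

Lemma leapfrog_flip z : leapfrog U h (flip (leapfrog U h z)) = flip z.
Proof.
case: z => q p; rewrite /leapfrog /Psi1 /Psi2 /flip /=.
set p1 := p - _; set q1 := q + _.
have -> : - (p1 - (h / 2) *: grad U q1) - (h / 2) *: grad U q1 = - p1.
  by rewrite opprB addrC addKr.
have -> : q1 + h *: - p1 = q by rewrite scalerN /q1 addrK.
by rewrite /p1 opprB addrC addKr.
Qed.

Lemma leapfrogT_flip n z : leapfrogT U h n (flip (leapfrogT U h n z)) = flip z.
Proof.
elim: n z => [//|n IH] z; rewrite /leapfrogT iterSr /=.
by rewrite leapfrog_flip; exact: IH.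
Qed.

Lemma Ham_flip z : Ham U (flip z) = Ham U z.
Proof.
rewrite /Ham /flip /=; congr (_ + _ / _).
by apply: eq_bigr => i _; rewrite mxE sqrrN.
Qed.

Section Step.
Variable T : nat.
Hypotheses (T0 : (0 < T)%N) (hT : 4 * L * T%:R ^+ 2 * h ^+ 2 <= 1).

(** Without force the momentum difference would stay [p - p'] and the position difference would be
    [h i (p - p')]. The force moves the momentum difference by at most [D / (2 T)] per step, hence
    by half of [D] in [T] steps. The two bounds feed each other and share one induction. *)
Lemma leap_diff (q p p' : 'rV[R]_d) i (D := `|p - p'|) : (i <= T)%N ->
  `|(leapfrogT U h i (q, p)).2 - (leapfrogT U h i (q, p')).2 - (p - p')|
    <= i%:R / (2 * T%:R) * D /\
  `|(leapfrogT U h i (q, p)).1 - (leapfrogT U h i (q, p')).1 - (h * i%:R) *: (p - p')|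
    <= h * i%:R / 2 * D.
Proof.
have t0 : 0 < T%:R :> R by rewrite ltr0n.
have D0 : 0 <= D by exact: normr_ge0.
(* The assumed bound gives [|x - x'| <= 3/2 h T D], rounded up to [2 h T D]; the Lipschitz bound and
   [4 L T^2 h^2 <= 1] then turn this into [D / (2 T)]. *)
have grad_bound (x x' : 'rV[R]_d) j : (j <= T)%N ->
    `|x - x' - (h * j%:R) *: (p - p')| <= h * j%:R / 2 * D ->
    h * `|grad U x - grad U x'| <= (2 * T%:R)^-1 * D.
  move=> jT xx.
  have jt : j%:R <= T%:R :> R by rewrite ler_nat.
  have hj : h * j%:R <= h * T%:R by rewrite ler_pM2l.
  have hj0 : 0 <= h * j%:R by rewrite mulr_ge0// ltW.
  have x2 : `|x - x'| <= 2 * (h * T%:R) * D.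
    rewrite -[x - x'](subrK ((h * j%:R) *: (p - p'))).
    rewrite (le_trans (ler_normD _ _))//.
    rewrite normrZ (ger0_norm hj0) -/D.
    have := ler_wpM2r D0 hj; have := mulr_ge0 hj0 D0; lra.
  apply: (@le_trans _ _ (h * (L * (2 * (h * T%:R) * D)))).
    by rewrite ler_pM2l// (le_trans (gradU_lip _ _))// ler_wpM2l.
  rewrite (_ : h * _ = (2 * L * T%:R * h ^+ 2) * D); last by ring.
  rewrite ler_wpM2r// -[_^-1]mul1r ler_pdivlMr ?mulr_gt0//.
  by apply: le_trans hT; rewrite le_eqVlt; apply/orP; left; apply/eqP; ring.
elim: i => [_|i IH iT].
  by rewrite /= !mulr0 !mul0r scale0r !subr0 subrr normr0 subrr normr0.
have [] := IH (ltnW iT).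
rewrite !leapfrogTS; case: (leapfrogT U h i (q, p)) => x v.
case: (leapfrogT U h i (q, p')) => x' v'.
rewrite !leapfrogE; set x1 := x + h *: v - _; set x1' := x' + h *: v' - _ => /= vle xle.
have g1 := grad_bound _ _ _ (ltnW iT) xle.
have it : i%:R + 1 <= T%:R :> R by rewrite natr1 ler_nat.
have x1le : `|x1 - x1' - (h * i.+1%:R) *: (p - p')| <= h * i.+1%:R / 2 * D.
  have -> : x1 - x1' - (h * i.+1%:R) *: (p - p') =
     (x - x' - (h * i%:R) *: (p - p')) + h *: (v - v' - (p - p'))
     - (h / 2) *: (h *: (grad U x - grad U x')).
    rewrite /x1 /x1'; move: (grad U x) (grad U x') => a a'.
    by apply/rowP => k; rewrite !mxE -(natr1 i); field.
  apply: le_trans (ler_normB _ _) _.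
  apply: le_trans (lerD (ler_normD _ _) (lexx _)) _.
  rewrite !normrZ (gtr0_norm h0) ger0_norm ?divr_ge0 ?(ltW h0)//.
  have a := ler_wpM2l (ltW h0) vle.
  have b : h / 2 * (h * `|grad U x - grad U x'|) <= h / 2 * ((2 * T%:R)^-1 * D).
    by rewrite ler_wpM2l// divr_ge0// ltW.
  (* The momentum error so far and the half kick add up to [(i + 1/2) / T], which is at most 1
     because [i + 1 <= T]. *)
  have c : h * (i%:R / (2 * T%:R) * D) + h / 2 * ((2 * T%:R)^-1 * D) <= h / 2 * D.
    have -> : h * (i%:R / (2 * T%:R) * D) + h / 2 * ((2 * T%:R)^-1 * D) =
      h / 2 * ((i%:R + 2^-1) / T%:R * D) by field; rewrite gt_eqF.
    rewrite ler_wpM2l ?divr_ge0 ?(ltW h0)// ler_piMl// ler_pdivrMr// mul1r; lra.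
  rewrite -(natr1 i) mulrDr mulr1 !mulrDl; lra.
clearbody x1 x1'; split => //.
have g2 := grad_bound _ _ _ iT x1le.
have -> : v - (h / 2) *: (grad U x + grad U x1) - (v' - (h / 2) *: (grad U x' + grad U x1'))
     - (p - p') = (v - v' - (p - p')) - 2^-1 *: (h *: (grad U x - grad U x'))
     - 2^-1 *: (h *: (grad U x1 - grad U x1')).
  move: (grad U x) (grad U x') (grad U x1) (grad U x1') => a a' b b'.
  by apply/rowP => k; rewrite !mxE; field.
apply: le_trans (ler_normB _ _) _.
apply: le_trans (lerD (ler_normB _ _) (lexx _)) _.
rewrite !normrZ (gtr0_norm h0) ger0_norm ?invr_ge0//.
rewrite -(natr1 i) [(_ + 1) / _]mulrDl [(_ + _) * D]mulrDl mul1r; move: vle g1 g2.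
move: `|v - v' - _| `|grad U x - _| `|grad U x1 - _| => a b c.
move: (i%:R / _ * D) (_^-1 * D) => s t; lra.
Qed.

Let G q p := leapfrogT_q U h T (q, p).
Let c := h * T%:R.

Let c0 : 0 < c.
Proof. by rewrite mulr_gt0// ltr0n. Qed.

Lemma leapfrogT_q_near q p p' :
  `|G q p - G q p' - (h * T%:R) *: (p - p')| <= h * T%:R / 2 * `|p - p'|.
Proof. by have [] := leap_diff q p p' (leqnn T). Qed.

Lemma leapfrogT_q_lower q p p' : h * T%:R / 2 * `|p - p'| <= `|G q p - G q p'|.
Proof.
have := leapfrogT_q_near q p p'; rewrite -/c => le.
have := lerB_dist (c *: (p - p')) (G q p - G q p').
rewrite distrC normrZ (gtr0_norm c0); lra.
Qed.

Lemma leapfrogT_q_upper q p p' : `|G q p - G q p'| <= 2 * (h * T%:R) * `|p - p'|.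
Proof.
have := leapfrogT_q_near q p p'; rewrite -/c => le.
have := lerB_dist (G q p - G q p') (c *: (p - p')).
rewrite normrZ (gtr0_norm c0) => le2.
have := mulr_ge0 (ltW c0) (normr_ge0 (p - p')); lra.
Qed.

(** A preimage of [y] is a fixed point of [p - (G q p - y) / c], which is a contraction of ratio
    [1/2] by [leapfrogT_q_near]. *)
Lemma leapfrogT_q_surj q y : exists p, G q p = y.
Proof.
pose f p := p - c^-1 *: (G q p - y).
have ff : set_fun setT setT f by [].
pose f' : {fun [set: 'rV[R]_d] >-> [set: 'rV[R]_d]} := HB.pack f (isFun.Build _ _ _ _ f ff).
have [|||p _ pE] := @banach_fixed_point R 'rV[R]_d setT f'.
- exists (2^-1)%:nng; split; first by rewrite /= invf_lt1// ltr1n.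
  move=> [p p'] _ /=; rewrite /f.
  have -> : p - c^-1 *: (G q p - y) - (p' - c^-1 *: (G q p' - y)) =
     - (c^-1 *: (G q p - G q p' - c *: (p - p'))).
    rewrite [in RHS]scalerBr scalerA mulVf ?gt_eqF// scale1r.
    by apply/rowP => k; rewrite !mxE; ring.
  rewrite normrN normrZ gtr0_norm ?invr_gt0// ler_pdivrMl//.
  by have := leapfrogT_q_near q p p'; rewrite -/c mulrA.
- exact: closedT.
- by exists 0.
exists p; move/eqP: pE; rewrite /= /f -subr_eq0 opprB addrC subrK scaler_eq0.
by rewrite invr_eq0 gt_eqF//= subr_eq0 => /eqP.
Qed.

End Step.

Lemma gradU_continuous : continuous (grad U).
Proof.
have L1 : 0 < L + 1 by rewrite ltr_wpDl.
move=> x A /nbhs_ballP[e /= e0 eA].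
suff : nbhs x (grad U @^-1` A) by [].
apply/nbhs_ballP; exists (e / (L + 1)); first by rewrite /= divr_gt0.
move=> y; rewrite -ball_normE /= => xy; apply: eA; rewrite -ball_normE /=.
apply: le_lt_trans (gradU_lip _ _) _.
apply: (@le_lt_trans _ _ ((L + 1) * `|x - y|)); first by rewrite ler_wpM2r// lerDl.
by rewrite mulrC -ltr_pdivlMr.
Qed.

Lemma leapfrogT_bounded n (k : R) : exists k' : R, forall z : 'rV[R]_d * 'rV[R]_d,
  `|z.1| <= k -> `|z.2| <= k ->
  `|(leapfrogT U h n z).1| <= k' /\ `|(leapfrogT U h n z).2| <= k'.
Proof.
have grad_le (x : 'rV[R]_d) b : `|x| <= b -> `|grad U x| <= `|grad U 0| + L * b.
  move=> xb; rewrite -[grad U x](subrK (grad U 0)) addrC.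
  apply: le_trans (ler_normD _ _) _; rewrite lerD2l.
  by apply: le_trans (gradU_lip _ _) _; rewrite subr0 ler_wpM2l.
elim: n => [|n [k1 IH]]; first by exists k.
pose g1 := `|grad U 0| + L * k1.
pose k2 := k1 + h * k1 + h ^+ 2 / 2 * g1.
pose g2 := `|grad U 0| + L * k2.
exists (Num.max k2 (k1 + h / 2 * (g1 + g2))) => z z1 z2.
rewrite leapfrogTS; have [] := IH z z1 z2.
case: (leapfrogT U h n z) => x v; rewrite leapfrogE.
set x1 := x + h *: v - _ => /= xk vk.
have hh : 0 <= h / 2 by rewrite divr_ge0// ltW.
have hh2 : 0 <= h ^+ 2 / 2 by rewrite divr_ge0// exprn_ge0// ltW.
have x1k : `|x1| <= k2.
  apply: le_trans (ler_normB _ _) _; apply: lerD; last first.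
    by rewrite normrZ ger0_norm// ler_wpM2l// grad_le.
  apply: le_trans (ler_normD _ _) _; apply: lerD => //.
  by rewrite normrZ gtr0_norm// ler_wpM2l// ltW.
clearbody x1; split; rewrite le_max; first by rewrite x1k.
apply/orP; right; apply: le_trans (ler_normB _ _) _; apply: lerD => //.
rewrite normrZ ger0_norm// ler_wpM2l//.
by apply: le_trans (ler_normD _ _) _; apply: lerD; exact: grad_le.
Qed.

End Leapfrog.

(** * Radon-Nikodym densities *)

Section MeasurePacks.
Context {R : realType} {dsp : measure_display} {X : measurableType dsp}.
Variable m : {measure set X -> \bar R}.

Section Probability.
Hypothesis m1 : m setT = 1%E.

Definition prob_fun (A : set X) : \bar R := m A.

Let prob0 : prob_fun set0 = 0%E. Proof. exact: measure0. Qed.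
Let prob_ge0 A : (0 <= prob_fun A)%E. Proof. exact: measure_ge0. Qed.
Let prob_additive : semi_sigma_additive prob_fun.
Proof. exact: measure_semi_sigma_additive. Qed.
Let prob_setT : prob_fun setT = 1%E. Proof. exact: m1. Qed.

HB.instance Definition _ := isMeasure.Build _ _ _ prob_fun prob0 prob_ge0 prob_additive.
HB.instance Definition _ := Measure_isProbability.Build _ _ _ prob_fun prob_setT.

Definition probability_pack : probability X R := prob_fun.

End Probability.

Section Finite.
Hypothesis mfin : (m setT < +oo)%E.

Definition fin_fun (A : set X) : \bar R := m A.

Let fin0 : fin_fun set0 = 0%E. Proof. exact: measure0. Qed.
Let fin_ge0 A : (0 <= fin_fun A)%E. Proof. exact: measure_ge0. Qed.
Let fin_additive : semi_sigma_additive fin_fun.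
Proof. exact: measure_semi_sigma_additive. Qed.
Let fin_finite : fin_num_fun fin_fun.
Proof.
move=> A mA; rewrite ge0_fin_numE; last exact: measure_ge0.
by apply: le_lt_trans mfin; apply: le_measure; rewrite ?inE.
Qed.

HB.instance Definition _ := isMeasure.Build _ _ _ fin_fun fin0 fin_ge0 fin_additive.
HB.instance Definition _ := Measure_isFinite.Build _ _ _ fin_fun fin_finite.

Definition finite_pack : {finite_measure set X -> \bar R} := fin_fun.

End Finite.
End MeasurePacks.

Lemma int_dominated {R : realType} {dsp} {X : measurableType dsp}
  (mu nu : {measure set X -> \bar R}) (k : R) (f : X -> \bar R) : 0 <= k ->
  (forall A, measurable A -> (mu A <= k%:E * nu A)%E) -> nmf f ->
  (\int[mu]_x f x <= k%:E * \int[nu]_x f x)%E.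
Proof.
move=> k0 le; move: f; apply: (nmf_induction (Q := fun f =>
  (\int[mu]_x f x <= k%:E * \int[nu]_x f x)%E)).
- by move=> A mA; rewrite !integral_indic// !setIT; exact: le.
- move=> c f c0 nf fle; rewrite !int_nmfZ// muleCA lee_wpmul2l ?lee_fin//.
- move=> f g nf ng fle gle; rewrite !int_nmfD//.
  by rewrite ge0_muleDr ?leeD//; apply: integral_ge0 => x _; [exact: nf.2|exact: ng.2].
- move=> f nf ndf fle; rewrite int_nmf_sup//; apply: ge_ereal_sup => _ [n _ <-].
  apply: le_trans (fle n) _; rewrite lee_wpmul2l ?lee_fin//.
  apply: int_nmf_le => [//||x]; first exact: nmf_sup.
  by apply: ereal_sup_ubound; exists n.
Qed.

Lemma density_exists {R : realType} {dsp} {X : measurableType dsp}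
  (P : probability X R) (nu : {measure set X -> \bar R}) : (nu setT < +oo)%E ->
  (forall A, measurable A -> P A = 0%E -> nu A = 0%E) ->
  exists u : X -> R, [/\ measurable_fun setT u, forall x, 0 <= u x &
    forall f, nmf f -> (\int[nu]_x f x = \int[P]_x ((u x)%:E * f x))%E].
Proof.
move=> fin ac.
have dom : finite_pack fin `<< P.
  by apply/null_content_dominatesP => A mA PA; exact: ac.
have [g [g0 gfin gint gE]] := radon_nikodym_sigma_finite dom.
have mg : measurable_fun setT g := measurable_int _ gint.
have eg x : g x = (fine (g x))%:E by rewrite fineK.
exists (fine \o g); split.
- apply/measurable_EFinP; apply: eq_measurable_fun mg => x _; exact: eg.
- by move=> x; exact: fine_ge0.
- move=> f nf; have ng : nmf g by [].
  transitivity (\int[density P ng]_x f x)%E.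
    by apply: eq_measure_integral => A mA _; exact: gE.
  rewrite int_density//; apply: eq_integral => x _ /=.
  by rewrite -eg muleC.
Qed.

(** * Volume preservation *)

Section HMCMeasurability.
Context {R : realType} {d : nat}.
Variables (U : 'rV[R]_d -> R) (h : R).
Hypothesis U_cont : continuous U.
Hypothesis gradU_cont : continuous (grad U).

Local Notation X := (Bor R d).

Lemma measurable_U : measurable_fun [set: X] (U : X -> R).
Proof. exact: continuous_Bor_measurable. Qed.

Lemma measurable_gradU : measurable_fun [set: X] (grad U : X -> X).
Proof.
apply: measurable_coords => i; apply: continuous_Bor_measurable => x.
apply: (@continuous_comp _ _ _ (grad U) (fun v : 'rV[R]_d => v 0 i)).
  exact: gradU_cont.
exact: coord_continuous.
Qed.

Lemma measurable_sqnorm : measurable_fun [set: X] (@sqnorm R d : X -> R).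
Proof.
apply: measurable_sum => i; apply: measurable_funX; exact: measurable_coord.
Qed.

Lemma measurable_gauss : measurable_fun [set: X] (@gauss R d : X -> R).
Proof.
apply: measurable_funM; first exact: measurable_cst.
apply: (measurableT_comp (@measurable_expR R)); apply: measurableT_comp => //.
by apply: measurable_funM => //; exact: measurable_sqnorm.
Qed.

Lemma gauss_gt0 (p : 'rV[R]_d) : 0 < gauss p.
Proof. by rewrite mulr_gt0// ?expR_gt0// powR_gt0// mulr_gt0// pi_gt0. Qed.

Lemma measurable_Psi1 : measurable_fun [set: X * X] (Psi1 U h : X * X -> X * X).
Proof.
apply: measurable_fun_pair; first exact: measurable_fst.
apply: measurable_addv; first exact: measurable_snd.
apply: measurable_oppv; apply: measurable_scalev.
by apply: (measurableT_comp measurable_gradU); exact: measurable_fst.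
Qed.

Lemma measurable_Psi2 : measurable_fun [set: X * X] (Psi2 h : X * X -> X * X).
Proof.
apply: measurable_fun_pair; last exact: measurable_snd.
apply: measurable_addv; first exact: measurable_fst.
by apply: measurable_scalev; exact: measurable_snd.
Qed.

Lemma measurable_flip : measurable_fun [set: X * X] (flip : X * X -> X * X).
Proof.
apply: measurable_fun_pair; first exact: measurable_fst.
by apply: measurable_oppv; exact: measurable_snd.
Qed.

Lemma measurable_leapfrogT n :
  measurable_fun [set: X * X] (leapfrogT U h n : X * X -> X * X).
Proof.
elim: n => [|n IH]; first exact: measurable_id.
apply: (measurableT_comp measurable_Psi1).
apply: (measurableT_comp measurable_Psi2).
exact: (measurableT_comp measurable_Psi1).
Qed.

Lemma measurable_Ham : measurable_fun [set: X * X] (Ham U : X * X -> R).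
Proof.
apply: measurable_funD.
  by apply: (measurableT_comp measurable_U); exact: measurable_fst.
apply: measurable_funM; last exact: measurable_cst.
by apply: (measurableT_comp measurable_sqnorm); exact: measurable_snd.
Qed.

Variable T : nat.

Definition accept (z : X * X) : R := alphaH U z (leapfrogT U h T z).

Lemma measurable_accept : measurable_fun [set: X * X] accept.
Proof.
apply: measurable_minr; first exact: measurable_cst.
apply: (measurableT_comp (@measurable_expR R)); apply: measurable_funB.
  exact: measurable_Ham.
exact: (measurableT_comp measurable_Ham (measurable_leapfrogT T)).
Qed.

Lemma accept_gt0 z : 0 < accept z.
Proof. by rewrite /accept /alphaH lt_min ltr01 expR_gt0. Qed.

Lemma accept_le1 z : accept z <= 1.
Proof. by rewrite /accept /alphaH ge_min lexx. Qed.

Lemma nmf_move : nmf (fun z : X * X => (accept z * gauss z.2)%:E).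
Proof.
apply: nmf_fun => [|z]; last by rewrite mulr_ge0// ltW ?accept_gt0 ?gauss_gt0.
apply: measurable_funM; first exact: measurable_accept.
by apply: (measurableT_comp measurable_gauss); exact: measurable_snd.
Qed.

Lemma nmf_stay : nmf (fun z : X * X => ((1 - accept z) * gauss z.2)%:E).
Proof.
apply: nmf_fun => [|z]; last by rewrite mulr_ge0 ?subr_ge0 ?accept_le1// ltW ?gauss_gt0.
apply: measurable_funM.
  by apply: measurable_funB; [exact: measurable_cst|exact: measurable_accept].
by apply: (measurableT_comp measurable_gauss); exact: measurable_snd.
Qed.

Lemma measurable_position : measurable_fun [set: X * X]
  (fun z => leapfrogT_q U h T z : X).
Proof. exact: (measurableT_comp measurable_fst (measurable_leapfrogT T)). Qed.

Variable lam : {measure set X -> \bar R}.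
Hypothesis Hl : is_lebesgue lam.

Let slam := lam_sigma_finite Hl.

Definition phase_int (F : X * X -> \bar R) : \bar R :=
  (\int[lam]_q \int[lam]_p F (q, p))%E.

(** At fixed [q] the map translates the momentum; likewise [Psi2] translates the position at fixed
    [p], after the order of integration is exchanged. *)
Lemma phase_int_Psi1 (F : X * X -> \bar R) : nmf F -> phase_int (F \o Psi1 U h) = phase_int F.
Proof.
move=> nF; apply: eq_integral => q _ /=.
exact: (int_translate Hl (- ((h / 2) *: grad U (q : 'rV[R]_d))) (nmf_pair1 q nF)).
Qed.

Lemma phase_int_Psi2 (F : X * X -> \bar R) : nmf F -> phase_int (F \o Psi2 h) = phase_int F.
Proof.
move=> nF; have nF2 := nmf_comp measurable_Psi2 nF.
rewrite /phase_int (tonelli slam slam nF2) (tonelli slam slam nF).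
apply: eq_integral => p _ /=.
exact: (int_translate Hl (h *: (p : 'rV[R]_d)) (nmf_pair2 p nF)).
Qed.

Lemma phase_int_flip (F : X * X -> \bar R) : nmf F -> phase_int (F \o flip) = phase_int F.
Proof.
move=> nF; apply: eq_integral => q _ /=.
exact: (int_opp Hl (nmf_pair1 q nF)).
Qed.

Lemma phase_int_leapfrogT n (F : X * X -> \bar R) : nmf F -> phase_int (F \o leapfrogT U h n) = phase_int F.
Proof.
elim: n F => [//|n IH] F nF.
have n1 := nmf_comp measurable_Psi1 nF.
have n2 := nmf_comp measurable_Psi2 n1.
have n3 := nmf_comp measurable_Psi1 n2.
transitivity (phase_int (((F \o Psi1 U h) \o Psi2 h) \o Psi1 U h)); last first.
  by rewrite (phase_int_Psi1 n2) (phase_int_Psi2 n1) (phase_int_Psi1 nF).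
exact: (IH _ n3).
Qed.

Lemma phase_int_reverse (F : X * X -> \bar R) : nmf F ->
  phase_int (F \o flip \o leapfrogT U h T) = phase_int F.
Proof.
move=> nF; rewrite (phase_int_leapfrogT T (nmf_comp measurable_flip nF)).
exact: phase_int_flip.
Qed.

(** Density on phase space of the accepted moves in stationarity: the density of pi at the position,
    times the Gaussian density of the momentum, times the acceptance probability. *)
Definition target (Z : R) (z : X * X) : R :=
  expR (- U z.1) / Z * (accept z * gauss z.2).

Lemma target_reverse Z z : target Z (flip (leapfrogT U h T z)) = target Z z.
Proof.
rewrite /target /accept leapfrogT_flip /alphaH !Ham_flip /gauss.
set z' := leapfrogT U h T z.
set c := powR _ _.
have e y r : expR (- U y.1) / Z * (r * (c * expR (- (sqnorm y.2 / 2)))) =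
   c / Z * (r * expR (- Ham U y)).
  by rewrite /Ham opprD expRD; ring.
(* The acceptance probability times [exp(-H)] at the start is the minimum of [exp(-H)] at both ends,
   which is symmetric in the two ends. *)
have m (a b : R) : Num.min 1 (expR (a - b)) * expR (- a) = Num.min (expR (- a)) (expR (- b)).
  rewrite minr_pMl ?expR_ge0// mul1r -expRD.
  by congr (Num.min _ (expR _)); ring.
by rewrite !e Ham_flip !m minC.
Qed.

End HMCMeasurability.

(** * The HMC kernel *)

Section HMCChain.
Context {R : realType} {d : nat}.
Variables (U : 'rV[R]_d -> R) (L h : R) (T : nat).
Variable lam : {measure set (Bor R d) -> \bar R}.
Hypotheses (L0 : 0 <= L) (h0 : 0 < h) (T0 : (0 < T)%N).
Hypothesis hT : 4 * L * T%:R ^+ 2 * h ^+ 2 <= 1.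
Hypothesis gradU_lip : forall q q' : 'rV[R]_d, `|grad U q - grad U q'| <= L * `|q - q'|.
Hypothesis U_cont : continuous U.
Hypothesis Hl : is_lebesgue lam.
Hypothesis U_int : (\int[lam]_x (expR (- U x))%:E < +oo)%E.

Local Notation X := (Bor R d).
Local Notation cball z r := [set x : X | `|(x : 'rV[R]_d) - z| <= r].

Let gradU_cont : continuous (grad U).
Proof. exact: gradU_continuous L0 gradU_lip. Qed.
Let mposition := measurable_position h gradU_cont T.
Let mv := nmf_move h U_cont gradU_cont T.
Let st := nmf_stay h U_cont gradU_cont T.
Let slam := lam_sigma_finite Hl.

Let pos (q p : X) : X := leapfrogT_q U h T (q, p).
Let c := h * T%:R.
Let c0 : 0 < c. Proof. by rewrite mulr_gt0// ltr0n. Qed.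

Let mpos q : measurable_fun setT (pos q).
Proof. exact: (measurableT_comp mposition (measurable_pair1 q)). Qed.

Let image q := image_measure lam (mpos q).

(** Two points of the preimage have images at distance at most [2 r], hence lie within [4 r / c] of
    each other by [leapfrogT_q_lower]: the preimage fits in a ball of that radius around any of its
    points. *)
Lemma image_cball_le q (z : 'rV[R]_d) (r : R) : 0 < r ->
  (image q (cball z r) <= ((4 / c) ^+ d)%:E * lam (cball z r))%E.
Proof.
move=> r0; rewrite image_measureE (lam_cball Hl _ (ltW r0)) -EFinM -exprMn.
have [[y yz]|ne] := pselect (exists y, cball z r (pos q y)); last first.
  rewrite (_ : _ @^-1` _ = set0) ?measure0; last first.
    by apply/seteqP; split => // y yz; apply: ne; exists y.
  have ? := ltW c0; have ? := ltW r0.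
  by rewrite lee_fin exprn_ge0//; apply: mulr_ge0; [exact: divr_ge0|exact: mulr_ge0].
have r2 : 0 <= 4 * r / c by rewrite ltW// divr_gt0// mulr_gt0.
rewrite (_ : 4 / c * (2 * r) = 2 * (4 * r / c)); last by ring.
rewrite -(lam_cball Hl y r2); apply: le_measure; rewrite ?inE.
- rewrite -[X in measurable X]setTI; apply: mpos => //.
  by apply: measurable_cball; exact: ltW.
- exact: measurable_cball.
move=> p /= pz; rewrite ler_pdivlMr// mulrC.
have := leapfrogT_q_lower L0 h0 gradU_lip T0 hT q p y; rewrite -/c.
have : `|pos q p - pos q y| <= 2 * r.
  rewrite -[pos q p](subrK z) -addrA (le_trans (ler_normD _ _))//.
  by move: yz pz; rewrite /= [`|z - _|]distrC; lra.
rewrite /pos; set a := `|_ - _ : 'rV[R]_d|; set b := `|_ - _ : 'rV[R]_d| => ab ba; lra.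
Qed.

(** By [leapfrogT_q_upper] the preimage contains the ball of radius [r / (2 c)] around a preimage of
    the center, which exists by surjectivity. *)
Lemma cball_le_image q (z : 'rV[R]_d) (r : R) : 0 < r ->
  (lam (cball z r) <= ((2 * c) ^+ d)%:E * image q (cball z r))%E.
Proof.
move=> r0; have [y yz] := leapfrogT_q_surj L0 h0 gradU_lip T0 hT q z.
have c20 : 0 < 2 * c by rewrite mulr_gt0.
have c2 := ltW c20.
have r2 : 0 <= r / (2 * c) by rewrite ltW// divr_gt0// mulr_gt0.
rewrite [image q _]image_measureE (lam_cball Hl z (ltW r0)).
rewrite (_ : 2 * r = 2 * c * (2 * (r / (2 * c)))); last by field; rewrite gt_eqF.
rewrite (exprMn _ (2 * c) (2 * (r / (2 * c)))) EFinM lee_wpmul2l ?lee_fin ?exprn_ge0//.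
rewrite -(lam_cball Hl y r2); apply: le_measure; rewrite ?inE.
- exact: measurable_cball.
- rewrite -[X in measurable X]setTI; apply: mpos => //.
  by apply: measurable_cball; exact: ltW.
move=> p /=; rewrite ler_pdivlMr// mulrC => py.
have := leapfrogT_q_upper L0 h0 gradU_lip T0 hT q p y; rewrite -/c yz.
by move/le_trans; apply.
Qed.

Lemma image_box_fin q (a b : 'rV[R]_d) : (image q (box a b) < +oo)%E.
Proof.
have r0 : 0 < `|a| + `|b| + 1 by rewrite ltr_wpDl// addr_ge0.
have mc : measurable (cball (0 : 'rV[R]_d) (`|a| + `|b| + 1)).
  by apply: measurable_cball; exact: ltW.
apply: (@le_lt_trans _ _ (image q (cball (0 : 'rV[R]_d) (`|a| + `|b| + 1)))).
  apply: le_measure; rewrite ?inE//; first exact: measurable_box.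
  move=> x xab /=; rewrite subr0; apply/rV_norm_leP => [|i]; first exact: ltW.
  have := xab i; have := rV_coord_le a i; have := rV_coord_le b i.
  by rewrite !ler_norml => /andP[? ?] /andP[? ?] /andP[? ?]; apply/andP; split; lra.
by apply: le_lt_trans (image_cball_le q _ r0) _; rewrite (lam_cball Hl _ (ltW r0)) -EFinM ltry.
Qed.

Lemma image_le q A : measurable A -> (image q A <= ((4 / c) ^+ d)%:E * lam A)%E.
Proof.
apply: (ball_domination Hl (image_box_fin q) (lam_box_fin Hl)).
  by rewrite exprn_ge0// divr_ge0// ltW.
exact: image_cball_le.
Qed.

Lemma le_image q A : measurable A -> (lam A <= ((2 * c) ^+ d)%:E * image q A)%E.
Proof.
apply: (ball_domination Hl (lam_box_fin Hl) (image_box_fin q)).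
  by rewrite exprn_ge0// mulr_ge0// ltW.
exact: cball_le_image.
Qed.

Lemma int_expU_pos : exists2 Z : R, 0 < Z & (\int[lam]_x (expR (- U x))%:E)%E = Z%:E.
Proof.
have mE : measurable_fun [set: X] (fun x : X => (expR (- U x))%:E).
  apply/measurable_EFinP; apply: (measurableT_comp (@measurable_expR R)).
  by apply: measurableT_comp => //; exact: measurable_U.
have i0 : (0 <= \int[lam]_x (expR (- U x))%:E)%E.
  by apply: integral_ge0 => x _; rewrite lee_fin expR_ge0.
exists (fine (\int[lam]_x (expR (- U x))%:E)%E); last by rewrite fineK// ge0_fin_numE.
rewrite fine_gt0// U_int andbT lt_def i0 andbT; apply/eqP => I0.
have : (\int[lam]_x `|(expR (- U x))%:E| = 0)%E.
  by rewrite -I0; apply: eq_integral => x _; rewrite gee0_abs// lee_fin expR_ge0.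
move/(ae_eq_integral_abs lam measurableT mE).
rewrite /ae_eq => -[N [mN N0 sub]].
have NT : N = setT.
  apply/seteqP; split => // x _; apply: sub => /= /(_ I) [] /eqP.
  by rewrite gt_eqF// expR_gt0.
by have := lam_setT_gt0 Hl; rewrite -NT N0 ltxx.
Qed.

Let Z := fine (\int[lam]_y (expR (- U y))%:E)%E.

Let Z0 : 0 < Z.
Proof. by have [z z0 zE] := int_expU_pos; rewrite /Z zE. Qed.

Let wpi (x : X) : \bar R := (expR (- U x) / Z)%:E.

Let nwpi : nmf wpi.
Proof.
apply: nmf_fun => [|x]; last by rewrite divr_ge0 ?expR_ge0// ltW.
apply: measurable_funM; last exact: measurable_cst.
apply: (measurableT_comp (@measurable_expR R)).
by apply: measurableT_comp => //; exact: measurable_U.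
Qed.

Let wpi_gt0 x : (0 < wpi x)%E.
Proof. by rewrite lte_fin divr_gt0// expR_gt0. Qed.

Let density_setT : density lam nwpi setT = 1%E.
Proof.
rewrite densityE /wpi; have [z z0 zE] := int_expU_pos.
have zZ : Z = z by rewrite /Z zE.
have nE : nmf (fun x : X => (expR (- U x))%:E).
  apply: nmf_fun => [|x]; last exact: expR_ge0.
  apply: (measurableT_comp (@measurable_expR R)).
  by apply: measurableT_comp => //; exact: measurable_U.
transitivity (\int[lam]_x ((Z^-1)%:E * (expR (- U x))%:E))%E.
  by apply: eq_integral => x _; rewrite -EFinM mulrC.
by rewrite int_nmfZ ?invr_ge0 ?(ltW Z0)// zE -EFinM zZ mulVf// gt_eqF.
Qed.

Definition target_prob : probability X R := probability_pack density_setT.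

Lemma target_probE A : target_prob A = piU U lam A.
Proof. by []. Qed.

Lemma int_target f : nmf f -> (\int[target_prob]_x f x = \int[lam]_x (f x * wpi x))%E.
Proof. exact: (int_density lam nwpi). Qed.

(** The density of pi is positive everywhere. This gives both the absolute continuity of the moving
    part and the irreducibility with respect to [lam]. *)
Lemma target_null A : measurable A -> target_prob A = 0%E -> lam A = 0%E.
Proof.
move=> mA; rewrite target_probE /piU => PA.
have mw : measurable_fun A wpi by apply: measurable_funTS; exact: nwpi.1.
have : (\int[lam]_(x in A) `|wpi x| = 0)%E.
  by rewrite -[RHS]PA; apply: eq_integral => x _; rewrite gee0_abs// nwpi.2.
move/(ae_eq_integral_abs lam mA mw) => -[N [mN N0 sub]].
apply: (subset_measure0 mA mN) => // x Ax; apply: sub => /= /(_ Ax) /eqP.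
by rewrite gt_eqF// wpi_gt0.
Qed.

Lemma target_pos A : measurable A -> (0 < lam A)%E -> (0 < target_prob A)%E.
Proof.
move=> mA lA; rewrite lt0e measure_ge0 andbT; apply/eqP => /(target_null mA) l0.
by move: lA; rewrite l0 ltxx.
Qed.

Lemma stay_move q :
  (\int[lam]_p (accept U h T (q, p) * gauss (p : 'rV[R]_d))%:E +
   \int[lam]_p ((1 - accept U h T (q, p)) * gauss (p : 'rV[R]_d))%:E = 1)%E.
Proof.
rewrite -(int_gauss Hl) -(int_nmfD lam (nmf_pair1 q mv) (nmf_pair1 q st)).
by apply: eq_integral => p _ /=; rewrite -EFinD; congr EFin; ring.
Qed.

Let K := HMCop U lam h T.

Lemma HMCopE f q : K f q = (\int[lam]_p (f (pos q p) *
    (accept U h T (q, p) * gauss (p : 'rV[R]_d))%:E) +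
  f q * \int[lam]_p ((1 - accept U h T (q, p)) * gauss (p : 'rV[R]_d))%:E)%E.
Proof. by []. Qed.

Lemma HMC_meas f : nmf f -> measurable_fun setT (K f).
Proof.
move=> nf; have nF := nmfM (nmf_comp mposition nf) mv.
apply: (nmfD (nmf_int2 slam nF) _).1; apply: nmfM => //.
exact: (nmf_int2 slam st).
Qed.

(** The accepted momenta, pushed to the end position, form the measure [nu], which [image_le] and
    [target_null] make absolutely continuous with respect to pi; [u] is its Radon-Nikodym density.
    Its mass [a] is positive because the integrand is positive everywhere, so [r = 1 - a] is below
    1. *)
Lemma HMC_rep q : exists (u : X -> R) (r : R),
  [/\ measurable_fun setT u, forall y, 0 <= u y, 0 <= r < 1,
      (\int[target_prob]_y (u y)%:E)%E = (1 - r)%:E &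
      forall f, nmf f ->
        K f q = (\int[target_prob]_y ((u y)%:E * f y) + r%:E * f q)%E].
Proof.
have nw := nmf_pair1 q mv.
pose nu := image_measure (density lam nw) (mpos q).
have sm := stay_move q.
have i0 : (0 <= \int[lam]_p (accept U h T (q, p) * gauss (p : 'rV[R]_d))%:E)%E.
  by apply: integral_ge0 => p _; exact: nw.2.
have j0 : (0 <= \int[lam]_p ((1 - accept U h T (q, p)) * gauss (p : 'rV[R]_d))%:E)%E.
  by apply: integral_ge0 => p _; exact: (nmf_pair1 q st).2.
have nuT : nu setT = (\int[lam]_p (accept U h T (q, p) * gauss (p : 'rV[R]_d))%:E)%E.
  by rewrite image_measureE preimage_setT densityE.
have iN0 : (\int[lam]_p (accept U h T (q, p) * gauss (p : 'rV[R]_d))%:E)%E != 0%E.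
  apply/eqP => I0.
  have : (\int[lam]_p `|(accept U h T (q, p) * gauss (p : 'rV[R]_d))%:E| = 0)%E.
    by rewrite -I0; apply: eq_integral => p _; rewrite gee0_abs// nw.2.
  move/(ae_eq_integral_abs lam measurableT nw.1) => -[N [mN N0 sub]].
  have NT : N = setT.
    apply/seteqP; split => // p _; apply: sub => /= /(_ I) [] /eqP.
    by rewrite gt_eqF// mulr_gt0// ?accept_gt0 ?gauss_gt0.
  by have := lam_setT_gt0 Hl; rewrite -NT N0 ltxx.
have [a [r [aE rE ar a0 r0]]] : exists a r : R,
    [/\ (\int[lam]_p (accept U h T (q, p) * gauss (p : 'rV[R]_d))%:E)%E = a%:E,
    (\int[lam]_p ((1 - accept U h T (q, p)) * gauss (p : 'rV[R]_d))%:E)%E = r%:E,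
    a + r = 1, 0 < a & 0 <= r].
  have i1 := leeDl (\int[lam]_p (accept U h T (q, p) * gauss (p : 'rV[R]_d))%:E)%E j0.
  have j1 := leeDr (\int[lam]_p ((1 - accept U h T (q, p)) * gauss (p : 'rV[R]_d))%:E)%E i0.
  rewrite sm in i1 j1; move: sm i0 j0 iN0 i1 j1.
  case: (\int[lam]_p _)%E => // a; case: (\int[lam]_p _)%E => // r [ar].
  rewrite !lee_fin => a0 r0 aN0 _ _.
  by exists a, r; split => //; rewrite lt_def a0 andbT.
have nufin : (nu setT < +oo)%E by rewrite nuT aE ltry.
have ac A : measurable A -> target_prob A = 0%E -> nu A = 0%E.
  move=> mA /(target_null mA) lA.
  have l0 : lam (pos q @^-1` A) = 0%E.
    have := image_le q mA; rewrite lA mule0 image_measureE => le0.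
    by apply/eqP; rewrite eq_le le0 measure_ge0.
  rewrite image_measureE densityE; apply: null_set_integral => //.
  - by rewrite -[X in measurable X]setTI; exact: mpos.
  - by apply: measurable_funTS; exact: nw.1.
have [u [mu u0 uE]] := density_exists nufin ac.
have intu : (\int[target_prob]_y (u y)%:E)%E = a%:E.
  rewrite -aE -nuT -[LHS](_ : \int[target_prob]_y ((u y)%:E * 1) = _)%E; last first.
    by apply: eq_integral => y _; rewrite mule1.
  by rewrite -(uE (fun=> 1%E)) ?integral_cst ?mul1e//; exact: nmf_cst.
exists u, r; split => //.
- by rewrite r0/=; lra.
- by rewrite intu; congr EFin; lra.
- move=> f nf; rewrite HMCopE rE muleC; congr (_ + _)%E.
  rewrite -(uE f nf) [RHS](int_image_measure (density lam nw) (mpos q) nf).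
  exact/esym/(int_density lam nw (nmf_comp (mpos q) nf)).
Qed.

Lemma HMC_rev f g : nmf f -> nmf g ->
  (\int[target_prob]_x (f x * K g x) = \int[target_prob]_x (g x * K f x))%E.
Proof.
move=> nf ng.
have tgt0 z : 0 <= target U h T Z z.
  by rewrite mulr_ge0 ?divr_ge0 ?expR_ge0 ?(ltW Z0)// mulr_ge0// ltW// ?accept_gt0 ?gauss_gt0.
have nt : nmf (fun z : X * X => (target U h T Z z)%:E).
  have := nmfM (nmf_comp measurable_fst nwpi) mv.
  by congr nmf; apply/funext => z; rewrite /target /wpi EFinM.
have nfst k : nmf k -> nmf (fun z : X * X => k z.1).
  by move=> nk; exact: (nmf_comp measurable_fst nk).
pose F (a b : X -> \bar R) (z : X * X) : \bar R :=
  (a z.1 * (b (leapfrogT_q U h T z) * (target U h T Z z)%:E))%E.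
have nF a b : nmf a -> nmf b -> nmf (F a b).
  move=> na nb; apply: nmfM; first exact: nfst.
  by apply: nmfM => //; exact: (nmf_comp mposition nb).
have nS q := nmf_pair1 q st.
pose s (q : X) := (\int[lam]_p ((1 - accept U h T (q, p)) * gauss (p : 'rV[R]_d))%:E)%E.
have ns : nmf s by exact: (nmf_int2 slam st).
have split_int a b : nmf a -> nmf b -> (\int[target_prob]_x (a x * K b x) =
    phase_int lam (F a b) + \int[lam]_q (a q * b q * (s q * wpi q)))%E.
  move=> na nb; have nK : nmf (K b).
    split; first exact: HMC_meas.
    move=> q; have nw := nmf_pair1 q (nmfM (nmf_comp mposition nb) mv).
    rewrite HMCopE adde_ge0//; first by apply: integral_ge0 => p _; exact: nw.2.
    by rewrite mule_ge0 ?nb.2// ns.2.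
  rewrite (int_target (nmfM na nK)) -int_nmfD; last 2 first.
  - exact: (nmf_int2 slam (nF _ _ na nb)).
  - by apply: nmfM; exact: nmfM.
  apply: eq_integral => q _.
  have nb1 := nmf_pair1 q (nmfM (nmf_comp mposition nb) mv).
  have i0 : (0 <= \int[lam]_p (b (pos q p) *
     (accept U h T (q, p) * gauss (p : 'rV[R]_d))%:E))%E.
    by apply: integral_ge0 => p _; exact: nb1.2.
  rewrite HMCopE ge0_muleDr//; last by rewrite mule_ge0 ?nb.2// ns.2.
  rewrite ge0_muleDl; last 2 first.
  - by rewrite mule_ge0 ?na.2.
  - by rewrite !mule_ge0 ?na.2 ?nb.2 ?ns.2.
  congr (_ + _)%E; last by rewrite !muleA.
  rewrite muleAC -ge0_integralZl//; first last.
  - by rewrite mule_ge0 ?na.2 ?nwpi.2.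
  - by move=> p _; exact: nb1.2.
  - exact: nb1.1.
  apply: eq_integral => p _; rewrite /F /target /wpi /= -/(pos q p) EFinM.
  by rewrite -muleA; congr (_ * _)%E; rewrite muleCA.
rewrite !split_int//; congr (_ + _)%E; last first.
  by apply: eq_integral => q _; rewrite (muleC (f q)).
(* The holding parts are symmetric in [f] and [g]. In the moving part, going to the endpoint and
   flipping the momentum keeps [target] and exchanges the start and end positions, which turns
   [F f g] into [F g f]. *)
rewrite -(phase_int_reverse h gradU_cont T Hl (nF _ _ nf ng)).
congr phase_int; apply/funext => z; rewrite /F /= target_reverse.
rewrite /leapfrogT_q leapfrogT_flip /=.
by rewrite muleCA.
Qed.

Lemma U_bounded (r : R) : exists B : R, forall x : 'rV[R]_d, `|x| <= r -> `|U x| <= B.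
Proof.
have [r0|r0] := ltP r 0.
  by exists 0 => x xr; have := le_lt_trans (le_trans (normr_ge0 x) xr) r0; rewrite ltxx.
pose A := [set x : 'rV[R]_d | `|x| <= r].
have cA : compact A.
  apply: bounded_closed_compact.
    by exists r; split; [exact: num_real|move=> M rM x /= xr; rewrite (le_trans xr)// ltW].
  apply: (@closed_comp _ _ (fun x : 'rV[R]_d => `|x|) [set y | y <= r]).
    by move=> x _; exact: norm_continuous.
  exact: closed_le.
have cU : continuous (fun x => `|U x|).
  move=> x; apply: (@continuous_comp _ _ _ U (fun y : R => `|y|)); first exact: U_cont.
  exact: norm_continuous.
have [|b _ bmax] := @EVT_max_rV R d (fun x => `|U x|) A _ cA (continuous_subspaceT cU).
  by exists 0; rewrite /A /= normr0.
by exists `|U b| => x xr; apply: bmax; rewrite inE.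
Qed.

Lemma sqnorm_le (p : 'rV[R]_d) (k : R) : `|p| <= k -> sqnorm p <= d%:R * k ^+ 2.
Proof.
move=> pk; rewrite /sqnorm -[d in d%:R]card_ord -sum1_card natr_sum mulr_suml.
apply: ler_sum => i _; rewrite mul1r -real_normK ?num_real//.
by rewrite lerXn2r ?nnegrE// ?(le_trans (rV_coord_le p i) pk)// (le_trans (normr_ge0 p)).
Qed.

Lemma sqnorm_ge0 (p : 'rV[R]_d) : 0 <= sqnorm p.
Proof. by apply: sumr_ge0 => i _; exact: sqr_ge0. Qed.

(** Bounded end positions force a bounded momentum: by [leapfrogT_q_lower], [c / 2 * |p|] is at most
    the distance between the endpoints reached with [p] and with zero momentum. Here [k1] bounds the
    latter endpoint, [k2] the momentum, [k3] the final state, [B] the potential at both ends and [m]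
    the energy gain. *)
Lemma move_lower (k : R) : exists2 e : R, 0 < e & forall q p : 'rV[R]_d,
  `|q| <= k -> `|leapfrogT_q U h T (q, p)| <= k ->
  e <= accept U h T (q, p) * gauss p.
Proof.
have [k1 k1P] := leapfrogT_bounded L0 h0 gradU_lip T (Num.max k 0).
pose k2 := 2 / c * (k + k1).
have [k3 k3P] := leapfrogT_bounded L0 h0 gradU_lip T (Num.max k k2).
have [B BP] := U_bounded (Num.max k k3).
pose m := 2 * B + d%:R * k3 ^+ 2 / 2.
exists (Num.min 1 (expR (- m)) *
   (powR (2 * pi) (- (d%:R / 2)) * expR (- (d%:R * k2 ^+ 2 / 2)))).
  rewrite mulr_gt0 ?lt_min ?ltr01 ?expR_gt0// mulr_gt0 ?expR_gt0// powR_gt0//.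
  by rewrite mulr_gt0// pi_gt0.
move=> q p qk posk.
have pk2 : `|p| <= k2.
  have q1 : `|q| <= Num.max k 0 by rewrite le_max qk.
  have q2 : `|0 : 'rV[R]_d| <= Num.max k 0 by rewrite normr0 le_max lexx orbT.
  have [q0 _] := k1P (q, 0) q1 q2.
  have := leapfrogT_q_lower L0 h0 gradU_lip T0 hT q p 0; rewrite -/c subr0.
  have := ler_normB (leapfrogT_q U h T (q, p)) (leapfrogT_q U h T (q, 0)).
  move=> le1 le2; rewrite /k2 mulrAC ler_pdivlMr// mulrC.
  move: le1 le2 posk q0; rewrite /leapfrogT_q.
  move: `|_ - _ : 'rV[R]_d| `|p| `|(leapfrogT U h T (q, p)).1| `|(leapfrogT U h T (q, 0)).1|.
  move=> a b e f; lra.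
have q3 : `|q| <= Num.max k k2 by rewrite le_max qk.
have p3 : `|p| <= Num.max k k2 by rewrite le_max pk2 orbT.
have [z1 z2] := k3P (q, p) q3 p3.
have U1 : `|U q| <= B by apply: BP; rewrite le_max qk.
have U2 : `|U (leapfrogT U h T (q, p)).1| <= B by apply: BP; rewrite le_max z1 orbT.
have pi0 : 0 <= powR (2 * pi) (- (d%:R / 2)) :> R by exact: powR_ge0.
apply: ler_pM.
- by rewrite le_min ler01 expR_ge0.
- by rewrite mulr_ge0// expR_ge0.
- rewrite /accept /alphaH le_min !ge_min lexx/= ler_expR; apply/orP; right.
  have := sqnorm_le z2; have := sqnorm_ge0 p.
  rewrite /Ham /m; move: U1 U2; rewrite !ler_norml /=.
  move: (U q) (U _) (sqnorm p) (sqnorm _) => a b e f /andP[? ?] /andP[? ?]; lra.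
- rewrite /gauss ler_wpM2l// ler_expR lerN2 ler_wpM2r ?invr_ge0//.
  exact: sqnorm_le.
Qed.

Lemma HMC_minor : exists C : nat -> set X,
  [/\ forall n, measurable (C n), nondecreasing_seq C, \bigcup_n C n = setT &
    forall n, exists2 e : R, 0 < e & forall x f, C n x -> nmf f ->
      (e%:E * \int[target_prob]_(y in C n) f y <= K f x)%E].
Proof.
pose C (n : nat) : set X := [set x : X | `|x : 'rV[R]_d| <= n%:R].
have mC n : measurable (C n).
  have := @measurable_cball R d 0 n%:R (ler0n _ _).
  by congr measurable; apply/seteqP; split => x; rewrite /C /= subr0.
exists C; split => //.
- by move=> m n mn; apply/subsetPset => x; rewrite /C /= => xm; rewrite (le_trans xm)// ler_nat.
- apply/seteqP; split => // x _; exists (Num.trunc `|x : 'rV[R]_d|).+1 => //.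
  exact/ltW/truncnS_gt.
move=> n; have [e e0 eP] := move_lower n%:R; have [B BP] := U_bounded n%:R.
pose k := (2 * c) ^+ d; pose M := expR B / Z.
have k0 : 0 < k by rewrite exprn_gt0// mulr_gt0.
have M0 : 0 < M by rewrite divr_gt0// expR_gt0.
(* [M] bounds the density of pi on [C n], [k] compares [lam] with its image under the position map,
   and [e] bounds from below the weight of moves that stay in [C n]. *)
exists (e / (k * M)); first by rewrite divr_gt0// mulr_gt0.
move=> x f Cx nf; pose g (y : X) : \bar R := (f y * (\1_(C n) y)%:E)%E.
have ng : nmf g by apply: nmfM => //; exact: nmf_indic.
have ngp := nmf_comp (mpos x) ng.
have nmv := nmf_pair1 x mv.
have le1 : (\int[target_prob]_(y in C n) f y <= M%:E * \int[lam]_y g y)%E.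
  rewrite integral_mkcond (_ : \int[_]_x _ = \int[target_prob]_x g x)%E; last first.
    apply: eq_integral => y _; rewrite /patch /g indicE.
    by case: (y \in C n); rewrite ?mule1 ?mule0.
  rewrite (int_target ng) -int_nmfZ ?(ltW M0)//.
  apply: int_nmf_le => [||y]; [exact: nmfM|apply: nmfM => //; apply: nmf_cst; exact: ltW|].
  rewrite muleC /g indicE; have [/set_mem yC|_] := boolP (y \in C n); last by rewrite !mule0.
  rewrite !mule1; apply: lee_wpmul2r; first exact: nf.2.
  rewrite lee_fin ler_wpM2r ?invr_ge0 ?(ltW Z0)// ler_expR.
  by have := BP _ yC; rewrite ler_norml => /andP[? _]; rewrite lerNl.
have le2 : (\int[lam]_y g y <= k%:E * \int[lam]_p g (pos x p))%E.
  rewrite -(int_image_measure lam (mpos x) ng); apply: int_dominated => //; first exact: ltW.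
  exact: le_image.
have le3 : (e%:E * \int[lam]_p g (pos x p) <= K f x)%E.
  rewrite -int_nmfZ ?(ltW e0)// HMCopE.
  apply: (@le_trans _ _ (\int[lam]_p (f (pos x p) *
      (accept U h T (x, p) * gauss (p : 'rV[R]_d))%:E))%E); last first.
    rewrite leeDl// mule_ge0 ?nf.2//; apply: integral_ge0 => p _.
    exact: (nmf_pair1 x st).2.
  apply: int_nmf_le.
  - by apply: nmfM => //; apply: nmf_cst; exact: ltW.
  - exact: (nmfM (nmf_comp (mpos x) nf) nmv).
  - move=> p; rewrite /g muleCA indicE.
    have [/set_mem pC|_] := boolP (pos x p \in C n); last first.
      by rewrite mule0 mule0 mule_ge0 ?nf.2 ?nmv.2.
    by rewrite mule1 lee_wpmul2l ?nf.2// lee_fin; exact: eP.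
apply: le_trans le3.
have i0 : (0 <= \int[lam]_p g (pos x p))%E by apply: integral_ge0 => p _; exact: ngp.2.
apply: (@le_trans _ _ ((e / (k * M))%:E * (M%:E * (k%:E * \int[lam]_p g (pos x p))))%E).
  have eM : 0 <= e / (k * M) by rewrite ltW// divr_gt0// mulr_gt0.
  apply: lee_wpmul2l; first by rewrite lee_fin.
  by apply: (le_trans le1); apply: lee_wpmul2l; [rewrite lee_fin ltW|exact: le2].
rewrite !muleA -!EFinM (_ : e / (k * M) * M * k = e)//.
by field; rewrite !gt_eqF.
Qed.

Lemma HMC_rev_chain : rev_chain target_prob K.
Proof.
by split; [exact: HMC_meas|exact: HMC_rep|exact: HMC_rev|exact: HMC_minor].
Qed.

Lemma HMC_irr_measure : irr_measure K lam.
Proof.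
split; first exact: (lam_setT_gt0 Hl); split; first exact: slam.
by move=> A mA lA; apply: (accessible_pos HMC_rev_chain mA); exact: target_pos.
Qed.

Lemma HMC_ergodic : [/\ irreducible K, irr_measure K lam, aperiodic K,
  harris_recurrent K &
  forall q, tv_dist K (piU U lam) n q @[n --> \oo] --> 0%E].
Proof.
split.
- by exists lam; exact: HMC_irr_measure.
- exact: HMC_irr_measure.
- exact: (rev_chain_aperiodic HMC_rev_chain).
- exact: (rev_chain_harris HMC_rev_chain).
- by move=> q; exact: (tv_convergence HMC_rev_chain).
Qed.

End HMCChain.

(** * Euclidean norm against sup norm, and the choice of the step size *)

Section EuclideanNorm.
Context {R : realType} {d : nat}.

Lemma norm_le_enorm (v : 'rV[R]_d) : `|v| <= enorm v.
Proof.
apply/rV_norm_leP => [|i]; first exact: sqrtr_ge0.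
rewrite -sqrtr_sqr ler_wsqrtr// /sqnorm (bigD1 i)//= lerDl.
by apply: sumr_ge0 => j _; exact: sqr_ge0.
Qed.

Lemma enorm_le_norm (v : 'rV[R]_d) : enorm v <= d%:R * `|v|.
Proof.
have dv : 0 <= d%:R * `|v| by rewrite mulr_ge0.
rewrite -[leRHS]ger0_norm// -sqrtr_sqr ler_wsqrtr//.
apply: (le_trans (sqnorm_le (lexx _))); rewrite exprMn ler_wpM2r ?sqr_ge0//.
by rewrite -natrX ler_nat; case: (d) => // n; rewrite expnS expn1 leq_pmulr.
Qed.

End EuclideanNorm.
Theorem theorem2 (R : realType) (d : nat) (beta : R) (U : 'rV[R]_d -> R)
  (lam : {measure set (Bor R d) -> \bar R}) :
  is_lebesgue lam ->
  0 <= beta <= 1 ->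
  C2 U ->
  (\int[lam]_(x in [set: Bor R d]) (expR (- U x))%:E < +oo)%E ->
  (exists L1 : R, 0 <= L1 /\
     forall q q' : 'rV[R]_d, enorm (grad U q - grad U q') <= L1 * enorm (q - q')) ->
  (exists M1 : R, 0 <= M1 /\
     forall q : 'rV[R]_d, enorm (grad U q) <= M1 * (1 + powR (enorm q) beta)) ->
  forall T : nat, (0 < T)%N ->
  exists ht : R, 0 < ht /\
    forall h : R, 0 < h <= ht ->
      [/\ irreducible (HMCop U lam h T),
          irr_measure (HMCop U lam h T) lam,
          aperiodic (HMCop U lam h T),
          harris_recurrent (HMCop U lam h T) &
          forall q : Bor R d,
            tv_dist (HMCop U lam h T) (piU U lam) n q @[n --> \oo] --> 0%E].
Proof.
move=> Hl _ [dU [_ _]] U_int [L1 [L10 lip]] _ T T0.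
(* The factor [d] is the cost of passing from the Euclidean norm to the sup norm. *)
pose L := L1 * d%:R.
have L0 : 0 <= L by rewrite mulr_ge0.
have gradU_lip (q q' : 'rV[R]_d) : `|grad U q - grad U q'| <= L * `|q - q'|.
  apply: le_trans (norm_le_enorm _) _; apply: le_trans (lip q q') _.
  by rewrite -mulrA ler_wpM2l// enorm_le_norm.
have U_cont : continuous U by move=> q; exact/differentiable_continuous/dU.
pose a := 4 * L * T%:R ^+ 2.
have a0 : 0 <= a by rewrite !mulr_ge0.
have a1 : 0 < a + 1 by rewrite ltr_wpDl.
(* The added 1 makes the inverse meaningful when [a = 0] and forces [h <= 1], so that
   [a h^2 <= a h <= 1]. *)
exists (a + 1)^-1; split; first by rewrite invr_gt0.
move=> h /andP[h0 hle]; apply: (HMC_ergodic L0 h0 T0 _ gradU_lip U_cont Hl U_int).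
have h1 : h * (a + 1) <= 1 by rewrite -ler_pdivlMr// mul1r.
have h2 : h <= 1 by apply: le_trans h1; rewrite ler_pMr// lerDr.
rewrite -/a expr2 mulrA; have := mulr_ge0 a0 (ltW h0); nra.
Qed.
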